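(* There exist an online algorithm and an absolute constant $C>0$ such that for every instance of online minimum-cost metric perfect matching with i.i.d. arrivals (defined below) with $n$ servers, the algorithm's expected cost satisfies $\mathbb{E}[\mathrm{ALG}] \le C\cdot \max\{1,(\log\log\log n)^2\}\cdot \mathbb{E}[\mathrm{OPT}]$. That is, there is an $O((\log\log\log n)^2)$-competitive algorithm for this problem.
   Context: Online minimum-cost metric perfect matching with (known) i.i.d. arrivals: an instance consists of a finite metric space $(X,d)$, $n$ servers located at points $s_1,\dots,s_n\in X$ (not necessarily distinct), and a known probability distribution $\mathcal{D}$ over $X$. Then $n$ requests $r_1,\dots,r_n$ arrive one at a time, each drawn independently from $\mathcal{D}$. Upon arrival, each request must immediately and irrevocably be matched to a currently unmatched server, incurring cost equal to the distance between the request's location and the server's location. $\mathrm{ALG}$ denotes the total cost incurred by the algorithm, and $\mathrm{OPT}$ denotes the cost of a minimum-cost perfect matching between the realized requests and the servers (computed offline with knowledge of all requests). Expectations are over the requests and the algorithm's internal randomness. An algorithm is $\alpha$-competitive if $\mathbb{E}[\mathrm{ALG}]\le \alpha\,\mathbb{E}[\mathrm{OPT}]$ on every instance. *)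

(* Defs.v *)
From HB Require Import structures.
From mathcomp Require Import all_boot all_order all_algebra all_fingroup.
From mathcomp Require Import all_classical all_reals all_analysis.

Set Implicit Arguments.
Unset Strict Implicit.
Unset Printing Implicit Defensive.

Import Order.TTheory GRing.Theory Num.Theory.
Local Open Scope classical_set_scope.
Local Open Scope ring_scope.

(* The distance is [mdist]; the uniform structure inherited from [metricType]
   plays no role.  To build an instance on a finType, use [isMetric.Build]. *)
#[short(type="finMetricType")]
HB.structure Definition FinMetric (K : numDomainType) :=
  {X of Finite X & Metric K X}.

Record instance (R : realType) (n : nat) := Instance {
  point : finMetricType R ;
  server : 'I_n -> point ;
  req_law : point -> R ;
  req_law_ge0 : forall x, 0 <= req_law x ;
  req_law_sum1 : \sum_x req_law x = 1
}.

Definition requests (R : realType) (n : nat) (I : instance R n) :=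
  {ffun 'I_n -> point I}.

(* Expectation over n requests drawn independently from [req_law]. *)
Definition iid_expectation (R : realType) (n : nat) (I : instance R n)
    (f : requests I -> R) : R :=
  \sum_(r : requests I) (\prod_i req_law (r i)) * f r.

Definition matching_cost (R : realType) (n : nat) (I : instance R n)
    (r : requests I) (m : 'I_n -> 'I_n) : R :=
  \sum_i mdist (r i) (server I (m i)).

(* The identity matching is only the starting value of the minimum. *)
Definition OPT (R : realType) (n : nat) (I : instance R n)
    (r : requests I) : R :=
  \big[Num.min/matching_cost r id]_(s : 'S_n) matching_cost r s.

(* [assign w r i] is the server matched to the i-th request when the internal
   randomness is [w] and the request sequence is [r]. By [assign_online] it
   depends only on requests 0, ..., i; by [assign_unmatched] it is still free
   when request i arrives. The seed is independent of the requests, see [ALG]. *)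
Record policy (R : realType) (n : nat) (I : instance R n) := Policy {
  seed_display : measure_display ;
  seed : measurableType seed_display ;
  seed_law : probability seed R ;
  assign : seed -> requests I -> 'I_n -> 'I_n ;
  measurable_assign : forall r i j, measurable [set w | assign w r i = j] ;
  assign_online : forall w (r r' : requests I) (i : 'I_n),
    (forall j : 'I_n, (j <= i)%N -> r j = r' j) ->
    assign w r i = assign w r' i ;
  assign_unmatched : forall w r (i j : 'I_n),
    (j < i)%N -> assign w r i != assign w r j
}.

Definition ALG (R : realType) (n : nat) (I : instance R n) (A : policy I)
    (w : seed A) (r : requests I) : R :=
  matching_cost r (assign w r).

(* The instance, including the law of the requests, is known in advance. *)
Definition online_algorithm (R : realType) :=
  forall (n : nat) (I : instance R n), policy I.

(* Product of the law of the seed with the law of the i.i.d. requests. *)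
Definition expected_ALG (R : realType) (n : nat) (I : instance R n)
    (A : policy I) : \bar R :=
  'E_(seed_law A)[fun w => iid_expectation (ALG (A := A) w)]%E.

Definition expected_OPT (R : realType) (n : nat) (I : instance R n) : R :=
  iid_expectation (@OPT R n I).

(* Main.v *)
Require Import Defs.
From mathcomp Require Import all_boot all_order all_algebra all_fingroup.
From mathcomp Require Import all_classical all_reals all_analysis.
From mathcomp Require Import finset ring lra zify.
Local Open Scope ring_scope.

Set Implicit Arguments.
Unset Strict Implicit.
Unset Printing Implicit Defensive.

Import Order.TTheory GRing.Theory Num.Theory.

(** Let V(S) be the least expected cost of serving #|S| further requests when S is the set of
    free servers. The map p |-> min_s (d(p, s) + V(S \ s)) is 1-Lipschitz, so V(S) is at most
    the average of V(S \ s) over s in S plus the transport distance between the request law and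
    the uniform law on S. Averaging over uniformly random sets S, the optimal policy costs at
    most E[OPT] + sum_k T(k) / k, where T(k) is the mean Kantorovich norm of the centred
    indicator of a random k-subset of the servers. Splicing two independent request sequences
    shows T(k) <= 4 E[OPT] for every k.

    Put A = 16 (ln ln n + 1). For A <= k <= n / 16 one has
    T(k) = O(A^(3/4) (k / n)^(1/4)) E[OPT], so that only the terms with k < A or k > n / A^3
    matter and the sum is O(1 + ln A) E[OPT]. To bound T(k), compare a signed sample of density
    k / n with random signs on all servers, whose mean norm B is at most 8 E[OPT]. Let
    m be about A n / k.
    - Each sampled point is moved to a hub whose distance is comparable with the distance r(x)
      to its m-th neighbour. This is cheap, since disjoint bump functions show that
      sum_x r(x) = O(m^(3/4)) B.
    - The mass of a hub is spread over at least m points. While it stays within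
      sqrt A standard deviations, the contraction principle bounds the cost by
      O(sqrt (A k / n)) B.
    - It exceeds s times this threshold with probability 2 exp (- s A / 8), a negative power
      of ln n; this gain beats the factor ln n lost in a cotype inequality for the
      Kantorovich norm, applied to the exceptional hubs. *)

(** * Averages and Rademacher sums *)

Section Averages.
Variable R : realType.

(** The uniform bound on T(k) alone would leave the full harmonic sum, hence a factor ln n;
    everything between the recursion and the summation serves to make T(k) small when k / n is
    small. The exponents come from one constraint: exponential moments control the mass of a hub at
    sqrt A standard deviations only if about A sampled points are expected there. At sampling rate
    eps this forces m to be of order A / eps, and moving points to hubs then costs eps * m^(3/4) =
    A^(3/4) eps^(1/4). A union bound over all hubs would need A of order ln n; letting exceptional
    hubs occur and charging them by cotype reduces A to order ln ln n. Cutting at n / A^3 makes the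
    fourth roots sum to O(A^(-3/4)), which cancels the prefactor, at the price of ln (A^3) above the
    cut. The argument thus yields the first power of the triple logarithm, weakened to its square
    only at the end. Apart from the requests, all randomness is uniform on finite types, and
    independence is often expressed by bijections that preserve averages. *)

Definition avg (T : finType) (F : T -> R) : R := (\sum_t F t) / #|T|%:R.

Lemma eq_avg (T : finType) (F G : T -> R) : F =1 G -> avg F = avg G.
Proof. by move=> FG; rewrite /avg (eq_bigr G). Qed.

Lemma ler_avg (T : finType) (F G : T -> R) :
  (forall t, F t <= G t) -> avg F <= avg G.
Proof. by move=> FG; rewrite ler_wpM2r ?invr_ge0 ?ler0n // ler_sum. Qed.

Lemma avg_ge0 (T : finType) (F : T -> R) : (forall t, 0 <= F t) -> 0 <= avg F.
Proof. by move=> F0; rewrite mulr_ge0 ?invr_ge0 ?ler0n ?sumr_ge0. Qed.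

Lemma avgD (T : finType) (F G : T -> R) :
  avg (fun t => F t + G t) = avg F + avg G.
Proof. by rewrite /avg big_split mulrDl. Qed.

Lemma avgZ (T : finType) (c : R) (F : T -> R) :
  avg (fun t => c * F t) = c * avg F.
Proof. by rewrite /avg -mulr_sumr mulrA. Qed.

Lemma avgN (T : finType) (F : T -> R) : avg (fun t => - F t) = - avg F.
Proof. by rewrite /avg sumrN mulNr. Qed.

Lemma avg_sum (T I : finType) (P : pred I) (F : I -> T -> R) :
  avg (fun t => \sum_(i | P i) F i t) = \sum_(i | P i) avg (F i).
Proof. by rewrite /avg exchange_big mulr_suml. Qed.

Lemma avg_exchange (T U : finType) (F : T -> U -> R) :
  avg (fun t => avg (F t)) = avg (fun u => avg (F^~ u)).
Proof.
rewrite /avg -!mulr_suml -!mulrA [(#|U|%:R^-1) * _]mulrC.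
by rewrite exchange_big.
Qed.

Lemma avg_pair (T U : finType) (F : T * U -> R) :
  avg F = avg (fun t => avg (fun u => F (t, u))).
Proof.
rewrite /avg card_prod natrM invfM -mulr_suml -mulrA.
rewrite [(#|U|%:R^-1) * _]mulrC; congr (_ * _).
by rewrite (pair_bigA _ (fun t u => F (t, u))); apply: eq_bigr => -[].
Qed.

Lemma avg_reindex (T U : finType) (h : U -> T) (F : T -> R) :
  bijective h -> avg F = avg (fun u => F (h u)).
Proof.
move=> bij; rewrite /avg (bij_eq_card bij); congr (_ / _).
by rewrite (reindex h) //; apply: onW_bij.
Qed.

Lemma avg_const (T : finType) (t0 : T) (c : R) : avg (fun _ : T => c) = c.
Proof.
rewrite /avg sumr_const -[c *+ _]mulr_natr mulfK //.
by rewrite pnatr_eq0 -lt0n; apply/card_gt0P; exists t0.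
Qed.

Lemma avg_le_const (T : finType) (F : T -> R) (c : R) :
  0 <= c -> (forall t, F t <= c) -> avg F <= c.
Proof.
move=> c0 Fc; case: (pickP T) => [t0 _|T0]; last by rewrite /avg big_pred0 ?mul0r.
by rewrite -[leRHS](avg_const t0) ler_avg.
Qed.

Lemma avg0 (T : finType) (F : T -> R) : (forall t, F t = 0) -> avg F = 0.
Proof. by move=> F0; rewrite /avg big1 ?mul0r. Qed.

Lemma ler_norm_avg (T : finType) (F : T -> R) :
  `|avg F| <= avg (fun t => `|F t|).
Proof.
rewrite /avg normrM [X in _ * X]ger0_norm ?invr_ge0 ?ler0n //.
by rewrite ler_wpM2r ?invr_ge0 ?ler0n ?ler_norm_sum.
Qed.

Lemma avg_ffun_prod (J T : finType) (g : J -> T -> R) :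
  avg (fun w : {ffun J -> T} => \prod_j g j (w j)) = \prod_j avg (g j).
Proof.
rewrite /avg big_split /= card_ffun bigA_distr_bigA /=; congr (_ * _).
by rewrite prodr_const natrX exprVn.
Qed.

Definition pr (T : finType) (P : pred T) : R := avg (fun t => (P t)%:R).

Lemma pr_ge0 (T : finType) (P : pred T) : 0 <= pr P.
Proof. by apply: avg_ge0 => t; rewrite ler0n. Qed.

Lemma pr_markov (T : finType) (P : pred T) (F : T -> R) (c : R) : 0 < c ->
  (forall t, 0 <= F t) -> (forall t, P t -> c <= F t) -> pr P <= avg F / c.
Proof.
move=> c0 F0 Fc; rewrite ler_pdivlMr // mulrC -avgZ; apply: ler_avg => t.
by case: (boolP (P t)) => [/Fc|_]; rewrite ?mulr1 ?mulr0.
Qed.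

End Averages.

Section Rademacher.
Variables (R : realType) (J : finType).
Implicit Types (s : {ffun J -> bool}) (a : J -> R).

Definition sg (b : bool) : R := (-1) ^+ b.

Lemma sgM_addb b c : sg (b (+) c) = sg b * sg c.
Proof. exact: signr_addb. Qed.

Lemma sgN b : sg (~~ b) = - sg b. Proof. by rewrite /sg signrN. Qed.

Lemma sg_sqr b : sg b * sg b = 1. Proof. by rewrite -expr2 sqrr_sign. Qed.

Lemma normr_signb b : `|sg b| = 1. Proof. exact: normr_sign. Qed.

Definition flip (j : J) s : {ffun J -> bool} := [ffun i => (i == j) (+) s i].

Lemma flipK j : involutive (flip j).
Proof. by move=> s; apply/ffunP => i; rewrite !ffunE addbA addbb. Qed.

(** This symmetry stands in for independence of the sign at [j]: whatever does not involve that sign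
    is invariant under [flip j], while the sign itself is negated. *)
Lemma avg_flip j (F : {ffun J -> bool} -> R) : avg F = avg (fun s => F (flip j s)).
Proof. by apply: avg_reindex; exists (flip j); exact: flipK. Qed.

Lemma avg_signl (t : {ffun J -> bool}) (F : {ffun J -> bool} -> R) :
  avg F = avg (fun s => F [ffun i => t i (+) s i]).
Proof.
apply: avg_reindex; exists (fun s => [ffun i => t i (+) s i]) => s;
by apply/ffunP => i; rewrite !ffunE addbA addbb.
Qed.

Lemma avg_odd j (F : {ffun J -> bool} -> R) :
  (forall s, F (flip j s) = - F s) -> avg F = 0.
Proof.
move=> odd; have : avg F = - avg F by rewrite {1}(avg_flip j) (eq_avg odd) avgN.
by lra.
Qed.

Lemma sg_flip j s : sg (flip j s j) = - sg (s j).
Proof. by rewrite ffunE eqxx -sgN. Qed.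

Lemma sg_flip_neq j i s : i != j -> sg (flip j s i) = sg (s i).
Proof. by rewrite ffunE => /negbTE ->. Qed.

Lemma avg_sg_indep j (F : {ffun J -> bool} -> R) :
  (forall s, F (flip j s) = F s) -> avg (fun s => F s * sg (s j)) = 0.
Proof. by move=> FE; apply: (@avg_odd j) => s; rewrite sg_flip FE mulrN. Qed.

Definition rsum (A : {set J}) a s := \sum_(i in A) sg (s i) * a i.

Lemma rsum0 a s : rsum set0 a s = 0. Proof. exact: big_set0. Qed.

Lemma rsum_setU1 (A : {set J}) j a s : j \notin A ->
  rsum (j |: A) a s = sg (s j) * a j + rsum A a s.
Proof. by move=> jA; rewrite /rsum big_setU1. Qed.

Lemma rsum_flip (A : {set J}) j a s : j \notin A ->
  rsum A a (flip j s) = rsum A a s.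
Proof.
move=> jA; apply: eq_bigr => i iA; rewrite sg_flip_neq //.
by apply: contraNneq jA => <-.
Qed.

Lemma set_ind (P : {set J} -> Prop) : P set0 ->
  (forall (j : J) (A : {set J}), j \notin A -> P A -> P (j |: A)) -> forall A, P A.
Proof.
move=> P0 PS A; elim: {A}_.+1 {-2}A (ltnSn #|A|) => // n IHn A An.
case: (set_0Vmem A) => [->//|[j jA]].
rewrite -(setD1K jA); apply: PS; first by rewrite !inE eqxx.
by apply: IHn; rewrite (cardsD1 j A) jA in An.
Qed.

Lemma avg_rsum2 (A : {set J}) a :
  avg (fun s => rsum A a s ^+ 2) = \sum_(i in A) a i ^+ 2.
Proof.
elim/set_ind: A => [|j A jA IH].
  rewrite big_set0 -(avg_const [ffun _ : J => true] 0); apply: eq_avg => s.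
  by rewrite rsum0 expr0n.
rewrite big_setU1 //= -IH.
have -> : avg (fun s => rsum (j |: A) a s ^+ 2) =
  a j ^+ 2 + 2 * a j * avg (fun s => rsum A a s * sg (s j))
   + avg (fun s => rsum A a s ^+ 2).
  rewrite -avgZ -{1}(avg_const [ffun _ : J => true] (a j ^+ 2)) -!avgD.
  apply: eq_avg => s; rewrite rsum_setU1 //.
  by rewrite /sg; case: (s j); rewrite /= ?expr1 ?expr0; ring.
by rewrite (@avg_sg_indep j) ?mulr0 ?addr0 // => s; rewrite rsum_flip.
Qed.

(** Odd powers of a new sign average to 0, and the surviving a^4 + 6 a^2 V + 3 V^2 is at most 3 (a^2
    + V)^2, which closes the induction. *)
Lemma avg_rsum4 (A : {set J}) a :
  avg (fun s => rsum A a s ^+ 4) <= 3 * (\sum_(i in A) a i ^+ 2) ^+ 2.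
Proof.
elim/set_ind: A => [|j A jA IH].
  rewrite big_set0 -(avg_const [ffun _ : J => true] (3 * 0 ^+ 2)).
  by apply: ler_avg => s; rewrite rsum0 !expr0n mulr0.
rewrite big_setU1 //=.
have -> : avg (fun s => rsum (j |: A) a s ^+ 4) =
  a j ^+ 4 + 4 * a j ^+ 3 * avg (fun s => rsum A a s * sg (s j))
   + 6 * a j ^+ 2 * avg (fun s => rsum A a s ^+ 2)
   + 4 * a j * avg (fun s => rsum A a s ^+ 3 * sg (s j))
   + avg (fun s => rsum A a s ^+ 4).
  rewrite -!avgZ -{1}(avg_const [ffun _ : J => true] (a j ^+ 4)) -!avgD.
  apply: eq_avg => s; rewrite rsum_setU1 //.
  by rewrite /sg; case: (s j); rewrite /= ?expr1 ?expr0; ring.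
do 2![rewrite (@avg_sg_indep j) ?mulr0 ?addr0; last by move=> s; rewrite rsum_flip].
rewrite avg_rsum2; move: (\sum_(i in A) _) IH => S IH.
have := sqr_ge0 (a j ^+ 2); have := sqr_ge0 (a j); lra.
Qed.

(* |x| >= (3 l^2 x^2 - x^4) / (2 l^3) for l > 0; here l^2 is twice the variance. *)
Lemma khintchine (A : {set J}) a :
  Num.sqrt (\sum_(i in A) a i ^+ 2) / 2 <= avg (fun s => `|rsum A a s|).
Proof.
set V := \sum_(i in A) _.
have V0 : 0 <= V by apply: sumr_ge0 => i _; apply: sqr_ge0.
have [->|Vn0] := eqVneq V 0.
  by rewrite sqrtr0 mul0r; apply: avg_ge0 => s.
have Vp : 0 < V by rewrite lt_def Vn0.
set l := Num.sqrt (2 * V).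
have lp : 0 < l by rewrite sqrtr_gt0 mulr_gt0.
have l2 : l ^+ 2 = 2 * V by rewrite sqr_sqrtr // mulr_ge0.
have pt x : (3 * l ^+ 2 * x ^+ 2 - x ^+ 4) / (2 * l ^+ 3) <= `|x|.
  rewrite ler_pdivrMr ?mulr_gt0 ?exprn_gt0 //.
  have -> : x ^+ 2 = `|x| ^+ 2 by rewrite real_normK ?num_real.
  have -> : x ^+ 4 = `|x| ^+ 4.
    by rewrite -[4%N]/(2 * 2)%N !exprM real_normK ?num_real.
  have y0 : 0 <= `|x| by []; move: `|x| y0 => y y0.
  rewrite -subr_ge0.
  have -> : y * (2 * l ^+ 3) - (3 * l ^+ 2 * y ^+ 2 - y ^+ 4) =
    y * ((y - l) ^+ 2 * (y + 2 * l)) by ring.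
  by rewrite mulr_ge0 // mulr_ge0 ?sqr_ge0 // addr_ge0 // mulr_ge0 // ltW.
apply: le_trans (ler_avg (fun s => pt (rsum A a s))).
have -> : avg (fun s => (3 * l ^+ 2 * rsum A a s ^+ 2 - rsum A a s ^+ 4) / (2 * l ^+ 3))
  = (3 * l ^+ 2 * V - avg (fun s => rsum A a s ^+ 4)) / (2 * l ^+ 3).
  rewrite [in RHS]/V -avg_rsum2 -avgZ -avgN -avgD [RHS]mulrC -avgZ.
  by apply: eq_avg => s; rewrite mulrC.
have := avg_rsum4 A a; rewrite -/V => H4.
rewrite ler_pdivlMr ?mulr_gt0 ?exprn_gt0 //.
apply: (@le_trans _ _ (3 * V ^+ 2)); last by rewrite l2; lra.
have -> : l = Num.sqrt 2 * Num.sqrt V by rewrite -sqrtrM.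
have sV := sqr_sqrtr V0; set v := Num.sqrt V in sV *.
have s2 := @sqr_sqrtr R 2 ltac:(by []); set r2 := Num.sqrt 2 in s2 *.
have r0 : 0 <= r2 by apply: sqrtr_ge0.
have -> : v / 2 * (2 * (r2 * v) ^+ 3) = r2 * (r2 ^+ 2) * (v ^+ 2) ^+ 2 by field.
rewrite s2 sV ler_wpM2r ?sqr_ge0 //.
have : r2 <= 3 / 2.
  by rewrite -(@ler_pXn2r _ 2) ?nnegrE ?divr_ge0 // s2; lra.
lra.
Qed.

End Rademacher.

(** * Exponential moments, tails and quadratic chaos of random signs *)

Section Exponential.
Variable R : realType.
Implicit Types x l : R.

Lemma expR_le_inv x : x < 1 -> expR x <= (1 - x)^-1.
Proof.
move=> x1; rewrite -[x in expR x]opprK expRN.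
by rewrite lef_pV2 ?posrE ?expR_gt0 ?subr_gt0 //; apply: expR_ge1Dx.
Qed.

Lemma cosh_le_quadratic x : x ^+ 2 <= 1 / 2 ->
  (expR x + expR (- x)) / 2 <= 1 + 2 * x ^+ 2.
Proof.
move=> x2.
have xlt1 : `|x| < 1.
  rewrite -(@ltr_pXn2r _ 2) ?nnegrE // real_normK ?num_real // expr1n; lra.
move: xlt1; rewrite ltr_norml => /andP[x1 x1'].
have e1 := expR_le_inv x1'.
have e2 : expR (- x) <= (1 + x)^-1.
  by have := @expR_le_inv (- x); rewrite opprK; apply; lra.
apply: (@le_trans _ _ (((1 - x)^-1 + (1 + x)^-1) / 2)); first by lra.
have -> : ((1 - x)^-1 + (1 + x)^-1) / 2 = (1 - x ^+ 2)^-1.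
  field; apply/and3P; split; rewrite gt_eqF //; first lra.
  - lra.
  - lra.
rewrite -[leLHS]mul1r ler_pdivrMr; last by lra.
have := sqr_ge0 x; move: (x ^+ 2) x2 => y y2 y0.
have : 0 <= y * (1 - 2 * y) by apply: mulr_ge0 => //; lra.
lra.
Qed.

(** The generous constant 2 permits elementary estimates: once x^2 > 1/2, both x and -x are at most
    2 x^2. *)
Lemma cosh_le_gauss x : (expR x + expR (- x)) / 2 <= expR (2 * x ^+ 2).
Proof.
have [x2|x2] := leP (x ^+ 2) (1 / 2).
  by apply: le_trans (cosh_le_quadratic x2) _; apply: expR_ge1Dx.
have H (y : R) : y ^+ 2 = x ^+ 2 -> y <= 2 * x ^+ 2.
  move=> yx; rewrite -yx; rewrite -yx in x2.
  have [y0|y0] := leP y 0; first by apply: (le_trans y0); rewrite mulr_ge0 ?sqr_ge0.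
  have y1 : 1 / 2 < y by nra.
  nra.
have h1 : expR x <= expR (2 * x ^+ 2) by rewrite ler_expR; apply: H.
have h2 : expR (- x) <= expR (2 * x ^+ 2) by rewrite ler_expR; apply/H/sqrrN.
lra.
Qed.

Section Rad.
Variable J : finType.
Implicit Types (s : {ffun J -> bool}) (a : J -> R).

Lemma rad_mgf a l :
  avg (fun s => expR (l * \sum_i sg R (s i) * a i)) <=
  expR (2 * l ^+ 2 * \sum_i a i ^+ 2).
Proof.
under eq_avg => s do rewrite mulr_sumr expR_sum.
rewrite (avg_ffun_prod (fun i b => expR (l * (sg R b * a i)))).
rewrite mulr_sumr expR_sum; apply: ler_prod => i _.
rewrite /avg big_bool card_bool /sg expr1 expr0 mul1r mulN1r mulrN.
rewrite divr_ge0 ?addr_ge0 ?expR_ge0 //=.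
have -> : 2 * l ^+ 2 * a i ^+ 2 = 2 * (l * a i) ^+ 2 by ring.
by rewrite addrC; apply: cosh_le_gauss.
Qed.

Lemma rad_tail a (l u V : R) : 0 <= l -> \sum_i a i ^+ 2 <= V ->
  pr R (fun s => u < \sum_i sg R (s i) * a i) <= expR (2 * l ^+ 2 * V - l * u).
Proof.
move=> l0 aV.
have := @pr_markov R _ (fun s => u < \sum_i sg R (s i) * a i)
  (fun s => expR (l * \sum_i sg R (s i) * a i)) (expR (l * u)) (expR_gt0 _).
move=> /(_ (fun s => expR_ge0 _)) h.
apply: le_trans (h _) _.
  by move=> s us; rewrite ler_expR ler_wpM2l // ltW.
rewrite expRB ler_wpM2r ?invr_ge0 ?expR_ge0 //.
apply: le_trans (rad_mgf _ _) _.
by rewrite ler_expR ler_wpM2l // mulr_ge0 ?sqr_ge0.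
Qed.

(** The maximum is replaced by a dominating function: since y - u <= exp (l (y - u)) / l, adding
    these exponentials over all sums and both signs to the level u gives a bound whose mean is a sum
    of moment generating functions. *)
Lemma rad_max (K : finType) (a : K -> J -> R) (l u V : R) : 0 < l ->
  (forall k, \sum_i a k i ^+ 2 <= V) ->
  exists2 M : {ffun J -> bool} -> R,
    (forall s k, `|\sum_i sg R (s i) * a k i| <= M s) /\ (forall s, u <= M s) &
    avg M <= u + 2 * #|K|%:R * expR (2 * l ^+ 2 * V - l * u) / l.
Proof.
move=> l0 aV.
pose W k s := \sum_i sg R (s i) * a k i.
pose E (y : R) := expR (l * y - l * u) / l.
have E0 y : 0 <= E y by rewrite divr_ge0 ?expR_ge0 // ltW.
have EP y : y <= u + E y.
  rewrite -lerBlDl ler_pdivlMr // mulrC mulrBr.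
  by apply: le_trans (expR_ge1Dx _); rewrite lerDr.
pose M s := u + \sum_k (E (W k s) + E (- W k s)).
have S0 s : 0 <= \sum_k (E (W k s) + E (- W k s)).
  by apply: sumr_ge0 => k _; rewrite addr_ge0.
exists M; first split.
- move=> s k; rewrite -/(W k s) /M (bigD1 k) //=.
  have : 0 <= \sum_(i | i != k) (E (W i s) + E (- W i s)).
    by apply: sumr_ge0 => i _; rewrite addr_ge0.
  have := EP (W k s); have := EP (- W k s); have := E0 (W k s); have := E0 (- W k s).
  by rewrite ler_norml; lra.
- by move=> s; rewrite lerDl.
rewrite /M avgD (avg_const [ffun=> true]) lerD2l avg_sum.
apply: (@le_trans _ _ (\sum_(k : K) (2 * expR (2 * l ^+ 2 * V - l * u) / l))).
  apply: ler_sum => k _.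
  have half (b : bool) : avg (fun s => E (sg R b * W k s)) <=
      expR (2 * l ^+ 2 * V - l * u) / l.
    have -> : avg (fun s => E (sg R b * W k s)) =
        expR (- (l * u)) / l * avg (fun s => expR (l * (sg R b * W k s))).
      by rewrite -avgZ; apply: eq_avg => s; rewrite /E expRD; ring.
    rewrite expRD [leRHS](_ : _ = expR (- (l * u)) / l * expR (2 * l ^+ 2 * V)); last by ring.
    rewrite ler_wpM2l ?divr_ge0 ?expR_ge0 ?(ltW l0) //.
    have -> : avg (fun s => expR (l * (sg R b * W k s))) =
      avg (fun s => expR (l * \sum_i sg R (s i) * (sg R b * a k i))).
      apply: eq_avg => s; rewrite /W mulr_sumr; congr (expR (l * _)).
      by apply: eq_bigr => i _; rewrite mulrCA.
    apply: le_trans (rad_mgf _ _) _; rewrite ler_expR ler_wpM2l ?(mulr_ge0 _ (sqr_ge0 _)) //.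
    apply: (le_trans _ (aV k)); apply: ler_sum => i _.
    by rewrite exprMn /sg sqrr_sign mul1r.
  have := half false; have := half true.
  rewrite /sg expr1 expr0 avgD.
  rewrite (@eq_avg _ _ (fun s => E (-1 * W k s)) (fun s => E (- W k s))); last first.
    by move=> s; rewrite mulN1r.
  rewrite (@eq_avg _ _ (fun s => E (1 * W k s)) (fun s => E (W k s))); last first.
    by move=> s; rewrite mul1r.
  by move: (expR _) => e; lra.
rewrite sumr_const -[leLHS]mulr_natr.
by rewrite le_eqVlt; apply/orP; left; apply/eqP; ring.
Qed.

(** A new index k adds s_k times a linear form in the earlier signs, so the cross term averages to
    0. The factor 2 is lost in (a_ik + a_ki)^2, because [a] need not be symmetric. *)
Lemma chaos2 (a : J -> J -> R) (A : {set J}) :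
  avg (fun s => (\sum_(i in A) \sum_(j in A | j != i) sg R (s i) * sg R (s j) * a i j) ^+ 2)
  <= 2 * \sum_(i in A) \sum_(j in A) a i j ^+ 2.
Proof.
pose O (B : {set J}) s :=
  \sum_(i in B) \sum_(j in B | j != i) sg R (s i) * sg R (s j) * a i j.
rewrite -/(O A).
elim/set_ind: A => [|k A kA IH].
  rewrite big_set0 mulr0; apply: avg_le_const => // s.
  by rewrite /O big_set0 expr0n.
pose L (s : {ffun J -> bool}) := rsum A (fun i => a i k + a k i) s.
have neqA i : i \in A -> i != k by move=> iA; apply: contraNneq kA => <-.
have OE s : O (k |: A) s = O A s + L s * sg R (s k).
  rewrite /O big_setU1 //=.
  have -> : \sum_(j in k |: A | j != k) sg R (s k) * sg R (s j) * a k j =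
            \sum_(j in A) sg R (s k) * sg R (s j) * a k j.
    apply: eq_bigl => j; rewrite !inE; case: eqP => [->|]; last by rewrite andbT.
    by rewrite (negbTE kA).
  have -> : \sum_(i in A) \sum_(j in k |: A | j != i) sg R (s i) * sg R (s j) * a i j
    = \sum_(i in A) (sg R (s i) * sg R (s k) * a i k +
       \sum_(j in A | j != i) sg R (s i) * sg R (s j) * a i j).
    apply: eq_bigr => i iA; rewrite (bigD1 k) /=; last first.
      by rewrite !inE eqxx eq_sym neqA.
    congr (_ + _); apply: eq_bigl => j; rewrite !inE.
    case: (eqVneq j k) => [->|]; first by rewrite andbF (negbTE kA).
    by rewrite andbT.
  rewrite big_split /= [RHS]addrC addrA; congr (_ + _).
  rewrite /L /rsum mulr_suml -big_split; apply: eq_bigr => i _ /=; ring.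
have Oflip s : O A (flip k s) = O A s.
  apply: eq_bigr => i iA; apply: eq_bigr => j /andP[jA _].
  by rewrite !sg_flip_neq ?neqA.
have Lflip s : L (flip k s) = L s by rewrite /L rsum_flip.
have -> : avg (fun s => O (k |: A) s ^+ 2) = avg (fun s => O A s ^+ 2) +
   2 * avg (fun s => (O A s * L s) * sg R (s k)) + avg (fun s => L s ^+ 2).
  rewrite -avgZ -!avgD; apply: eq_avg => s; rewrite OE.
  by rewrite /sg; case: (s k); rewrite /= ?expr1 ?expr0; ring.
rewrite avg_sg_indep ?mulr0 ?addr0; last by move=> s; rewrite Oflip Lflip.
rewrite avg_rsum2 big_setU1 //= big_setU1 //=.
have -> : \sum_(i in A) \sum_(j in k |: A) a i j ^+ 2 =
  \sum_(i in A) a i k ^+ 2 + \sum_(i in A) \sum_(j in A) a i j ^+ 2.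
  by rewrite -big_split; apply: eq_bigr => i iA; rewrite big_setU1.
have : \sum_(i in A) (a i k + a k i) ^+ 2 <=
   2 * (\sum_(i in A) a i k ^+ 2 + \sum_(i in A) a k i ^+ 2).
  rewrite -big_split mulr_sumr; apply: ler_sum => i _ /=.
  by have := sqr_ge0 (a i k - a k i); nra.
have := sqr_ge0 (a k k).
move: IH; lra.
Qed.

End Rad.
End Exponential.

(** * The Kantorovich norm *)

Section LipschitzNorm.
Variables (R : realType) (X : finType).

(** Distinct indices may be at distance 0: the points will be servers, which can share a
    location. *)
Definition pseudometric (d : X -> X -> R) :=
  [/\ forall x, d x x = 0, forall x y, d x y = d y x
    & forall x y z, d x z <= d x y + d y z].

Variable d : X -> X -> R.

Definition lip (f : X -> R) := forall x y, f x - f y <= d x y.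

(** Centring f keeps the supremum over Lipschitz functions finite whatever the total mass of u, and
    makes constants added to u invisible. *)
Definition pairing (u f : X -> R) := \sum_x u x * (f x - avg f).

(* Kantorovich dual norm of [u], after subtracting from [u] its mean value. *)
Definition knorm (u : X -> R) : R := sup [set pairing u f | f in lip]%classic.

Hypothesis dP : pseudometric d.

Lemma dxx x : d x x = 0. Proof. by case: dP. Qed.
Lemma d_sym x y : d x y = d y x. Proof. by case: dP. Qed.
Lemma d_tri y x z : d x z <= d x y + d y z. Proof. by case: dP. Qed.
Lemma d_ge0 x y : 0 <= d x y.
Proof. by have := d_tri y x x; rewrite dxx (d_sym y x); lra. Qed.

Lemma lip_cst c : lip (fun _ => c).
Proof. by move=> x y; rewrite subrr d_ge0. Qed.

Lemma lip_opp f : lip f -> lip (fun x => - f x).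
Proof. by move=> fL x y; rewrite d_sym; have := fL y x; lra. Qed.

Lemma lip_norm f : lip f -> forall x y, `|f x - f y| <= d x y.
Proof.
move=> fL x y; rewrite ler_norml; have := fL x y; have := fL y x.
by rewrite (d_sym y x); lra.
Qed.

Lemma sub_avg (f : X -> R) x : f x - avg f = avg (fun y => f x - f y).
Proof. by rewrite avgD avgN (avg_const x). Qed.

Lemma pairingD u v f : pairing (fun x => u x + v x) f = pairing u f + pairing v f.
Proof. by rewrite /pairing -big_split; apply: eq_bigr => x _ /=; rewrite mulrDl. Qed.

Lemma pairingZ c u f : pairing (fun x => c * u x) f = c * pairing u f.
Proof. by rewrite /pairing mulr_sumr; apply: eq_bigr => x _; rewrite mulrA. Qed.

Lemma pairing_sum (I : finType) (P : pred I) (u : I -> X -> R) f :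
  pairing (fun x => \sum_(i | P i) u i x) f = \sum_(i | P i) pairing (u i) f.
Proof.
by rewrite /pairing exchange_big; apply: eq_bigr => x _ /=; rewrite mulr_suml.
Qed.

Lemma pairing_avg (T : finType) (u : T -> X -> R) f :
  pairing (fun x => avg (u^~ x)) f = avg (fun t => pairing (u t) f).
Proof.
rewrite /pairing avg_sum; apply: eq_bigr => x _.
by rewrite mulrC -avgZ; apply: eq_avg => t; rewrite mulrC.
Qed.

Lemma pairing_sumr (I : finType) (P : pred I) u (f : I -> X -> R) :
  pairing u (fun x => \sum_(i | P i) f i x) = \sum_(i | P i) pairing u (f i).
Proof.
rewrite /pairing exchange_big; apply: eq_bigr => x _ /=; rewrite -mulr_sumr.
by rewrite avg_sum sumrB.
Qed.

Lemma pairingZr c u f : pairing u (fun x => c * f x) = c * pairing u f.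
Proof.
rewrite /pairing mulr_sumr; apply: eq_bigr => x _.
by rewrite avgZ -mulrBr mulrCA.
Qed.

Lemma pairingNr u f : pairing u (fun x => - f x) = - pairing u f.
Proof.
by rewrite -mulN1r -pairingZr; congr pairing; apply/funext => x; rewrite mulN1r.
Qed.

Lemma pairing_cst c f : pairing (fun _ => c) f = 0.
Proof.
rewrite /pairing -mulr_sumr sumrB sumr_const -[_ *+ #|X|]mulr_natl.
case: (pickP X) => [x0 _|X0]; last by rewrite !(eq_card0 X0) big_pred0 // mul0r subrr mulr0.
rewrite /avg mulrCA mulfV ?mulr1 ?subrr ?mulr0 // pnatr_eq0 -lt0n.
by apply/card_gt0P; exists x0.
Qed.

Lemma pairing_delta x f : pairing (fun z => (z == x)%:R) f = f x - avg f.
Proof.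
rewrite /pairing (bigD1 x) //= eqxx mul1r big1 ?addr0 // => y /negbTE ->.
by rewrite mul0r.
Qed.

Lemma pairing_ub u : has_ubound [set pairing u f | f in lip]%classic.
Proof.
exists (\sum_x `|u x| * \sum_y d x y) => _ [f fL <-].
apply: ler_sum => x _; apply: le_trans (ler_norm _) _.
rewrite normrM ler_wpM2l // sub_avg.
apply: le_trans (ler_norm_avg _) _; apply: le_trans (ler_avg (lip_norm fL x)) _.
rewrite /avg -[leRHS]mulr1 ler_wpM2l ?sumr_ge0 // => [y _|]; first exact: d_ge0.
by rewrite invf_le1 ?ler1n ?ltr0n; apply/card_gt0P; exists x.
Qed.

Lemma pairing_nonempty u : ([set pairing u f | f in lip] !=set0)%classic.
Proof. by exists (pairing u (fun _ => 0)), (fun _ => 0) => //; apply: lip_cst. Qed.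

Lemma knorm_ub u f : lip f -> pairing u f <= knorm u.
Proof. by move=> fL; apply: sup_upper_bound; [split; [exact: pairing_nonempty|exact: pairing_ub]|exists f]. Qed.

Lemma knorm_le u c : (forall f, lip f -> pairing u f <= c) -> knorm u <= c.
Proof.
by move=> H; apply: ge_sup; [exact: pairing_nonempty|move=> _ [f fL <-]; exact: H].
Qed.

Lemma knorm_ge0 u : 0 <= knorm u.
Proof.
apply: le_trans (knorm_ub u (lip_cst 0)).
rewrite /pairing big1 // => x _.
by rewrite (avg_const x) subrr mulr0.
Qed.

Lemma knorm_pairing u f : lip f -> `|pairing u f| <= knorm u.
Proof.
move=> fL; rewrite ler_norml lerNl -pairingNr.
by rewrite !knorm_ub //; apply: lip_opp.
Qed.

(** Half of the supremum is enough later on, and it spares a compactness argument for its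
    attainment. *)
Lemma dualf_ex u : exists f, lip f /\ knorm u / 2 <= pairing u f.
Proof.
have [N0|N0] := ltP 0 (knorm u); last first.
  exists (fun _ => 0); split; first exact: lip_cst.
  have /eqP -> : knorm u == 0 by rewrite eq_le N0 knorm_ge0.
  rewrite mul0r /pairing sumr_ge0 // => x _.
  by rewrite (avg_const x) subrr mulr0.
have e0 : 0 < knorm u / 2 by rewrite divr_gt0.
have [_ [f fL <-] fN] := sup_adherent e0 (conj (pairing_nonempty u) (pairing_ub u)).
by exists f; split => //; rewrite -/(knorm u) in fN; lra.
Qed.

(** The choice depends on u alone, so every operation on the signs that fixes u also fixes its dual
    function. *)
Definition dualf u : X -> R := projT1 (cid (dualf_ex u)).

Lemma dualf_lip u : lip (dualf u).
Proof. by rewrite /dualf; case: cid => f []. Qed.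

Lemma dualf_opt u : knorm u / 2 <= pairing u (dualf u).
Proof. by rewrite /dualf; case: cid => f []. Qed.

Lemma knorm_scale u F t : 0 <= t -> (forall x y, F x - F y <= t * d x y) ->
  pairing u F <= t * knorm u.
Proof.
move=> t0 FL; have [t00|tn0] := eqVneq t 0.
  rewrite t00 mul0r /pairing big1 // => x _; rewrite sub_avg.
  rewrite avg0 ?mulr0 // => y.
  by apply/eqP; rewrite eq_le; have := FL x y; have := FL y x; rewrite t00 !mul0r; lra.
have tp : 0 < t by rewrite lt_def tn0.
have -> : F = (fun x => t * (t^-1 * F x)).
  by apply/funext => x; rewrite mulrA mulfV // mul1r.
rewrite pairingZr ler_wpM2l //; apply: knorm_ub => x y.
by rewrite -mulrBr ler_pdivrMl.
Qed.

Lemma knormD u v : knorm (fun x => u x + v x) <= knorm u + knorm v.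
Proof. by apply: knorm_le => f fL; rewrite pairingD lerD ?knorm_ub. Qed.

Lemma knorm0 : knorm (fun _ => 0) = 0.
Proof.
apply/eqP; rewrite eq_le knorm_ge0 andbT; apply: knorm_le => f fL.
by rewrite pairing_cst.
Qed.

Lemma knorm_sum (I : finType) (P : pred I) (u : I -> X -> R) :
  knorm (fun x => \sum_(i | P i) u i x) <= \sum_(i | P i) knorm (u i).
Proof.
by apply: knorm_le => f fL; rewrite pairing_sum; apply: ler_sum => i _; apply: knorm_ub.
Qed.

Lemma knorm_avg (T : finType) (u : T -> X -> R) :
  knorm (fun x => avg (u^~ x)) <= avg (fun t => knorm (u t)).
Proof.
by apply: knorm_le => f fL; rewrite pairing_avg; apply: ler_avg => t; apply: knorm_ub.
Qed.

Lemma knormZ c u : knorm (fun x => c * u x) = `|c| * knorm u.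
Proof.
have le c' v : knorm (fun x => c' * v x) <= `|c'| * knorm v.
  apply: knorm_le => f fL; rewrite pairingZ; apply: le_trans (ler_norm _) _.
  by rewrite normrM ler_wpM2l // knorm_pairing.
apply/eqP; rewrite eq_le le /=; have [->|c0] := eqVneq c 0.
  by rewrite normr0 mul0r knorm_ge0.
rewrite -ler_pdivlMl ?normr_gt0 // -normfV.
by apply: le_trans (le _ _); rewrite (_ : (fun x => _) = u) //; apply/funext => x; rewrite mulrA mulVf // mul1r.
Qed.

Lemma knormN u : knorm (fun x => - u x) = knorm u.
Proof.
rewrite -[RHS]mul1r -normr1 -normrN -knormZ; congr knorm.
by apply/funext => x; rewrite mulN1r.
Qed.

Lemma knorm_shift u c : knorm (fun x => u x + c) = knorm u.
Proof.
rewrite /knorm; congr (sup _); apply/seteqP.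
by split => _ [f fL <-]; exists f => //; rewrite pairingD pairing_cst addr0.
Qed.

Lemma knorm_sgZ b u : knorm (fun x => sg R b * u x) = knorm u.
Proof. by rewrite knormZ normr_signb mul1r. Qed.

Lemma knorm_move x (D : {set X}) (y0 : X) : y0 \in D ->
  knorm (fun z => (z == x)%:R - (z \in D)%:R / #|D|%:R) <=
  (\sum_(y in D) d x y) / #|D|%:R.
Proof.
move=> yD; apply: knorm_le => f fL; rewrite pairingD pairing_delta.
have D0 : #|D|%:R != 0 :> R.
  by rewrite pnatr_eq0 -lt0n; apply/card_gt0P; exists y0.
have -> : pairing (fun z => - ((z \in D)%:R / #|D|%:R)) f =
   - ((\sum_(y in D) (f y - avg f)) / #|D|%:R).
  rewrite /pairing mulr_suml -sumrN [RHS]big_mkcond; apply: eq_bigr => y _ /=.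
  by case: (y \in D); rewrite ?mul0r ?oppr0 ?mul0r // mulNr mul1r mulrC.
have cst (c : R) : (\sum_(y in D) c) / #|D|%:R = c.
  rewrite sumr_const -[X in X / _]mulr_natr. by rewrite mulfK.
rewrite sumrB mulrBl cst.
have -> : f x - avg f - ((\sum_(y in D) f y) / #|D|%:R - avg f) =
   (\sum_(y in D) (f x - f y)) / #|D|%:R.
  by rewrite sumrB mulrBl cst; ring.
by rewrite ler_wpM2r ?invr_ge0 ?ler0n // ler_sum.
Qed.

End LipschitzNorm.

(** * Random signs: contraction and cotype *)

Section RandomSigns.
Variables (R : realType) (X : finType) (d : X -> X -> R).
Hypothesis dP : pseudometric d.
Local Notation N := (knorm d).

Definition radnorm (J : finType) (v : J -> X -> R) : R :=
  avg (fun s : {ffun J -> bool} => N (fun x => \sum_j sg R (s j) * v j x)).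

Lemma radnorm_ge0 (J : finType) (v : J -> X -> R) : 0 <= radnorm v.
Proof. by apply: avg_ge0 => s; apply: knorm_ge0. Qed.

Lemma eq_radnorm (J : finType) (v w : J -> X -> R) :
  (forall j x, v j x = w j x) -> radnorm v = radnorm w.
Proof. by move=> vw; congr radnorm; apply/funext => j; apply/funext => x. Qed.

Section Contraction.
Variable J : finType.
Implicit Types (v w : J -> X -> R) (a b : J -> R).

Lemma radnormD v w :
  radnorm (fun j x => v j x + w j x) <= radnorm v + radnorm w.
Proof.
rewrite -avgD; apply: ler_avg => s; apply: le_trans (knormD dP _ _).
rewrite le_eqVlt; apply/orP; left; apply/eqP; congr knorm; apply/funext => x.
by rewrite -big_split; apply: eq_bigr => j _; rewrite mulrDr.
Qed.

Lemma radnormZ c v : radnorm (fun j x => c * v j x) = `|c| * radnorm v.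
Proof.
rewrite -avgZ; apply: eq_avg => s; rewrite -knormZ //; congr knorm.
by apply/funext => x; rewrite mulr_sumr; apply: eq_bigr => j _; rewrite mulrCA.
Qed.

Lemma radnorm_sum (n : nat) (v : nat -> J -> X -> R) :
  radnorm (fun j x => \sum_(k < n) v k j x) <= \sum_(k < n) radnorm (v k).
Proof.
elim: n => [|n IHn].
  rewrite big_ord0; apply: avg_le_const => // s.
  rewrite (_ : (fun x => _) = (fun=> 0)) ?knorm0 //; apply/funext => x.
  by rewrite big1 // => j _; rewrite big_ord0 mulr0.
rewrite big_ord_recr; apply: le_trans (lerD IHn (lexx _)).
apply: le_trans (radnormD _ _).
by rewrite le_eqVlt; apply/orP; left; apply/eqP/eq_radnorm => j x; rewrite big_ord_recr.
Qed.

(** The coefficient a_j is a convex combination of b_j and -b_j, and replacing b_j by -b_j amounts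
    to flipping the sign at [j]. *)
Lemma radnorm_le1 j a b v : (forall i, i != j -> a i = b i) -> `|a j| <= `|b j| ->
  radnorm (fun i x => a i * v i x) <= radnorm (fun i x => b i * v i x).
Proof.
move=> eqab leab; have [b0|bn0] := eqVneq (b j) 0.
  rewrite le_eqVlt; apply/orP; left; apply/eqP/eq_radnorm => i x.
  have [->|/eqab -> //] := eqVneq i j.
  by move: leab; rewrite b0 normr0 normr_le0 => /eqP ->.
pose l := (1 + a j / b j) / 2.
have ab1 : `|a j / b j| <= 1.
  by rewrite normrM normfV ler_pdivrMr ?normr_gt0 // mul1r.
have l0 : 0 <= l by move: ab1; rewrite ler_norml /l => /andP[? ?]; lra.
have l1 : 0 <= 1 - l by move: ab1; rewrite ler_norml /l => /andP[? ?]; lra.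
have aj : a j = l * b j - (1 - l) * b j by rewrite /l; field.
pose u (s : {ffun J -> bool}) x := \sum_i sg R (s i) * (b i * v i x).
have step (s : {ffun J -> bool}) :
    N (fun x => \sum_i sg R (s i) * (a i * v i x)) <=
    l * N (u s) + (1 - l) * N (u (flip j s)).
  have -> : l * N (u s) = N (fun x => l * u s x) by rewrite knormZ // ger0_norm.
  have -> : (1 - l) * N (u (flip j s)) = N (fun x => (1 - l) * u (flip j s) x).
    by rewrite knormZ // ger0_norm.
  apply: le_trans (knormD dP _ _).
  rewrite le_eqVlt; apply/orP; left; apply/eqP; congr knorm; apply/funext => x.
  have E r (c : J -> R) : \sum_i sg R (r i) * (c i * v i x) =
      sg R (r j) * (c j * v j x) + \sum_(i | i != j) sg R (r i) * (c i * v i x).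
    by rewrite (bigD1 j).
  rewrite /u !E.
  rewrite sg_flip aj.
  have -> : \sum_(i | i != j) sg R (s i) * (a i * v i x) =
            \sum_(i | i != j) sg R (s i) * (b i * v i x).
    by apply: eq_bigr => i /eqab ->.
  have -> : \sum_(i | i != j) sg R (flip j s i) * (b i * v i x) =
            \sum_(i | i != j) sg R (s i) * (b i * v i x).
    by apply: eq_bigr => i ij; rewrite sg_flip_neq.
  by ring.
apply: le_trans (ler_avg step) _; rewrite avgD !avgZ.
by rewrite -(avg_flip j (fun s => N (u s))) -mulrDl addrC subrK mul1r.
Qed.

Lemma radnorm_le a b v : (forall i, `|a i| <= `|b i|) ->
  radnorm (fun i x => a i * v i x) <= radnorm (fun i x => b i * v i x).
Proof.
move=> leab; pose m (A : {set J}) i := if i \in A then b i else a i.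
have H (A : {set J}) :
    radnorm (fun i x => a i * v i x) <= radnorm (fun i x => m A i * v i x).
  elim/set_ind: A => [|j A jA IH].
    by rewrite le_eqVlt; apply/orP; left; apply/eqP/eq_radnorm => i x; rewrite /m inE.
  apply: le_trans IH _; apply: (@radnorm_le1 j) => [i ij|].
    by rewrite /m !inE (negbTE ij).
  by rewrite /m !inE eqxx (negbTE jA).
apply: le_trans (H [set: J]) _.
by rewrite le_eqVlt; apply/orP; left; apply/eqP/eq_radnorm => i x; rewrite /m inE.
Qed.

Lemma radnorm_drop (P : pred J) v : radnorm (fun i x => (P i)%:R * v i x) <= radnorm v.
Proof.
have -> : radnorm v = radnorm (fun i x => 1 * v i x).
  by apply: eq_radnorm => i x; rewrite mul1r.
apply: (@radnorm_le (fun i => (P i)%:R) (fun=> 1)) => i.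
by rewrite normr1 normr_nat lern1 leq_b1.
Qed.

Lemma knorm_le_radnorm j v : N (v j) <= radnorm v.
Proof.
apply: le_trans (radnorm_drop (pred1 j) v).
rewrite -[leLHS](avg_const [ffun _ : J => true]); apply: ler_avg => s.
rewrite -(knorm_sgZ dP (s j)) le_eqVlt; apply/orP; left; apply/eqP; congr knorm.
apply/funext => x; rewrite (bigD1 j) //= eqxx mul1r big1 ?addr0 // => i /negbTE ->.
by rewrite mul0r mulr0.
Qed.

End Contraction.

(* Cotype estimate: if f_c norms Z_c, then sum_c s_c f_c is t-Lipschitz outside an event
   of probability delta, and its mean pairing with sum_c s_c Z_c is sum_c <Z_c, f_c>. *)
Lemma cotype (G : finType) (Z : G -> X -> R) (K t delta : R) (c0 : G) :
  0 < K -> 0 <= t -> (forall c, N (Z c) <= K) ->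
  #|X|%:R ^+ 2 * expR (- (t ^+ 2 / (8 * #|G|%:R))) <= delta -> delta <= 1 / 8 ->
  avg (fun c => N (Z c)) <= 16 * delta * K + 4 * t / #|G|%:R * radnorm Z.
Proof.
move=> K0 t0 ZK del1 del2.
set M : R := #|G|%:R.
have M0 : 0 < M by rewrite ltr0n; apply/card_gt0P; exists c0.
pose S := \sum_c N (Z c).
pose f c := dualf dP (Z c).
pose a c c' := pairing (Z c) (f c').
pose F (s : {ffun G -> bool}) x := \sum_c sg R (s c) * f c x.
pose nu (s : {ffun G -> bool}) x := \sum_c sg R (s c) * Z c x.
pose D := \sum_c a c c.
pose O (s : {ffun G -> bool}) :=
  \sum_c \sum_(c' | c' != c) sg R (s c) * sg R (s c') * a c c'.
have GE s : pairing (nu s) (F s) = D + O s.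
  rewrite /nu pairing_sum /D /O -big_split; apply: eq_bigr => c _ /=.
  rewrite pairingZ pairing_sumr (bigD1 c) //= pairingZr mulrDr mulrA sg_sqr mul1r.
  by rewrite mulr_sumr; congr (_ + _); apply: eq_bigr => c' _; rewrite pairingZr mulrA.
have O0 : avg O = 0.
  rewrite /O avg_sum big1 // => c _; rewrite avg_sum big1 // => c' c'c.
  have -> : avg (fun s : {ffun G -> bool} => sg R (s c) * sg R (s c') * a c c') =
            avg (fun s : {ffun G -> bool} => a c c' * sg R (s c) * sg R (s c')).
    by apply: eq_avg => s; ring.
  by rewrite avg_sg_indep // => s; rewrite sg_flip_neq // eq_sym.
(* Only one of the two factors is bounded by K, so that the variance of the chaos is linear in S and
   can be absorbed by the main term. *)
have aN c c' : a c c' ^+ 2 <= K * N (Z c).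
  have h : `|a c c'| <= N (Z c) by apply: knorm_pairing => //; apply: dualf_lip.
  rewrite -[a c c' ^+ 2]real_normK ?num_real // expr2.
  by apply: ler_pM => //; apply: le_trans (ZK c).
have O2 : avg (fun s => O s ^+ 2) <= 2 * M * K * S.
  have -> : avg (fun s => O s ^+ 2) = avg (fun s : {ffun G -> bool} => (\sum_(c in [set: G])
      \sum_(c' in [set: G] | c' != c) sg R (s c) * sg R (s c') * a c c') ^+ 2).
    apply: eq_avg => s; congr (_ ^+ 2); apply: eq_big => [c|c _]; first by rewrite inE.
    by apply: eq_bigl => c'; rewrite inE.
  apply: le_trans (chaos2 a [set: G]) _.
  rewrite -!mulrA ler_wpM2l // mulrA /S mulr_sumr.
  rewrite (eq_bigl xpredT); last by move=> c; rewrite inE.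
  apply: ler_sum => c _; apply: (@le_trans _ _ (\sum_(c' : G) K * N (Z c))).
    rewrite (eq_bigl xpredT); last by move=> c'; rewrite inE.
    exact: ler_sum.
  by rewrite sumr_const -[leLHS]mulr_natl mulrA.
pose good s := [forall x, forall y, F s x - F s y <= t * d x y].
have prbad : pr R (fun s => ~~ good s) <= delta.
  apply: le_trans del1.
  apply: (@le_trans _ _ (\sum_x \sum_y pr R (fun s => t * d x y < F s x - F s y))).
    rewrite /pr; under eq_bigr => x _ do rewrite -avg_sum.
    rewrite -avg_sum; apply: ler_avg => s; case: (boolP (good s)) => [_|] /=.
      by rewrite sumr_ge0 // => x _; rewrite sumr_ge0.
    case/forallPn => x /forallPn[y]; rewrite -ltNge => xy.
    rewrite (bigD1 x) //= (bigD1 y) //= xy -addrA lerDl addr_ge0 //.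
      by rewrite sumr_ge0.
    by rewrite sumr_ge0 // => z _; rewrite sumr_ge0.
  have bnd x y : pr R (fun s => t * d x y < F s x - F s y) <= expR (- (t ^+ 2 / (8 * M))).
    have FE s : F s x - F s y = \sum_c sg R (s c) * (f c x - f c y).
      by rewrite -sumrB; apply: eq_bigr => c _; rewrite mulrBr.
    have fd c : `|f c x - f c y| <= d x y by apply: lip_norm => //; apply: dualf_lip.
    have [d0|dn0] := eqVneq (d x y) 0.
      apply: le_trans (expR_ge0 _); apply: avg_le_const => // s.
      rewrite FE big1 ?d0 ?mulr0 ?ltxx // => c _.
      by move: (fd c); rewrite d0 normr_le0 => /eqP ->; rewrite mulr0.
    have dp : 0 < d x y by rewrite lt_def dn0 d_ge0.
    rewrite (_ : pr R _ = pr R (fun s : {ffun G -> bool} =>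
        t * d x y < \sum_c sg R (s c) * (f c x - f c y))); last first.
      by apply: eq_avg => s; rewrite FE.
    (* This parameter minimises 2 l^2 V - l u for V = M d^2 and u = t d, with minimum -t^2 / (8 M).
       It divides by the distance, hence the separate case of distance 0. *)
    apply: le_trans (@rad_tail _ _ _ (t / (4 * M * d x y)) _ (M * d x y ^+ 2) _ _) _.
    - by rewrite divr_ge0 // !mulr_ge0 // ltW.
    - apply: (@le_trans _ _ (\sum_(c : G) d x y ^+ 2)).
        apply: ler_sum => c _; rewrite -[leLHS]real_normK ?num_real //.
        by rewrite lerXn2r ?nnegrE // ltW.
      by rewrite sumr_const -[leLHS]mulr_natl.
    rewrite ler_expR le_eqVlt; apply/orP; left; apply/eqP.
    by field; rewrite dn0 gt_eqF.
  apply: (@le_trans _ _ (\sum_(x : X) \sum_(y : X) expR (- (t ^+ 2 / (8 * M))))).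
    by apply: ler_sum => x _; apply: ler_sum => y _.
  by rewrite !sumr_const -mulrnA -[leLHS]mulr_natl natrM expr2.
have Da c : N (Z c) / 2 <= a c c by apply: dualf_opt.
have DS1 : S / 2 <= D by rewrite /S mulr_suml; apply: ler_sum.
have DS2 : D <= S.
  by apply: ler_sum => c _; apply: knorm_ub => //; apply: dualf_lip.
have MK : 0 < M * K by rewrite mulr_gt0.
have ptw s : D + O s <= t * N (nu s) + (~~ good s)%:R * (D + 4 * (M * K))
   + O s ^+ 2 / (16 * (M * K)).
  have O2p : 0 <= O s ^+ 2 / (16 * (M * K)).
    by rewrite divr_ge0 ?sqr_ge0 // mulr_ge0 // ltW.
  case: (boolP (good s)) => /= [/forallP g|_].
    rewrite mul0r addr0; apply: (@le_trans _ _ (t * N (nu s))); last by rewrite lerDl.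
    rewrite -GE; apply: knorm_scale => // x y.
    by have /forallP := g x; apply.
  (* On the bad event the signed sum of dual functions may be far from Lipschitz, and only the
     second moment of the chaos is available. The weights make its mean contribution S / 8; the bad
     event takes another S / 8 from S / 2, leaving S / 4. *)
  have amgm : O s <= 4 * (M * K) + O s ^+ 2 / (16 * (M * K)).
    have -> : 4 * (M * K) + O s ^+ 2 / (16 * (M * K)) =
       O s + (O s - 8 * (M * K)) ^+ 2 / (16 * (M * K)).
      by field; rewrite (gt_eqF M0) (gt_eqF K0).
    by rewrite lerDl divr_ge0 ?sqr_ge0 // mulr_ge0 // ltW.
  have := mulr_ge0 t0 (knorm_ge0 dP (nu s)); rewrite mul1r; lra.
have := ler_avg ptw.
rewrite avgD O0 addr0 (avg_const [ffun=> true]) 2!avgD avgZ.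
have -> : avg (fun s => (~~ good s)%:R * (D + 4 * (M * K))) =
          (D + 4 * (M * K)) * pr R (fun s => ~~ good s).
  by rewrite -avgZ; apply: eq_avg => s; rewrite mulrC.
have -> : avg (fun s => O s ^+ 2 / (16 * (M * K))) =
          (16 * (M * K))^-1 * avg (fun s => O s ^+ 2).
  by rewrite -avgZ; apply: eq_avg => s; rewrite mulrC.
rewrite -/(radnorm Z).
have S0 : 0 <= S by apply: sumr_ge0 => c _; apply: knorm_ge0.
have h1 : (D + 4 * (M * K)) * pr R (fun s => ~~ good s) <= (S + 4 * (M * K)) * delta.
  apply: ler_pM => //; last by rewrite lerD2r.
  - by have := DS1; lra.
  - exact: pr_ge0.
have h2 : (16 * (M * K))^-1 * avg (fun s => O s ^+ 2) <= S / 8.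
  rewrite ler_pdivrMl ?mulr_gt0 //; apply: le_trans O2 _.
  by rewrite le_eqVlt; apply/orP; left; apply/eqP; field.
move=> h3.
have h4 : S * delta <= S / 8 by rewrite ler_wpM2l //; lra.
have h5 : S <= 4 * t * radnorm Z + 16 * delta * K * M by lra.
rewrite /avg -/S -/M ler_pdivrMr // mulrDl addrC; apply: le_trans h5 _.
rewrite le_eqVlt; apply/orP; left; apply/eqP; field.
by rewrite gt_eqF.
Qed.

End RandomSigns.

(** * Random sparse subfamilies of vectors *)

Section Sparse.
Variable R : realType.

Lemma ln_ge1 (n : nat) : (3 <= n)%N -> 1 <= ln (n%:R : R).
Proof.
move=> n3; have n0 : (0 : R) < n%:R by rewrite ltr0n (leq_trans _ n3).
rewrite -ler_expR lnK ?posrE //; apply: (@le_trans _ _ 3); last by rewrite ler_nat.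
(* The bound e <= 3 follows from exp (1/6) <= 6/5 and (6/5)^6 < 3. *)
have -> : (1 : R) = 6%:R * (1 / 6) by field.
rewrite expRM_natl; apply: (@le_trans _ _ ((6 / 5) ^+ 6)); last by lra.
rewrite lerXn2r ?nnegrE ?expR_ge0 //.
apply: le_trans (expR_le_inv _) _; first by lra.
by rewrite invf_ple ?posrE; lra.
Qed.

Variables (X : finType) (d : X -> X -> R).
Hypothesis dP : pseudometric d.
Hypothesis X3 : (3 <= #|X|)%N.
Local Notation n := (#|X|%:R : R).
Local Notation L := (ln n).

(* Cotype is applied to the vectors indexed by all outcomes w: the coefficient of [v i]
   becomes a Rademacher sum over w, typically of size at most sqrt (p * #|W| * ln n). *)
Lemma sparse (J W : finType) (w0 : W) (b : J -> pred W) (p : R) (v : J -> X -> R) :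
  (#|J| <= #|X|)%N -> 0 < p -> (forall i, pr R (b i) <= p) ->
  avg (fun w => radnorm d (fun i x => (b i w)%:R * v i x)) <=
  (140 * Num.sqrt p * L + 16 / n ^+ 3) * radnorm d v.
Proof.
move=> JX p0 bp.
set Phi := radnorm d v.
have n0 : 0 < n by rewrite ltr0n (leq_trans _ X3).
have L1 : 1 <= L by apply: ln_ge1.
have L0 : 0 < L by lra.
have Phi0 : 0 <= Phi by apply: radnorm_ge0.
have [PhiE|Phin0] := eqVneq Phi 0.
  rewrite PhiE mulr0; apply: avg_le_const => // w.
  by rewrite -PhiE; apply: (radnorm_drop dP (fun i => b i w)).
have Phip : 0 < Phi by rewrite lt_def Phin0.
set M : R := #|W|%:R.
have M0 : 0 < M by rewrite ltr0n; apply/card_gt0P; exists w0.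
pose V := p * M.
have V0 : 0 < V by rewrite mulr_gt0.
pose l := Num.sqrt (L / V).
have l0 : 0 < l by rewrite sqrtr_gt0 divr_gt0.
have l2 : l ^+ 2 = L / V by rewrite sqr_sqrtr // divr_ge0 // ltW.
have LV : L = V * l ^+ 2 by rewrite l2 mulrC divfK // gt_eqF.
have vJ i : knorm d (v i) <= Phi by apply: knorm_le_radnorm.
have bV i : \sum_w (b i w)%:R ^+ 2 <= V.
  have -> : \sum_w (b i w)%:R ^+ 2 = pr R (b i) * M.
    rewrite /pr /avg divfK ?gt_eqF //; apply: eq_bigr => w _.
    by case: (b i w); rewrite ?expr1n ?expr0n.
  by rewrite /V ler_wpM2r // ltW.
(* With V l^2 = ln n, the level 4 V l makes the exponent equal to -2 ln n, and n^(-2) outweighs the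
   at most n sums being compared. *)
have [mx [mxW mxu] mxavg] := rad_max (4 * (V * l)) l0 bV.
have u0 : 0 <= 4 * (V * l) by rewrite !mulr_ge0 // ltW.
have mxE : avg mx <= 5 * (V * l).
  apply: (le_trans mxavg).
  have -> : 2 * l ^+ 2 * V - l * (4 * (V * l)) = - (2%:R * L) by rewrite [in RHS]LV; ring.
  rewrite expRN expRM_natl lnK ?posrE //.
  have linv : l^-1 <= V * l.
    by rewrite -[leLHS]mul1r ler_pdivrMr // -mulrA -expr2 -LV.
  have Jn : #|J|%:R <= n :> R by rewrite ler_nat.
  have -> : 5 * (V * l) = 4 * (V * l) + V * l by ring.
  rewrite lerD2l -[leRHS]mul1r; apply: ler_pM => //.
    by rewrite invr_ge0 ltW.
  rewrite ler_pdivrMr ?exprn_gt0 // mul1r.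
  have : 3 <= n by rewrite ler_nat.
  nra.
(* Then t^2 / (8 M) = 6 ln n, and the union over n^2 pairs fails with probability at most n^(-4).
   This also pays for the crude norm bound n * Phi and leaves 16 / n^3. *)
pose t := Num.sqrt (48 * M * L).
have t2 : t ^+ 2 = 48 * M * L by rewrite sqr_sqrtr // !mulr_ge0 // ltW.
pose Z (s : {ffun J -> bool}) w x := \sum_i sg R (s i) * ((b i w)%:R * v i x).
have ZK s w : knorm d (Z s w) <= n * Phi.
  apply: le_trans (knorm_sum dP _ _) _.
  apply: (@le_trans _ _ (\sum_(i : J) Phi)).
    apply: ler_sum => i _; rewrite (knorm_sgZ dP) knormZ // normr_nat.
    case: (b i w); rewrite ?mul1r ?mul0r //; exact: vJ.
  rewrite sumr_const -[leLHS]mulr_natl ler_wpM2r // ler_nat //.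
have step s : avg (fun w => knorm d (Z s w)) <=
    16 / n ^+ 4 * (n * Phi) + 4 * t / M * radnorm d (Z s).
  apply: (@cotype _ _ _ dP _ _ _ _ _ w0) => //.
  - by rewrite mulr_gt0.
  - exact: sqrtr_ge0.
  - rewrite -/M t2 (_ : 48 * M * L / (8 * M) = 6%:R * L); last by field; rewrite gt_eqF.
    rewrite expRN expRM_natl lnK ?posrE // le_eqVlt; apply/orP; left; apply/eqP.
    by field; rewrite gt_eqF.
  - rewrite invf_ple ?posrE ?exprn_gt0 //.
    apply: (@le_trans _ _ (3 ^+ 4)); first lra.
    by rewrite lerXn2r ?nnegrE ?ler_nat // ltW.
have -> : avg (fun w => radnorm d (fun i x => (b i w)%:R * v i x)) =
    avg (fun s => avg (fun w => knorm d (Z s w))).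
  by rewrite -avg_exchange.
apply: le_trans (ler_avg step) _.
rewrite avgD (avg_const [ffun=> true]) avgZ.
have -> : avg (fun s => radnorm d (Z s)) = avg (fun tau : {ffun W -> bool} =>
    radnorm d (fun i x => (\sum_w sg R (tau w) * (b i w)%:R) * v i x)).
  rewrite avg_exchange; apply: eq_avg => tau; apply: eq_avg => s.
  congr knorm; apply/funext => x; rewrite /Z.
  under eq_bigr => w _ do rewrite mulr_sumr.
  rewrite exchange_big; apply: eq_bigr => i _ /=.
  by rewrite mulr_suml mulr_sumr; apply: eq_bigr => w _; ring.
have step2 (tau : {ffun W -> bool}) :
    radnorm d (fun i x => (\sum_w sg R (tau w) * (b i w)%:R) * v i x) <= Phi * mx tau.
  have m0 : 0 <= mx tau by apply: le_trans (mxu tau).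
  rewrite mulrC -[X in X * _](ger0_norm m0) -radnormZ //.
  have := @radnorm_le _ _ _ dP J (fun i => \sum_w sg R (tau w) * (b i w)%:R)
    (fun=> mx tau) v; apply=> i.
  by rewrite [leRHS]ger0_norm.
have tM : 0 <= 4 * t / M by rewrite divr_ge0 ?mulr_ge0 ?sqrtr_ge0 // ltW.
apply: (le_trans (lerD (lexx _) (ler_wpM2l tM (ler_avg step2)))).
rewrite avgZ [leRHS]mulrDl [leRHS]addrC; apply: lerD.
  by rewrite le_eqVlt; apply/orP; left; apply/eqP; field; rewrite gt_eqF.
rewrite mulrCA [leRHS]mulrC ler_wpM2l //.
apply: (@le_trans _ _ (4 * t / M * (5 * (V * l)))); first by rewrite ler_wpM2l.
rewrite -(@ler_pXn2r _ 2) ?nnegrE //; last 2 first.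
- by rewrite mulr_ge0 // mulr_ge0 // mulr_ge0 // ltW.
- by rewrite !mulr_ge0 ?sqrtr_ge0 // ltW.
have -> : (4 * t / M * (5 * (V * l))) ^+ 2 =
   400 * t ^+ 2 / M ^+ 2 * V * (V * l ^+ 2) by field; rewrite gt_eqF.
rewrite -LV t2 /V exprMn exprMn sqr_sqrtr ?(ltW p0) //.
(* The number of outcomes cancels, and 19200 <= 140^2 gives the constant 140. *)
have -> : 400 * (48 * M * L) / M ^+ 2 * (p * M) * L = 19200 * (p * L ^+ 2).
  by field; rewrite gt_eqF.
rewrite -mulrA ler_wpM2r ?mulr_ge0 ?sqr_ge0 ?(ltW p0) //; lra.
Qed.

End Sparse.

(** * Packings and bump functions *)

Section Geometry.
Variables (R : realType) (X : finType) (d : X -> X -> R).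
Hypothesis dP : pseudometric d.
Local Notation n := (#|X|%:R : R).

Definition oball x (r : R) : {set X} := [set y | d x y < r].
Definition cball x (r : R) : {set X} := [set y | d x y <= r].

Lemma cball_center x r : 0 <= r -> x \in cball x r.
Proof. by rewrite inE (dxx dP). Qed.

(** The radius is the distance to the m-th nearest point, the centre included; ties are why the open
    ball is bounded above and the closed ball below. *)
Lemma nbr_radius (m : nat) : (0 < m <= #|X|)%N ->
  exists r : X -> R, forall x,
    [/\ 0 <= r x, (#|oball x (r x)| < m)%N & (m <= #|cball x (r x)|)%N].
Proof.
move=> /andP[m0 mX].
suff H x : exists r : R, [/\ 0 <= r, (#|oball x r| < m)%N & (m <= #|cball x r|)%N].
  by exists (fun x => projT1 (cid (H x))) => x; case: cid.
pose P y := (m <= #|cball x (d x y)|)%N.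
have [y1 _ y1max] := arg_maxP (d x) (isT : xpredT x).
have Py1 : P y1.
  rewrite /P (_ : cball _ _ = [set: X]) ?cardsT //.
  by apply/setP => z; rewrite !inE; apply: y1max.
have [y Py ymin] := arg_minP (d x) Py1.
exists (d x y); split => //; first exact: d_ge0.
rewrite ltnNge; apply/negP => mo.
have /card_gt0P[y2 y2o] : (0 < #|oball x (d x y)|)%N by apply: leq_trans mo.
have [y3 y3o y3max] := arg_maxP (d x) y2o.
have Py3 : P y3.
  apply: (leq_trans mo); apply: subset_leq_card; apply/fintype.subsetP => z zo.
  by rewrite inE; apply: y3max.
have : y3 \in oball x (d x y) by exact: y3o.
by rewrite inE ltNge => /negP[]; apply: ymin.
Qed.

(** Greedy choice by largest radius: the open ball of the chosen point holds at most M points, none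
    of larger radius, and every later centre lies outside it. *)
Lemma packing (rho : X -> R) (M : nat) (Y : {set X}) :
  (forall x, 0 <= rho x) -> (forall x, x \in Y -> (#|oball x (rho x)| <= M)%N) ->
  exists I : {set X}, [/\ I \subset Y,
    forall z w, z \in I -> w \in I -> z != w -> rho z <= d z w
    & \sum_(x in Y) rho x <= M%:R * \sum_(x in I) rho x].
Proof.
move=> rho0; elim: {Y}_.+1 {-2}Y (ltnSn #|Y|) => // k IHk Y Yk YM.
have [Y0|[y0 y0Y]] := set_0Vmem Y.
  exists set0; split; first exact: sub0set.
  - by move=> z w; rewrite inE.
  - by rewrite Y0 !big_set0 mulr0.
have [y yY0 ymax] := arg_maxP rho y0Y; have yY : y \in Y by [].
(* An open ball of radius 0 misses its own centre, so removing it would not shrink Y; here all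
   remaining radii vanish. *)
have [ry|ry] := leP (rho y) 0.
  exists set0; split; first exact: sub0set.
  - by move=> z w; rewrite inE.
  - rewrite big_set0 mulr0 big1 // => x xY; apply/eqP; rewrite eq_le rho0 andbT.
    by apply: le_trans ry; apply: ymax.
have yo : y \in oball y (rho y) by rewrite inE (dxx dP).
have [||I [IY Isep Isum]] := IHk (Y :\: oball y (rho y)).
- apply: leq_trans (_ : (#|Y :\ y| < k)%N).
    by rewrite ltnS subset_leq_card // setDS // sub1set.
  by rewrite (cardsD1 y Y) yY in Yk.
- by move=> x; rewrite inE => /andP[_ xY]; apply: YM.
have IYo z : z \in I -> z \in Y /\ rho y <= d y z.
  by move=> /(fintype.subsetP IY); rewrite !inE -leNgt => /andP[].
have yI : y \notin I by apply/negP => /IYo[_]; rewrite (dxx dP) leNgt ry.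
exists (y |: I); split.
- rewrite subUset sub1set yY; apply: fintype.subset_trans IY _; exact: finset.subsetDl.
- move=> z w; rewrite !inE => /orP[/eqP->|zI] /orP[/eqP->|wI] zw; first by rewrite eqxx in zw.
  + by case: (IYo _ wI).
  + rewrite (d_sym dP); have [zY] := IYo _ zI; apply: le_trans; exact: ymax.
  + exact: Isep.
rewrite big_setU1 //= mulrDr (big_setID (oball y (rho y))) /= lerD //.
apply: (@le_trans _ _ (\sum_(x in Y :&: oball y (rho y)) rho y)).
  by apply: ler_sum => x; rewrite inE => /andP[xY _]; apply: ymax.
rewrite sumr_const -[leLHS]mulr_natl ler_wpM2r // ler_nat.
by apply: leq_trans (YM _ yY); apply: subset_leq_card; apply: subsetIr.
Qed.

(** Greedy choice by smallest radius, opposite to the usual Vitali selection: a point whose ball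
    meets that of its hub then has the larger radius, so the way to the hub is paid by the point
    itself. *)
Lemma vitali (r : X -> R) : (forall x, 0 <= r x) -> exists h : X -> X, [/\
  forall x, r (h x) <= r x,
  forall x, exists2 y, y \in cball (h x) (r (h x)) & y \in cball x (r x)
  & forall x x', h x != h x' -> [disjoint cball (h x) (r (h x)) & cball (h x') (r (h x'))]].
Proof.
move=> r0; suff H (Y : {set X}) : exists h : X -> X, [/\
  forall x, x \in Y -> h x \in Y /\ r (h x) <= r x,
  forall x, x \in Y -> exists2 y, y \in cball (h x) (r (h x)) & y \in cball x (r x)
  & forall x x', x \in Y -> x' \in Y -> h x != h x' ->
     [disjoint cball (h x) (r (h x)) & cball (h x') (r (h x'))]].
  have [h [h1 h2 h3]] := H [set: X]; exists h; split.
  - by move=> x; case: (h1 x); rewrite ?inE.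
  - by move=> x; case: (h2 x); rewrite ?inE // => y; exists y.
  - by move=> x x'; apply: h3; rewrite inE.
elim: {Y}_.+1 {-2}Y (ltnSn #|Y|) => // k IHk Y Yk.
have [Y0|[y0 y0Y]] := set_0Vmem Y.
  by exists id; rewrite Y0; split => x; rewrite ?inE // => x'; rewrite inE.
have [y yY0 ymin] := arg_minP r y0Y; have yY : y \in Y by [].
pose A := [set x in Y | [disjoint cball y (r y) & cball x (r x)]].
have yA : y \notin A.
  rewrite inE yY /=; apply/negP => /disjoint_setI0 /setP /(_ y).
  by rewrite !inE (dxx dP) r0.
have AY x : x \in A -> x \in Y by rewrite inE => /andP[].
have Ady x : x \in A -> [disjoint cball y (r y) & cball x (r x)].
  by rewrite inE => /andP[].
have [|h [h1 h2 h3]] := IHk A.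
  have : (#|A| < #|Y|)%N.
    by apply: proper_card; apply/properP; split; [apply/fintype.subsetP|exists y].
  by move=> /leq_trans; apply.
exists (fun x => if x \in A then h x else y); split.
- move=> x xY; case: ifP => [/h1[/AY]//|_]; split=> //; exact: ymin.
- move=> x xY; case: ifP => [/h2//|/negbT]; rewrite inE xY /= -setI_eq0.
  by case/set0Pn => z; rewrite inE => /andP[]; exists z.
- move=> x x' xY x'Y; case: ifP => xA; case: ifP => x'A.
  + exact: h3.
  + by move=> _; rewrite disjoint_sym Ady //; case: (h1 x).
  + by move=> _; rewrite Ady //; case: (h1 x').
  + by rewrite eqxx.
Qed.

End Geometry.

(** * Lower bounds for the norm of random signs *)

Section Bumps.
Variables (R : realType) (X : finType) (d : X -> X -> R).
Hypothesis dP : pseudometric d.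
Local Notation n := (#|X|%:R : R).

Definition signnorm : R := avg (fun s : {ffun X -> bool} => knorm d (fun x => sg R (s x))).

Lemma signnormE : signnorm = radnorm d (fun i x => (x == i)%:R).
Proof.
apply: eq_avg => s; congr knorm; apply/funext => x.
rewrite (bigD1 x) //= eqxx mulr1 big1 ?addr0 // => i ix.
by rewrite eq_sym (negbTE ix) mulr0.
Qed.

Lemma signnorm_ge0 : 0 <= signnorm.
Proof. by rewrite signnormE radnorm_ge0. Qed.

(** With c the mean, (g - c)^2 is at least g^2 / 2 - c^2 on S and equals c^2 off S; as S holds at
    most half of the points, the c^2 terms have a nonnegative total. *)
Lemma sum_sqr_sub_avg (g : X -> R) (S : {set X}) : (forall x, x \notin S -> g x = 0) ->
  (2 * #|S| <= #|X|)%N -> (\sum_x g x ^+ 2) / 2 <= \sum_x (g x - avg g) ^+ 2.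
Proof.
move=> gS SX; set c := avg g.
have pt x : g x ^+ 2 / 2 + (if x \in S then - c ^+ 2 else c ^+ 2) <= (g x - c) ^+ 2.
  case: ifPn => [_|/gS ->]; first by have := sqr_ge0 (g x - 2 * c); nra.
  by rewrite expr0n /= mul0r add0r sub0r sqrrN.
apply: le_trans (ler_sum _ (fun x _ => pt x)).
rewrite big_split /= -mulr_suml lerDl (bigID [in S]) /=.
rewrite (eq_bigr (fun=> - c ^+ 2)) => [|x ->//].
rewrite [X in _ + X](eq_bigr (fun=> c ^+ 2)) => [|x /negbTE ->//].
rewrite !sumr_const -[X in X + _]mulr_natl -[X in _ + X]mulr_natl mulrN -mulNr -mulrDl.
rewrite mulr_ge0 ?sqr_ge0 // addrC subr_ge0 ler_nat.
have -> : #|[pred x | x \notin S]| = #|~: S| by apply: eq_card => x; rewrite !inE.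
by have := cardsC S; lia.
Qed.

Section Packed.
Variables (rho : X -> R) (I : {set X}) (b : nat).
Hypothesis rho0 : forall x, 0 <= rho x.
Hypothesis Isep : forall z w, z \in I -> w \in I -> z != w -> rho z <= d z w.
Hypothesis small : forall z, z \in I -> (2 * #|oball d z (rho z)| <= #|X|)%N.
Hypothesis big : forall z, z \in I -> (b <= #|cball d z (rho z / 8)|)%N.

Let g z x := Num.max 0 (rho z / 4 - d z x).

Let g_ge0 z x : 0 <= g z x. Proof. by rewrite le_max lexx. Qed.

Let g_lip z x y : `|g z x - g z y| <= d x y.
Proof.
have h u v : g z u <= g z v + d u v.
  rewrite /g ge_max addr_ge0 ?le_max ?lexx ?(d_ge0 dP) //=.
  have : rho z / 4 - d z v <= Num.max 0 (rho z / 4 - d z v) by rewrite le_max lexx orbT.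
  have := d_tri dP u z v; lra.
rewrite ler_norml; have := h x y; have := h y x; rewrite (d_sym dP y x); lra.
Qed.

Let g_gt0 z x : 0 < g z x -> d z x < rho z / 4.
Proof. by rewrite /g lt_max ltxx /= subr_gt0. Qed.

Let g_uniq z w x : z \in I -> w \in I -> 0 < g z x -> 0 < g w x -> z = w.
Proof.
move=> zI wI /g_gt0 gz /g_gt0 gw; apply/eqP; apply/negPn/negP => zw.
have := Isep zI wI zw; have := Isep wI zI; rewrite eq_sym => /(_ zw).
have := d_tri dP x z w; rewrite (d_sym dP w z) (d_sym dP x w).
have := d_ge0 dP z w; lra.
Qed.

Let g_count x (c : R) : 0 <= c -> \sum_(z in I | 0 < g z x) c <= c.
Proof.
move=> c0; case: (pickP [pred z in I | 0 < g z x]) => [z /andP[zI gz]|e].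
  rewrite (big_pred1 z) // => w; apply/andP/eqP => [[wI gw]|->//].
  exact: g_uniq gw gz.
by rewrite big_pred0.
Qed.

Let F_lip (e : X -> R) : (forall z, `|e z| <= 1) -> forall x y,
  (\sum_(z in I) e z * g z x) - (\sum_(z in I) e z * g z y) <= 2 * d x y.
Proof.
move=> e1 x y; rewrite -sumrB.
have dxy := d_ge0 dP x y.
apply: (@le_trans _ _ (\sum_(z in I) ((if 0 < g z x then d x y else 0) +
                                     (if 0 < g z y then d x y else 0)))).
  apply: ler_sum => z _; rewrite -mulrBr; apply: le_trans (ler_norm _) _.
  rewrite normrM; have gl := g_lip z x y.
  have h : `|e z| * `|g z x - g z y| <= `|g z x - g z y| by rewrite ler_piMl.
  case: ifPn => gx; case: ifPn => gy; try lra.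
  have gx0 : g z x = 0 by apply/eqP; rewrite eq_le g_ge0 leNgt gx.
  have gy0 : g z y = 0 by apply/eqP; rewrite eq_le g_ge0 leNgt gy.
  by rewrite gx0 gy0 subrr normr0 mulr0 addr0.
rewrite big_split /= -!big_mkcondr /=.
have := g_count x dxy; have := g_count y dxy; lra.
Qed.

(** The supports are disjoint, so the bumps can be combined with signs adapted to the outcome while
    staying 2-Lipschitz; this turns the norm into a sum of absolute pairings. Each has variance at
    least b (rho / 16)^2, from the b points where the bump is at least rho / 8, and Khintchine
    applies. *)
Lemma bumps : Num.sqrt b%:R / 64 * \sum_(z in I) rho z <= signnorm.
Proof.
pose a z x := g z x - avg (g z).
pose T z (s : {ffun X -> bool}) := \sum_(x in [set: X]) sg R (s x) * a z x.
have Tsum s : \sum_(z in I) `|T z s| <= 2 * knorm d (fun x => sg R (s x)).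
  pose e z : R := if 0 <= T z s then 1 else -1.
  have e1 z : `|e z| <= 1 by rewrite /e; case: ifP; rewrite ?normrN normr1.
  have KS := @knorm_scale R X d dP (fun x => sg R (s x)) (fun x => \sum_(z in I) e z * g z x)
    2 (ler0n _ _) (F_lip e1).
  apply: le_trans KS.
  rewrite pairing_sumr; apply: ler_sum => z _; rewrite pairingZr.
  have -> : pairing (fun x => sg R (s x)) (g z) = T z s.
    by apply: eq_bigl => x; rewrite inE.
  rewrite /e; case: ifPn => [T0|]; first by rewrite mul1r ger0_norm.
  by rewrite -ltNge => T0; rewrite mulN1r ltr0_norm.
have low z : z \in I -> Num.sqrt b%:R * rho z / 32 <= avg (fun s => `|T z s|).
  move=> zI; apply: (le_trans _ (khintchine _ _)).
  have -> : \sum_(x in [set: X]) a z x ^+ 2 = \sum_x a z x ^+ 2.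
    by apply: eq_bigl => x; rewrite inE.
  suff : Num.sqrt b%:R * rho z / 16 <= Num.sqrt (\sum_x a z x ^+ 2) by lra.
  have r8 : 0 <= rho z / 16 by rewrite divr_ge0.
  have -> : Num.sqrt b%:R * rho z / 16 = Num.sqrt (b%:R * (rho z / 16) ^+ 2).
    by rewrite sqrtrM ?ler0n // sqrtr_sqr ger0_norm // mulrA.
  apply: ler_wsqrtr.
  apply: (le_trans _ (@sum_sqr_sub_avg (g z) (oball d z (rho z)) _ (small zI))); last first.
    move=> x; rewrite inE -leNgt => h; apply/eqP; rewrite eq_le g_ge0 andbT.
    by rewrite ge_max lexx /=; have := rho0 z; lra.
  have h : b%:R * (rho z / 8) ^+ 2 <= \sum_x g z x ^+ 2.
    apply: (@le_trans _ _ (\sum_(x in cball d z (rho z / 8)) (rho z / 8) ^+ 2)).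
      rewrite sumr_const -[leRHS]mulr_natl ler_wpM2r ?sqr_ge0 // ler_nat; exact: big.
    rewrite [leRHS](bigID [in cball d z (rho z / 8)]) /= -[leLHS]addr0 lerD //; last first.
      by apply: sumr_ge0 => x _; rewrite sqr_ge0.
    apply: ler_sum => x; rewrite inE => xz.
    rewrite lerXn2r ?nnegrE ?g_ge0 ?divr_ge0 // le_max; apply/orP; right; lra.
  have := mulr_ge0 (ler0n R b) (sqr_ge0 (rho z)).
  move: h; rewrite !exprMn; have -> : (8^-1 : R) ^+ 2 = 1 / 64 by field.
  have -> : (16^-1 : R) ^+ 2 = 1 / 256 by field.
  lra.
have : \sum_(z in I) (Num.sqrt b%:R * rho z / 32) <= 2 * signnorm.
  apply: (@le_trans _ _ (\sum_(z in I) avg (fun s => `|T z s|))); first exact: ler_sum.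
  by rewrite -avg_sum -avgZ; apply: ler_avg.
rewrite -mulr_suml -mulr_sumr; lra.
Qed.

End Packed.
End Bumps.

Section RadiusSum.
Variables (R : realType) (X : finType) (d : X -> X -> R).
Hypothesis dP : pseudometric d.

Lemma packed_sum (rho : X -> R) (M b : nat) (Y : {set X}) :
  (forall x, 0 <= rho x) -> (2 * M <= #|X|)%N -> (0 < b)%N ->
  (forall x, x \in Y -> (#|oball d x (rho x)| <= M)%N) ->
  (forall x, x \in Y -> (b <= #|cball d x (rho x / 8)|)%N) ->
  Num.sqrt b%:R * \sum_(x in Y) rho x <= 64 * M%:R * signnorm d.
Proof.
move=> rho0 MX b0 YM Yb; have [I [IY Isep Isum]] := packing dP rho0 YM.
have IY' z : z \in I -> z \in Y by apply: (fintype.subsetP IY).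
have sm z : z \in I -> (2 * #|oball d z (rho z)| <= #|X|)%N.
  by move=> /IY' /YM h; apply: leq_trans MX; rewrite leq_mul2l h orbT.
have bg z : z \in I -> (b <= #|cball d z (rho z / 8)|)%N by move=> /IY'; apply: Yb.
have := @bumps _ _ _ dP rho I b rho0 Isep sm bg.
move=> h; apply: le_trans (ler_wpM2l (sqrtr_ge0 _) Isum) _.
have := ler_wpM2l (ler0n R M) h; lra.
Qed.

(* Points with p neighbours within r/8 give bumps of large variance; at the others
   the p-th neighbour is already at distance r/8, and bumps of radius r/8 suffice. *)
Lemma radius_sum (r : X -> R) (p : nat) : (0 < p)%N -> (2 * p ^ 2 <= #|X|)%N ->
  (forall x, 0 <= r x) -> (forall x, (#|oball d x (r x)| < p ^ 2)%N) ->
  \sum_x r x <= 576 * (p%:R * Num.sqrt p%:R) * signnorm d.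
Proof.
move=> p0 pX r0 rp.
pose Y := [set x | (p <= #|cball d x (r x / 8)|)%N].
have B0 := signnorm_ge0 dP.
have sp : 0 < Num.sqrt (p%:R : R) by rewrite sqrtr_gt0 ltr0n.
have s1 : 1 <= Num.sqrt (p%:R : R) by rewrite -{1}[1]sqrtr1 ler_wsqrtr // ler1n.
have s2 : Num.sqrt (p%:R : R) * Num.sqrt p%:R = p%:R by rewrite -expr2 sqr_sqrtr ?ler0n.
(* Packing loses a factor p^2 and the bumps gain sqrt p; this is the origin of p^(3/2), that is
   m^(3/4) for m = p^2. On the complement the packing loss is only p. *)
have h1 : \sum_(x in Y) r x <= 64 * (p%:R * Num.sqrt p%:R) * signnorm d.
  have M1 x : x \in Y -> (#|oball d x (r x)| <= p ^ 2)%N by move=> _; apply: ltnW.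
  have M2 x : x \in Y -> (p <= #|cball d x (r x / 8)|)%N by rewrite inE.
  have h := packed_sum r0 pX p0 M1 M2. rewrite -(ler_pM2l sp); apply: (le_trans h).
  have -> : Num.sqrt p%:R * (64 * (p%:R * Num.sqrt p%:R) * signnorm d) =
    64 * (p%:R * (Num.sqrt p%:R * Num.sqrt p%:R)) * signnorm d by ring.
  by rewrite s2 natrX expr2.
have h2 : \sum_(x in ~: Y) r x <= 512 * p%:R * signnorm d.
  have r80 x : 0 <= r x / 8 by rewrite divr_ge0.
  have pX1 : (2 * p <= #|X|)%N.
    by apply: leq_trans pX; rewrite leq_mul2l /= expnS expn1 leq_pmulr.
  have M1 x : x \in ~: Y -> (#|oball d x (r x / 8)| <= p)%N.
    rewrite !inE -ltnNge => /ltnW; apply: leq_trans; apply: subset_leq_card.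
    by apply/fintype.subsetP => y; rewrite !inE => /ltW.
  have M2 x : x \in ~: Y -> (1 <= #|cball d x (r x / 8 / 8)|)%N.
    by move=> _; apply/card_gt0P; exists x; apply: cball_center => //; rewrite divr_ge0.
  have := packed_sum r80 pX1 (ltn0Sn 0) M1 M2.
  rewrite -mulr_suml sqrtr1 mul1r; lra.
rewrite (bigID [in Y]) /=.
have -> : \sum_(x | x \notin Y) r x = \sum_(x in ~: Y) r x.
  by apply: eq_bigl => x; rewrite !inE.
have : 512 * p%:R * signnorm d <= 512 * (p%:R * Num.sqrt p%:R) * signnorm d.
  rewrite ler_wpM2r // ler_wpM2l // -[leLHS]mulr1 ler_wpM2l ?ler0n //.
lra.
Qed.
End RadiusSum.

(** * Clusters and sparse signed samples *)

Section DisjointFamilies.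
Variables (R : realType) (X : finType) (d : X -> X -> R).
Hypothesis dP : pseudometric d.
Variables (P : pred X) (D : X -> {set X}).
Hypothesis Ddisj : forall i j, P i -> P j -> i != j -> [disjoint D i & D j].
Hypothesis Dne : forall i, P i -> (0 < #|D i|)%N.

Definition unif (i x : X) : R := (x \in D i)%:R / #|D i|%:R.

Let Y i (s : {ffun X -> bool}) : R := \sum_(y in D i) sg R (s y).
Let vec s x := \sum_(i | P i) Y i s * unif i x.

Let D_inj i j x : P i -> P j -> x \in D i -> x \in D j -> i = j.
Proof.
move=> Pi Pj xi xj; apply/eqP/negPn/negP => /(Ddisj Pi Pj) /disjoint_setI0 /setP /(_ x).
by rewrite !inE xi xj.
Qed.

Let vec_swap i x y (s : {ffun X -> bool}) : P i -> x \in D i -> y \in D i ->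
  vec [ffun z => s (tperm x y z)] = vec s.
Proof.
move=> Pi xi yi; apply/funext => z; apply: eq_bigr => j Pj; congr (_ * _).
rewrite /Y [RHS](reindex_inj (@perm_inj _ (tperm x y))) /=.
apply: eq_big => [w|w _]; last by rewrite ffunE.
have H u : u \in D i -> (u \in D j) = (i == j).
  by move=> ui; apply/idP/eqP => [uj|<-//]; apply: D_inj ui uj.
by case: tpermP => [->|->|//]; rewrite !H.
Qed.

Let vec_flip x s : (forall i, P i -> x \notin D i) -> vec (flip x s) = vec s.
Proof.
move=> nx; apply/funext => z; apply: eq_bigr => j Pj; congr (_ * _).
by apply: eq_bigr => y yj; rewrite sg_flip_neq //; apply: contraNneq (nx j Pj) => <-.
Qed.

(* The cluster sums determine the dual function of [vec s], and given them the signs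
   inside a cluster are exchangeable. *)
Lemma avg_cluster_knorm : avg (fun s => knorm d (vec s)) <= 2 * signnorm d.
Proof.
pose f s := dualf dP (vec s).
pose phi s x := f s x - avg (f s).
have phi_swap i x y (s : {ffun X -> bool}) z : P i -> x \in D i -> y \in D i ->
    phi [ffun z => s (tperm x y z)] z = phi s z.
  by move=> Pi xi yi; rewrite /phi /f (vec_swap _ Pi xi yi).
have Ex x : avg (fun s => vec s x * phi s x) = avg (fun s : {ffun X -> bool} => sg R (s x) * phi s x).
  case: (pickP [pred i | P i & x \in D i]) => [i /andP[/= Pi xi]|nx].
    have vE s : vec s x = #|D i|%:R^-1 * Y i s.
      rewrite /vec (bigD1 i) //= {1}/unif xi mul1r mulrC big1 ?addr0 // => j /andP[Pj ji].
      rewrite /unif (_ : x \in D j = false) ?mul0r ?mulr0 //.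
      by apply/negP => xj; rewrite (D_inj Pi Pj xi xj) eqxx in ji.
    under eq_avg => s do rewrite vE -mulrA /Y mulr_suml.
    rewrite avgZ avg_sum.
    rewrite (eq_bigr (fun=> avg (fun s : {ffun X -> bool} => sg R (s x) * phi s x))) => [|y yi].
      rewrite sumr_const -[X in _ * X]mulr_natl mulrA mulVf ?mul1r //.
      by rewrite pnatr_eq0 -lt0n Dne.
    rewrite [RHS](@avg_reindex _ _ _ (fun s : {ffun X -> bool} => [ffun z => s (tperm x y z)])).
      by apply: eq_avg => s; rewrite ffunE tpermL (phi_swap i x y s x Pi xi yi).
    exists (fun s : {ffun X -> bool} => [ffun z => s (tperm x y z)]) => s;
    by apply/ffunP => z; rewrite !ffunE tpermK.
  have nx' i : P i -> x \notin D i by move=> Pi; have := nx i; rewrite /= Pi => /negbT.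
  rewrite avg0 => [|s]; last first.
    rewrite /vec big1 ?mul0r // => i /nx' /negbTE xi.
    by rewrite /unif xi mul0r mulr0.
  rewrite (eq_avg (G := fun s => phi s x * sg R (s x))) => [|s]; last by rewrite mulrC.
  by rewrite avg_sg_indep // => s; rewrite /phi /f vec_flip.
apply: (@le_trans _ _ (avg (fun s => 2 * pairing (vec s) (f s)))).
  by apply: ler_avg => s; have := dualf_opt dP (vec s); rewrite -/(f s); lra.
rewrite avgZ ler_wpM2l //.
have -> : avg (fun s => pairing (vec s) (f s)) =
          avg (fun s : {ffun X -> bool} => pairing (fun x => sg R (s x)) (f s)).
  by rewrite /pairing !avg_sum; apply: eq_bigr => x _; apply: Ex.
by apply: ler_avg => s; apply: knorm_ub => //; apply: dualf_lip.
Qed.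

(** By Khintchine, sqrt #|D i| is at most twice the mean of |Y i|. Convexity moves this mean out of
    the norm, contraction removes the absolute value, and an outer sign on a cluster is absorbed by
    flipping all signs inside it. *)
Lemma radnorm_clusters :
  radnorm d (fun i x => (P i)%:R * (Num.sqrt #|D i|%:R * unif i x)) <= 4 * signnorm d.
Proof.
pose w i x := (P i)%:R * unif i x.
have YE i s : Y i s = rsum (D i) (fun=> 1 : R) s.
  by apply: eq_bigr => y _; rewrite mulr1.
have low i : Num.sqrt #|D i|%:R <= 2 * avg (fun s => `|Y i s|).
  have := khintchine (D i) (fun=> 1 : R).
  rewrite (eq_bigr (fun=> 1)) => [|y _]; last by rewrite expr1n.
  rewrite sumr_const (eq_avg (G := fun s => `|Y i s|)) => [|s]; last by rewrite YE.
  lra.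
apply: (@le_trans _ _ (radnorm d (fun i x => (2 * avg (fun s => `|Y i s|)) * w i x))).
  have := @radnorm_le _ _ _ dP X (fun i => Num.sqrt #|D i|%:R)
    (fun i => 2 * avg (fun s => `|Y i s|)) w.
  have -> : radnorm d (fun i x => Num.sqrt #|D i|%:R * w i x) =
    radnorm d (fun i x => (P i)%:R * (Num.sqrt #|D i|%:R * unif i x)).
    by apply: eq_radnorm => i x; rewrite mulrCA.
  apply=> i; rewrite !ger0_norm ?sqrtr_ge0 //.
  by rewrite mulr_ge0 // avg_ge0.
have -> : radnorm d (fun i x => (2 * avg (fun s => `|Y i s|)) * w i x) =
   2 * radnorm d (fun i x => avg (fun s => `|Y i s|) * w i x).
  rewrite -[X in X * _]ger0_norm // -radnormZ //.
  by apply: eq_radnorm => i x; rewrite mulrA.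
apply: (@le_trans _ _ (2 * avg (fun s => radnorm d (fun i x => `|Y i s| * w i x)))).
  rewrite ler_wpM2l // /radnorm avg_exchange; apply: ler_avg => t.
  apply: le_trans (knorm_avg dP _).
  rewrite le_eqVlt; apply/orP; left; apply/eqP; congr knorm; apply/funext => x.
  rewrite avg_sum; apply: eq_bigr => i _; rewrite avgZ mulrC [in RHS]mulrC; congr (_ * _).
  by rewrite mulrC -avgZ; apply: eq_avg => s; rewrite mulrC.
have -> : 4 * signnorm d = 2 * (2 * signnorm d) by ring.
rewrite ler_wpM2l //; apply: le_trans avg_cluster_knorm.
apply: (@le_trans _ _ (avg (fun s => radnorm d (fun i x => Y i s * w i x)))).
  apply: ler_avg => s; apply: (@radnorm_le _ _ _ dP _ (fun i => `|Y i s|) (Y ^~ s) w) => i.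
  by rewrite normr_id.
rewrite /radnorm avg_exchange; apply: avg_le_const => [|t].
  by apply: avg_ge0 => s; apply: knorm_ge0.
(* The default value concerns points outside all clusters, whose signs enter no cluster sum. *)
pose idx x := odflt x [pick i | P i & x \in D i].
have idxE i x : P i -> x \in D i -> idx x = i.
  move=> Pi xi; rewrite /idx; case: pickP => [j /= /andP[Pj xj]|/(_ i)] /=.
    exact: D_inj xj xi.
  by rewrite Pi xi.
rewrite [leRHS](avg_signl [ffun x => t (idx x)]) le_eqVlt; apply/orP; left; apply/eqP.
apply: eq_avg => s; congr knorm; apply/funext => x.
rewrite /vec [RHS]big_mkcond; apply: eq_bigr => i _.
case: ifPn => [Pi|/negbTE nPi]; last by rewrite /w nPi mul0r !mulr0.
rewrite /w Pi mul1r mulrA; congr (_ * _); rewrite /Y mulr_sumr.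
by apply: eq_bigr => y yi; rewrite !ffunE sgM_addb (idxE i).
Qed.

End DisjointFamilies.

(** * Signed samples of density eps *)

Section Subsampling.
Variables (R : realType) (X : finType) (q : nat).
Local Notation W := ({ffun X -> 'I_q.+1} * {ffun X -> bool})%type.
Local Notation eps := (q.+1%:R^-1 : R).

(** Uniform colours make selection at rate 1 / (q + 1), independent over the points, a plain average
    over a finite type; colour 0 means selected. *)
Definition sgsample (w : W) (x : X) : R := (w.1 x == ord0)%:R * sg R (w.2 x).

Lemma pr_color (x : X) : pr R (fun c : {ffun X -> 'I_q.+1} => c x == ord0) = eps.
Proof.
have -> : pr R (fun c : {ffun X -> 'I_q.+1} => c x == ord0) =
  avg (fun c : {ffun X -> 'I_q.+1} =>
    \prod_y (if y == x then (c y == ord0)%:R else 1 : R)).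
  apply: eq_avg => c; rewrite (bigD1 x) //= eqxx big1 ?mulr1 // => y /negbTE ->//.
rewrite (avg_ffun_prod (fun y (e : 'I_q.+1) => if y == x then (e == ord0)%:R else 1 : R)).
rewrite (bigD1 x) //= eqxx big1 => [|y /negbTE ->]; last exact: avg_const ord0 _.
rewrite mulr1 /avg (bigD1 ord0) //= big1 => [|e /negbTE ->//].
by rewrite addr0 card_ord mul1r.
Qed.

Lemma avg_color (a b : R) :
  avg (fun e : 'I_q.+1 => if e == ord0 then a else b) = b + eps * (a - b).
Proof.
rewrite /avg (bigD1 ord0) //= (eq_bigr (fun=> b)) => [|e /negbTE ->//].
rewrite sumr_const cardC1 card_ord /= -[b *+ q]mulr_natl -natr1.
by field; rewrite natr1 pnatr_eq0.
Qed.

(** Each point contributes 1 + eps (cosh l - 1). The restriction on l gives the quadratic bound of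
    cosh, and hence a factor eps in the exponent. *)
Lemma sgsample_mgf (C : {set X}) (l : R) : l ^+ 2 <= 1 / 2 ->
  avg (fun w : W => expR (l * \sum_(x in C) sgsample w x)) <=
  expR (2 * l ^+ 2 * (eps * #|C|%:R)).
Proof.
move=> l2; set ch := (expR l + expR (- l)) / 2.
have ch2 : ch <= 1 + 2 * l ^+ 2 by apply: cosh_le_quadratic.
have e0 : 0 <= eps by rewrite invr_ge0 ler0n.
pose g (x : X) (e : 'I_q.+1) := if x \in C then if e == ord0 then ch else 1 else 1.
have -> : avg (fun w : W => expR (l * \sum_(x in C) sgsample w x)) =
   avg (fun c : {ffun X -> 'I_q.+1} => \prod_x g x (c x)).
  rewrite avg_pair; apply: eq_avg => c.
  have -> : avg (fun u : {ffun X -> bool} => expR (l * \sum_(x in C) sgsample (c, u) x)) =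
    avg (fun u : {ffun X -> bool} => \prod_x
      (if x \in C then expR (l * ((c x == ord0)%:R * sg R (u x))) else 1)).
    apply: eq_avg => u; rewrite mulr_sumr expR_sum [LHS]big_mkcond.
    by [].
  rewrite (avg_ffun_prod (fun x b => if x \in C then expR (l * ((c x == ord0)%:R * sg R b)) else 1)).
  apply: eq_bigr => x _; rewrite /g; case: ifP => _; last exact: avg_const true _.
  rewrite /avg big_bool card_bool /= /sg expr1 expr0; case: eqP => _.
    by rewrite !mul1r mulr1 mulrN1 addrC.
  by rewrite !mul0r !mulr0 expR0 -[1 + 1]/(2%:R) mulfV // pnatr_eq0.
rewrite (avg_ffun_prod g).
have -> : expR (2 * l ^+ 2 * (eps * #|C|%:R)) =
    \prod_(x : X) (if x \in C then expR (eps * (2 * l ^+ 2)) else 1).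
  rewrite -big_mkcond prodr_const -expRM_natl; congr expR; ring.
apply: ler_prod => x _; rewrite avg_ge0 => [|e]; last first.
  rewrite /g; case: ifP => // _; case: ifP => // _.
  by rewrite divr_ge0 ?addr_ge0 ?expR_ge0.
rewrite /= /g; case: ifP => _; last by rewrite (avg_const ord0).
rewrite avg_color; apply: le_trans (expR_ge1Dx _).
by rewrite lerD2l ler_wpM2l //; lra.
Qed.

Lemma sgsample_tail (C : {set X}) (l u : R) : 0 <= l -> l ^+ 2 <= 1 / 2 ->
  pr R (fun w : W => u < `|\sum_(x in C) sgsample w x|) <=
  2 * expR (2 * l ^+ 2 * (eps * #|C|%:R) - l * u).
Proof.
move=> l0 l2; pose S (w : W) := \sum_(x in C) sgsample w x.
have h := @pr_markov R W (fun w => u < `|S w|)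
  (fun w => expR (l * S w) + expR (- l * S w)) (expR (l * u)) (expR_gt0 _).
apply: le_trans (h _ _) _.
- by move=> w; rewrite addr_ge0 ?expR_ge0.
- move=> w; rewrite ltr_normr => /orP[] uS.
    apply: ler_wpDr; first exact: expR_ge0.
    by rewrite ler_expR ler_wpM2l // ltW.
  apply: ler_wpDl; first exact: expR_ge0.
  by rewrite ler_expR mulNr -mulrN ler_wpM2l // ltW.
rewrite expRB mulrA ler_wpM2r ?invr_ge0 ?expR_ge0 // avgD.
have m1 := sgsample_mgf C l2.
have m2 := @sgsample_mgf C (- l); rewrite sqrrN in m2; move/(_ l2): m2 => m2.
rewrite -/S in m1 m2; lra.
Qed.

Variable d : X -> X -> R.
Hypothesis dP : pseudometric d.

Definition subnorm : R := avg (fun w : W => knorm d (sgsample w)).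

Lemma subnorm_ge0 : 0 <= subnorm.
Proof. by apply: avg_ge0 => w; apply: knorm_ge0. Qed.

End Subsampling.

(** * Moving sampled points to hubs *)

Section ClusteredSample.
Variables (R : realType) (X : finType) (d : X -> X -> R).
Hypothesis dP : pseudometric d.
Local Notation n := (#|X|%:R : R).

Section Clusters.
Variables (m : nat) (r : X -> R) (h : X -> X).
Hypothesis m0 : (0 < m)%N.
Hypothesis r0 : forall x, 0 <= r x.
Hypothesis mr : forall x, (m <= #|cball d x (r x)|)%N.
Hypothesis hr : forall x, r (h x) <= r x.
Hypothesis hmeet : forall x, exists2 y, y \in cball d (h x) (r (h x)) & y \in cball d x (r x).
Hypothesis hdisj : forall x x', h x != h x' ->
  [disjoint cball d (h x) (r (h x)) & cball d (h x') (r (h x'))].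

Definition cell (i : X) : {set X} := [set x | h x == i].

(* The mass collected at the hub [i] is spread uniformly over this set. *)
Definition target (i : X) : {set X} :=
  if (m <= #|cell i|)%N then cell i else cball d i (r i).

Lemma target_size i : (m <= #|target i|)%N.
Proof. by rewrite /target; case: ifP. Qed.

Lemma cell_le_target i : (#|cell i| <= #|target i|)%N.
Proof.
rewrite /target; case: ifPn => //; rewrite -ltnNge => /ltnW H.
exact: (leq_trans H (mr i)).
Qed.

Lemma d_hub x : d x (h x) <= 2 * r x.
Proof.
have [y] := hmeet x; rewrite !inE => y1 y2; have := hr x.
by have := d_tri dP y x (h x); rewrite (d_sym dP y (h x)); lra.
Qed.

(** In a large cell d x y <= 2 r x + 2 r y through the common hub, and summing over pairs gives 4 r
    x per point. In a small cell y is within r of the hub, whose radius is at most r x, so 3 r x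
    suffices. *)
Lemma transport_cost :
  \sum_x (\sum_(y in target (h x)) d x y) / #|target (h x)|%:R <= 4 * \sum_x r x.
Proof.
rewrite (partition_big h xpredT) //= [X in _ <= 4 * X](partition_big h xpredT) //= mulr_sumr.
apply: ler_sum => i _.
have tp : (0 : R) < #|target i|%:R by rewrite ltr0n (leq_trans m0) // target_size.
have cst (A : {set X}) (c : R) : \sum_(y in A) c = #|A|%:R * c.
  by rewrite sumr_const -[LHS]mulr_natl.
have -> : \sum_(x | h x == i) r x = \sum_(x in cell i) r x.
  by apply: eq_bigl => x; rewrite inE.
have -> : \sum_(x | h x == i) (\sum_(y in target (h x)) d x y) / #|target (h x)|%:R =
  \sum_(x in cell i) (\sum_(y in target i) d x y) / #|target i|%:R.
  by apply: eq_big => [x|x /eqP ->//]; rewrite inE.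
have [big|small] := leqP m #|cell i|.
  have tE : target i = cell i by rewrite /target big.
  rewrite -mulr_suml ler_pdivrMr // tE.
  apply: (@le_trans _ _ (\sum_(x in cell i) \sum_(y in cell i) (2 * r x + 2 * r y))).
    apply: ler_sum => x; rewrite inE => /eqP xi; apply: ler_sum => y; rewrite inE => /eqP yi.
    apply: le_trans (d_tri dP i x y) _; have := d_hub x; have := d_hub y.
    by rewrite xi yi (d_sym dP y i); lra.
  rewrite (eq_bigr (fun x => #|cell i|%:R * (2 * r x) + 2 * \sum_(y in cell i) r y)).
    by rewrite big_split /= -mulr_sumr cst -mulr_sumr; lra.
  by move=> x _; rewrite big_split /= cst mulr_sumr.
have tE : target i = cball d i (r i) by rewrite /target leqNgt small.
rewrite mulr_sumr; apply: ler_sum => x; rewrite inE => /eqP xi.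
rewrite ler_pdivrMr // mulrC -cst; apply: ler_sum => y.
rewrite tE inE => iy; apply: le_trans (d_tri dP i x y) _.
by have := d_hub x; have := hr x; have := r0 x; rewrite xi; lra.
Qed.

(** Large cells are disjoint from each other, and so are the balls around hubs of small cells, but a
    cell may meet a ball; the two families are treated separately, at 4 each. Empty cells are
    excluded because only balls around actual hubs are known to be disjoint. *)
Lemma radnorm_targets :
  radnorm d (fun i x => (cell i != set0)%:R *
     (Num.sqrt #|target i|%:R * unif R target i x)) <= 8 * signnorm d.
Proof.
pose big i := (cell i != set0) && (m <= #|cell i|)%N.
pose small i := (cell i != set0) && (#|cell i| < m)%N.
have ne i : (0 < #|target i|)%N by rewrite (leq_trans m0) // target_size.
have bigE i : big i -> target i = cell i by rewrite /target => /andP[_ ->].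
have smallE i : small i -> target i = cball d i (r i).
  by rewrite /target leqNgt => /andP[_ ->].
have hub i : cell i != set0 -> exists x, h x = i.
  by case/set0Pn => x; rewrite inE => /eqP; exists x.
have b1 : radnorm d (fun i x => (big i)%:R * (Num.sqrt #|target i|%:R * unif R target i x))
   <= 4 * signnorm d.
  apply: radnorm_clusters => // i j bi bj ij; rewrite !bigE //.
  rewrite -setI_eq0; apply/eqP/setP => x; rewrite !inE.
  by apply/negP => /andP[/eqP xi /eqP xj]; rewrite -xi xj eqxx in ij.
have b2 : radnorm d (fun i x => (small i)%:R * (Num.sqrt #|target i|%:R * unif R target i x))
   <= 4 * signnorm d.
  apply: radnorm_clusters => // i j si sj ij; rewrite !smallE //.
  have /andP[/hub[x xi] _] := si; have /andP[/hub[y yj] _] := sj.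
  by rewrite -xi -yj; apply: hdisj; rewrite xi yj.
have -> : 8 * signnorm d = 4 * signnorm d + 4 * signnorm d by ring.
apply: le_trans (lerD b1 b2); apply: le_trans (radnormD dP _ _).
rewrite le_eqVlt; apply/orP; left; apply/eqP/eq_radnorm => i x.
rewrite -mulrDl -natrD /big /small; case: (cell i != set0) => //=.
by case: leqP.
Qed.

End Clusters.

Lemma near_far (q m : nat) (r : X -> R) (h : X -> X) (w : {ffun X -> 'I_q.+1} * {ffun X -> bool}) :
  (forall i, 0 < #|target m r h i|)%N ->
  knorm d (sgsample R w) <=
   \sum_x (w.1 x == ord0)%:R * ((\sum_(y in target m r h (h x)) d x y) / #|target m r h (h x)|%:R)
   + knorm d (fun z => \sum_i (\sum_(x in cell h i) sgsample R w x) * unif R (target m r h) i z).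
Proof.
move=> ne; set D := target m r h.
have E : sgsample R w = (fun z =>
    (\sum_x sgsample R w x * ((z == x)%:R - unif R D (h x) z)) +
    \sum_i (\sum_(x in cell h i) sgsample R w x) * unif R D i z).
  apply/funext => z.
  have -> : \sum_i (\sum_(x in cell h i) sgsample R w x) * unif R D i z =
     \sum_x sgsample R w x * unif R D (h x) z.
    rewrite [RHS](partition_big h xpredT) //=; apply: eq_bigr => i _.
    by rewrite mulr_suml; apply: eq_big => [x|x]; rewrite inE // => /eqP ->.
  rewrite -big_split /= (bigD1 z) //= eqxx big1 ?addr0 => [|x /negbTE xz]; first by rewrite mulrBr mulr1 subrK.
  by rewrite eq_sym xz sub0r mulrN addNr.
rewrite [in leLHS]E; apply: le_trans (knormD dP _ _) _; rewrite lerD2r.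
apply: le_trans (knorm_sum dP _ _) _; apply: ler_sum => x _.
rewrite knormZ // /sgsample normrM normr_signb mulr1 normr_nat ler_wpM2l ?ler0n //.
have /card_gt0P[y yD] := ne (h x).
exact: (knorm_move dP x yD).
Qed.

End ClusteredSample.

Section SubsampleBound.
Variables (R : realType) (X : finType) (d : X -> X -> R) (q : nat).
Hypothesis dP : pseudometric d.
Local Notation n := (#|X|%:R : R).
Local Notation W := ({ffun X -> 'I_q.+1} * {ffun X -> bool})%type.
Local Notation eps := (q.+1%:R^-1 : R).

Definition clsum (h : X -> X) (w : W) (i : X) : R := \sum_(x in cell h i) sgsample R w x.

(** One extra sign per cell can be absorbed in the signs of its points, which makes contraction and
    cotype applicable. *)
Lemma avg_clsum_symm (h : X -> X) (V : X -> X -> R) :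
  avg (fun w => knorm d (fun z => \sum_i clsum h w i * V i z)) =
  avg (fun w => radnorm d (fun i z => clsum h w i * V i z)).
Proof.
rewrite !avg_pair; apply: eq_avg => c; rewrite /radnorm avg_exchange.
rewrite -[LHS](avg_const [ffun _ : X => true]); apply: eq_avg => t.
rewrite (avg_signl [ffun x => t (h x)]); apply: eq_avg => u.
congr knorm; apply/funext => z; apply: eq_bigr => i _; rewrite mulrA; congr (_ * _).
rewrite /clsum mulr_sumr; apply: eq_bigr => x; rewrite inE => /eqP xi.
by rewrite /sgsample /= !ffunE sgM_addb xi mulrCA.
Qed.

Lemma layer_cake (k : nat) (y t : R) : 0 <= t -> y <= k%:R * t ->
  y <= t * \sum_(s < k) (s%:R * t < y)%R%:R.
Proof.
move=> t0; elim: k => [|k IHk] yk; first by rewrite big_ord0 mulr0 -(mul0r t).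
have [h|h] := leP y (k%:R * t).
  apply: le_trans (IHk h) _; rewrite ler_wpM2l // big_ord_recr /=.
  by rewrite lerDl ler0n.
rewrite (eq_bigr (fun=> 1)) => [|s _].
  by rewrite sumr_const card_ord mulrC.
have -> // : s%:R * t < y.
by apply: le_lt_trans h; rewrite ler_wpM2r // ler_nat -ltnS ltn_ord.
Qed.

Lemma half_le_expN1 : expR (-1) <= 1 / 2 :> R.
Proof.
rewrite expRN invf_ple ?posrE ?expR_gt0 // div1r invrK.
by have := expR_ge1Dx (1 : R); lra.
Qed.

(** The mass of each hub is measured in units of its threshold and cut into layers. The bottom layer
    is bounded by contraction; layer s >= 1 involves few hubs and falls under [sparse], with
    geometrically decreasing contributions. *)
Lemma far_bound (m : nat) (r : X -> R) (h : X -> X) (A : R) :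
  (3 <= #|X|)%N -> (0 < m)%N -> (forall x, 0 <= r x) ->
  (forall x, (m <= #|cball d x (r x)|)%N) -> (forall x, r (h x) <= r x) ->
  (forall x x', h x != h x' ->
    [disjoint cball d (h x) (r (h x)) & cball d (h x') (r (h x'))]) ->
  16 * (ln (ln n) + 1) <= A -> A <= eps * m%:R ->
  avg (fun w => knorm d (fun z => \sum_i clsum h w i * unif R (target d m r h) i z)) <=
  1816 * Num.sqrt (A * eps) * signnorm d.
Proof.
move=> X3 m0 r0 mr hr hdisj lA Am; set D := target d m r h.
have n3 : 3 <= n by rewrite ler_nat.
have L1 : 1 <= ln n by apply: ln_ge1.
have LL0 : 0 <= ln (ln n) by apply: ln_ge0.
have A1 : 1 <= A by lra.
have A0 : 0 < A by lra.
have e0 : 0 < eps by rewrite invr_gt0 ltr0n.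
have B0 := signnorm_ge0 dP.
have DA i : A <= eps * #|D i|%:R.
  by apply: (le_trans Am); rewrite ler_wpM2l ?ler_nat ?(ltW e0) // target_size.
pose t i := Num.sqrt (A * (eps * #|D i|%:R)).
have t2 i : t i ^+ 2 = A * (eps * #|D i|%:R).
  by rewrite sqr_sqrtr // mulr_ge0 ?(ltW A0) // (le_trans (ltW A0)).
have tA i : A <= t i.
  rewrite -(@ler_pXn2r _ 2) ?nnegrE ?sqrtr_ge0 ?(ltW A0) // t2 expr2.
  by rewrite ler_wpM2l ?(ltW A0).
have t0 i : 0 < t i by apply: lt_le_trans (tA i).
pose v i z := (cell h i != set0)%:R * (t i * unif R D i z).
pose Phi := radnorm d v.
have PhiB : Phi <= 8 * Num.sqrt (A * eps) * signnorm d.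
  have -> : Phi = Num.sqrt (A * eps) * radnorm d (fun i x => (cell h i != set0)%:R *
     (Num.sqrt #|D i|%:R * unif R D i x)).
    rewrite -[X in X * _]ger0_norm ?sqrtr_ge0 // -radnormZ //; apply: eq_radnorm => i x.
    have tE : t i = Num.sqrt (A * eps) * Num.sqrt #|D i|%:R.
      by rewrite /t mulrA sqrtrM // mulr_ge0 // ltW.
    by rewrite /v tE; ring.
  have := ler_wpM2l (sqrtr_ge0 (A * eps)) (radnorm_targets dP m0 mr hdisj).
  rewrite -/D; lra.
have Phi0 : 0 <= Phi by apply: radnorm_ge0.
pose S w i := \sum_(s < #|X|) (s%:R * t i < `|clsum h w i|)%R%:R : R.
have clX w i : `|clsum h w i| <= #|X|%:R * t i.
  have h1 : `|clsum h w i| <= \sum_(x in cell h i) 1.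
    apply: le_trans (ler_norm_sum _ _ _) _; apply: ler_sum => x _.
    by rewrite /sgsample normrM normr_signb mulr1 normr_nat lern1 leq_b1.
  apply: (le_trans h1); rewrite sumr_const -[leLHS]mulr1.
  apply: ler_pM => //; first by rewrite ler_nat max_card.
  by apply: le_trans (tA i).
rewrite avg_clsum_symm.
apply: (@le_trans _ _ (avg (fun w => \sum_(s < #|X|)
   radnorm d (fun i z => (s%:R * t i < `|clsum h w i|)%R%:R * v i z)))).
  apply: ler_avg => w.
  apply: le_trans (radnorm_sum dP _ (fun s i z => (s%:R * t i < `|clsum h w i|)%R%:R * v i z)).
  have -> : radnorm d (fun i z => \sum_(s < #|X|) (s%:R * t i < `|clsum h w i|)%R%:R * v i z)
     = radnorm d (fun i z => (t i * S w i) * ((cell h i != set0)%:R * unif R D i z)).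
    by apply: eq_radnorm => i z; rewrite -mulr_suml /v -/(S w i); ring.
  have -> : radnorm d (fun i z => clsum h w i * unif R D i z) =
     radnorm d (fun i z => clsum h w i * ((cell h i != set0)%:R * unif R D i z)).
    apply: eq_radnorm => i z; case: (eqVneq (cell h i) set0) => [c0|_]; last by rewrite mul1r.
    by rewrite /clsum c0 big_set0 !mul0r.
  apply: (@radnorm_le _ _ _ dP _ (clsum h w) (fun i => t i * S w i)) => i.
  apply: le_trans (ler_norm _); apply: layer_cake => //; exact: ltW.
rewrite avg_sum.
have bnd (s : 'I_#|X|) : avg (fun w => radnorm d (fun i z =>
    (s%:R * t i < `|clsum h w i|)%R%:R * v i z)) <=
    (if s == 0%N :> nat then 1 else 210 * (1 / 2) ^+ s + 16 / n ^+ 3) * Phi.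
  have [s0|sn0] := eqVneq (s : nat) 0%N.
    rewrite mul1r; apply: avg_le_const => // w.
    exact: (radnorm_drop dP (fun i => s%:R * t i < `|clsum h w i|)).
  have s1 : 1 <= s%:R :> R by rewrite ler1n lt0n.
  pose p : R := 2 * expR (- (s%:R * A / 8)).
  have p0 : 0 < p by rewrite mulr_gt0 // expR_gt0.
  have w0 : W := ([ffun=> ord0], [ffun=> true]).
  have tail i : pr R (fun w : W => s%:R * t i < `|clsum h w i|) <= p.
    (* The exponent is then at most A / 8 - s A / 4, hence at most -s A / 8 as s >= 1. The
       restriction on l holds because A <= eps * #|D i|. *)
    pose l := A / (4 * t i).
    have l2 : l ^+ 2 * (eps * #|D i|%:R) = A / 16.
      have E : l ^+ 2 * (16 * t i ^+ 2) = A ^+ 2 by rewrite /l; field; rewrite gt_eqF.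
      rewrite t2 in E; apply: (mulfI (lt0r_neq0 A0)).
      by move: E; move: (eps * _) (l ^+ 2) => y z E; lra.
    have l0 : 0 <= l by rewrite divr_ge0 ?mulr_ge0 // ltW.
    have l16 : l ^+ 2 <= 1 / 16.
      rewrite -(ler_pM2r A0); apply: (@le_trans _ _ (l ^+ 2 * (eps * #|D i|%:R))).
        by rewrite ler_wpM2l ?sqr_ge0.
      by rewrite l2; lra.
    have lh : l ^+ 2 <= 1 / 2 by lra.
    apply: le_trans (sgsample_tail q (cell h i) (s%:R * t i) l0 lh) _.
    rewrite ler_pM2l // ler_expR.
    have lst : l * (s%:R * t i) = s%:R * A / 4 by rewrite /l; field; rewrite gt_eqF.
    have : l ^+ 2 * (eps * #|cell h i|%:R) <= A / 16.
      rewrite -l2 ler_wpM2l ?sqr_ge0 // ler_wpM2l ?(ltW e0) // ler_nat.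
      exact: cell_le_target.
    have : A <= s%:R * A by rewrite ler_peMl // ltW.
    rewrite lst -[2 * l ^+ 2 * _]mulrA.
    by move: (l ^+ 2 * _) (s%:R * A) => y z; lra.
  apply: le_trans (sparse dP X3 w0 v (leqnn _) p0 tail) _.
  rewrite ler_wpM2r // lerD2r.
  set ell := ln (ln n) in lA LL0.
  have LE : ln n = expR ell by rewrite lnK // posrE; lra.
  (* The 16 in A is spent here: 8 in the tail exponent and 2 in the square root of p. One factor exp
     (-ell) then cancels ln n and exp (-s) remains. *)
  have sp : Num.sqrt p <= 3 / 2 * expR (- (s%:R * (ell + 1))).
    rewrite -(@ler_pXn2r _ 2) ?nnegrE ?sqrtr_ge0 ?mulr_ge0 ?expR_ge0 // sqr_sqrtr ?(ltW p0) //.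
    rewrite exprMn -expRM_natl /p.
    have h1 : expR (- (s%:R * A / 8)) <= expR (2%:R * - (s%:R * (ell + 1))).
      rewrite ler_expR; have := ler_wpM2l (ler0n R s) lA; lra.
    have := expR_ge0 (2%:R * - (s%:R * (ell + 1))); lra.
  have e2 : expR (- (s%:R * (ell + 1))) * ln n <= (1 / 2) ^+ s.
    apply: (@le_trans _ _ (expR (-1) ^+ s)).
      rewrite LE -expRD -expRM_natl ler_expR.
      have : ell <= s%:R * ell by rewrite ler_peMl.
      lra.
    by rewrite lerXn2r ?nnegrE ?expR_ge0 // half_le_expN1.
  have := ler_wpM2r (ltW (lt_le_trans ltr01 L1)) sp.
  move: e2; lra.
have sumk k : \sum_(s < k.+1) (if s == 0%N :> nat then 1 else 210 * (1 / 2) ^+ s + 16 / n ^+ 3)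
    <= 211 + k.+1%:R * (16 / n ^+ 3) - 420 * (1 / 2) ^+ k.+1 :> R.
  have c0 : 0 <= 16 / n ^+ 3 by rewrite divr_ge0 // exprn_ge0.
  move: (16 / n ^+ 3) c0 => c c0.
  elim: k => [|k IHk].
    by rewrite big_ord1 /= expr1; rewrite mul1r; lra.
  rewrite big_ord_recr /=; apply: le_trans (lerD IHk (lexx _)) _.
  rewrite -[k.+2%:R]natr1 [(1 / 2) ^+ k.+2]exprS.
  by move: ((1 / 2) ^+ k.+1) (k.+1%:R : R) => y z; lra.
apply: le_trans (ler_sum _ (fun s _ => bnd s)) _.
rewrite -mulr_suml.
(* 1 for the bottom layer, 210 for the geometric series and at most 16 for the n error terms; 227 *
   8 = 1816. *)
have h227 : \sum_(s < #|X|) (if s == 0%N :> nat then 1 else 210 * (1 / 2) ^+ s + 16 / n ^+ 3)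
    <= 227 :> R.
  have c16 : n * (16 / n ^+ 3) <= 16.
    have -> : n * (16 / n ^+ 3) = 16 / n ^+ 2 by field; rewrite gt_eqF //; lra.
    rewrite ler_pdivrMr ?exprn_gt0 //; last lra.
    by nra.
  have := sumk #|X|.-1; rewrite prednK ?(leq_trans _ X3) //.
  have : 0 <= (1 / 2 : R) ^+ #|X| by rewrite exprn_ge0 // divr_ge0.
  lra.
apply: le_trans (ler_wpM2r Phi0 h227) _.
lra.
Qed.

End SubsampleBound.

Section SubsampleMain.
Variables (R : realType) (X : finType) (d : X -> X -> R) (q : nat).
Hypothesis dP : pseudometric d.
Local Notation n := (#|X|%:R : R).
Local Notation eps := (q.+1%:R^-1 : R).

Lemma subnorm_le (p : nat) (A : R) :
  (3 <= #|X|)%N -> (0 < p)%N -> (2 * p ^ 2 <= #|X|)%N ->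
  16 * (ln (ln n) + 1) <= A -> A <= eps * (p ^ 2)%:R ->
  subnorm q d <= (2304 * (p%:R * Num.sqrt p%:R) * eps + 1816 * Num.sqrt (A * eps)) * signnorm d.
Proof.
move=> X3 p0 pX lA Ap.
have pm : (0 < p ^ 2 <= #|X|)%N by rewrite expn_gt0 p0 (leq_trans _ pX) // leq_pmull.
have [r rP] := nbr_radius dP pm.
have r0 x : 0 <= r x by case: (rP x).
have mr x : (p ^ 2 <= #|cball d x (r x)|)%N by case: (rP x).
have ro x : (#|oball d x (r x)| < p ^ 2)%N by case: (rP x).
have [h [hr hmeet hdisj]] := vitali dP r0.
have p2 : (0 < p ^ 2)%N by case/andP: pm.
have far := far_bound dP X3 p2 r0 mr hr hdisj lA Ap.
have cost := transport_cost dP p2 r0 mr hr hmeet.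
have rad := radius_sum dP p0 pX r0 ro.
have ne i : (0 < #|target d (p ^ 2) r h i|)%N by rewrite (leq_trans p2) // target_size.
apply: le_trans (ler_avg (fun w => near_far dP w ne)) _.
rewrite avgD mulrDl lerD //.
rewrite avg_sum.
rewrite (eq_bigr (fun x => eps * ((\sum_(y in target d (p ^ 2) r h (h x)) d x y) /
    #|target d (p ^ 2) r h (h x)|%:R))) => [|x _].
  rewrite -mulr_sumr; apply: (@le_trans _ _ (eps * (4 * (576 * (p%:R * Num.sqrt p%:R) * signnorm d)))).
    rewrite ler_wpM2l ?invr_ge0 ?ler0n //; apply: (le_trans cost).
    by rewrite ler_wpM2l.
  by rewrite le_eqVlt; apply/orP; left; apply/eqP; ring.
rewrite avg_pair -(pr_color R q x) /pr [RHS]mulrC -avgZ; apply: eq_avg => c /=.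
by rewrite (avg_const [ffun=> true]) mulrC.
Qed.

End SubsampleMain.

(** * Uniformly random subsets *)

Section RandomSubsets.
Variables (R : realType) (X : finType) (d : X -> X -> R).
Hypothesis dP : pseudometric d.
Local Notation n := (#|X|%:R : R).

(* Mean norm of the indicator of a uniformly random set of cardinal #|K|. *)
Definition subsetnorm (K : {set X}) : R :=
  avg (fun p : {perm X} => knorm d (fun x => (p x \in K)%:R)).

Lemma subsetnorm_ge0 K : 0 <= subsetnorm K.
Proof. by apply: avg_ge0 => p; apply: knorm_ge0. Qed.

Lemma perm_between (K L : {set X}) : #|K| = #|L| ->
  exists g : {perm X}, forall x, (g x \in L) = (x \in K).
Proof.
elim: {K}_.+1 {-2}K (ltnSn #|K :\: L|) => // k IHk K Kk KL.
have [K0|[x]] := set_0Vmem (K :\: L).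
  exists 1%g => x; rewrite perm1.
  suff -> : K = L by [].
  by apply/eqP; rewrite eqEcard KL leqnn andbT -setD_eq0 K0.
rewrite inE => /andP[xL xK].
have : (0 < #|L :\: K|)%N.
  have := cardsD K L; have := cardsD L K; rewrite setIC KL => -> h.
  have : (0 < #|K :\: L|)%N by apply/card_gt0P; exists x; rewrite inE xL.
  by rewrite h.
case/card_gt0P => y; rewrite inE => /andP[yK yL].
have yx : y != x by apply: contraNneq yK => ->.
pose K' := y |: K :\ x.
have cK' : #|K'| = #|K|.
  by rewrite cardsU1 !inE (negbTE yK) andbF (cardsD1 x K) xK.
have [||g gP] := IHk K'; rewrite ?cK' //.
  apply: leq_trans (_ : (#|K :\: L| <= k)%N) => //.
  apply: proper_card; apply/properP; split; last first.
    by exists x; rewrite !inE ?xL // eq_sym (negbTE yx) eqxx.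
  apply/fintype.subsetP => z; rewrite !inE => /andP[zL /orP[/eqP zy|/andP[_ zK]]].
    by rewrite zy yL in zL.
  by rewrite zL.
exists (tperm x y * g)%g => z; rewrite permM gP /K' !inE.
case: tpermP => [->|->|/eqP zx /eqP zy]; first by rewrite eqxx xK.
- by rewrite eq_sym (negbTE yx) eqxx (negbTE yK).
- by rewrite (negbTE zy) zx.
Qed.

Lemma subsetnorm_card (K L : {set X}) : #|K| = #|L| -> subsetnorm K = subsetnorm L.
Proof.
move=> /perm_between[g gP]; rewrite /subsetnorm.
rewrite [RHS](@avg_reindex _ _ _ (fun p => p * g)%g).
  by apply: eq_avg => p; congr knorm; apply/funext => x; rewrite permM gP.
by exists (fun p => p * g^-1)%g => p; rewrite ?mulgK ?mulgKV.
Qed.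

(** The indicator of L, counted #|K| times, is the sum of the indicators of L with one point
    removed; so T(k) / k is nonincreasing in k. *)
Lemma subsetnormU1 (K : {set X}) y : y \notin K ->
  #|K|%:R * subsetnorm (y |: K) <= #|K|.+1%:R * subsetnorm K.
Proof.
move=> yK; set L := y |: K.
have cL : #|L| = #|K|.+1 by rewrite cardsU1 yK.
have -> : #|K|.+1%:R * subsetnorm K = \sum_(z in L) subsetnorm (L :\ z).
  rewrite (eq_bigr (fun=> subsetnorm K)) => [|z zL].
    by rewrite sumr_const cL mulr_natl.
  by apply: subsetnorm_card; have := cardsD1 z L; rewrite zL cL => -[].
rewrite /subsetnorm -avg_sum -avgZ; apply: ler_avg => p.
rewrite -[X in X * _](@ger0_norm _ #|K|%:R) // -knormZ //.
apply: le_trans (knorm_sum dP _ _).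
rewrite le_eqVlt; apply/orP; left; apply/eqP; congr knorm; apply/funext => x.
case: (boolP (p x \in L)) => [xL|xL]; last first.
  rewrite mulr0 big1 // => z _; by rewrite inE (negbTE xL) andbF.
rewrite (bigD1 (p x)) //= !inE eqxx /= add0r mulr1.
rewrite (eq_bigr (fun=> 1)) => [|z /andP[_ zx]]; last first.
  by rewrite in_setD1 xL andbT eq_sym zx.
rewrite sumr_const; congr (_%:R); have := cardsD1 (p x) L; rewrite xL cL => -[->].
by apply: eq_card => z; rewrite in_setD1 andbC.
Qed.

Lemma subsetnormC (K : {set X}) : subsetnorm (~: K) = subsetnorm K.
Proof.
apply: eq_avg => p; rewrite -(knormN dP) -(knorm_shift d _ 1); congr knorm.
by apply/funext => x; rewrite inE; case: (p x \in K); rewrite /= ?oppr0 ?add0r ?addNr.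
Qed.

(** [subsetnormU1] applied to complements: T(k) / (n - k) is nondecreasing in k. This lets a random
    set with at least k points control T(k). *)
Lemma subsetnorm_sub (K L : {set X}) : K \subset L ->
  subsetnorm K * (n - #|L|%:R) <= (n - #|K|%:R) * subsetnorm L.
Proof.
move=> /setUidPr <-; move: L; apply: set_ind => [|y L yL IH].
  by rewrite setU0 mulrC.
rewrite setUCA; have [yK|yK] := boolP (y \in K :|: L).
  by rewrite (setUidPr _) // sub1set.
set M := K :|: L in yK IH *.
have cC : #|~: (y |: M)|%:R = n - #|M|%:R - 1 :> R.
  have := cardsC (y |: M); rewrite cardsU1 yK add1n => <-.
  by rewrite natrD -natr1; ring.
have := @subsetnormU1 (~: (y |: M)) y; rewrite !inE eqxx => /(_ isT).
have -> : y |: ~: (y |: M) = ~: M.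
  apply/setP => z; rewrite !inE negb_or; case: eqP => [->|//] /=.
  by move: yK; rewrite /M inE => ->.
rewrite !subsetnormC -natr1 cC cardsU1 yK natrD.
set a := n - #|M|%:R in IH *; set b := n - #|K|%:R in IH *.
have a1 : 1 <= a.
  by rewrite -subr_ge0 -cC.
have -> : n - (1%:R + #|M|%:R) = a - 1 by rewrite /a; ring.
rewrite subrK => h; have a0 : 0 < a by lra.
rewrite -(ler_pM2l a0).
have := ler_wpM2r (_ : 0 <= a - 1) IH; rewrite -/a => /(_ ltac:(lra)) h2.
have b0 : 0 <= b by rewrite subr_ge0 ler_nat max_card.
have := ler_wpM2l b0 h.
lra.
Qed.

Lemma subsetnorm_mono (K L : {set X}) : (#|K| <= #|L|)%N ->
  subsetnorm K * (n - #|L|%:R) <= n * subsetnorm L.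
Proof.
move=> KL.
have [K' [K'L cK']] : exists K' : {set X}, K' \subset L /\ #|K'| = #|K|.
  move: KL => /card_geqP[s [us ss sL]]; exists [set x in s]; split.
    by apply/fintype.subsetP => x; rewrite inE => /sL.
  by rewrite cardsE; move/card_uniqP: us => ->.
rewrite -(subsetnorm_card cK'); apply: le_trans (subsetnorm_sub K'L) _.
by rewrite ler_wpM2r ?subsetnorm_ge0 // gerBl.
Qed.

(** A sign vector is 1 minus twice an indicator, and a uniformly random set is exchangeable, hence a
    mixture of uniform sets of fixed cardinal. *)
Lemma signnorm_le_subsetnorm (c : R) :
  (forall K, subsetnorm K <= c) -> signnorm d <= 2 * c.
Proof.
move=> Kc; pose S (s : {ffun X -> bool}) : {set X} := [set x | s x].
have E (s : {ffun X -> bool}) : knorm d (fun x => sg R (s x)) = 2 * knorm d (fun x => (x \in S s)%:R).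
  rewrite -[X in X * _](@ger0_norm _ 2) // -knormZ // -(knormN dP).
  rewrite -[RHS](knorm_shift d _ (- 1)); congr knorm; apply/funext => x.
  by rewrite inE /sg; case: (s x); rewrite /= ?expr1 ?expr0; ring.
rewrite /signnorm (eq_avg E) avgZ ler_wpM2l //.
rewrite -[leLHS](avg_const (1%g : {perm X})).
have -> : avg (fun _ : {perm X} => avg (fun s => knorm d (fun x => (x \in S s)%:R))) =
  avg (fun p : {perm X} => avg (fun s => knorm d (fun x => (p x \in S s)%:R))).
  apply: eq_avg => p; rewrite [LHS](@avg_reindex _ _ _ (fun s : {ffun X -> bool} => [ffun x => s (p x)])).
    by apply: eq_avg => s; congr knorm; apply/funext => x; rewrite !inE ffunE.
  exists (fun s : {ffun X -> bool} => [ffun x => s ((p^-1)%g x)]) => s;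
  by apply/ffunP => x; rewrite !ffunE ?permK ?permKV.
rewrite avg_exchange; apply: avg_le_const => [|s]; last exact: Kc.
exact: le_trans (subsetnorm_ge0 set0) (Kc _).
Qed.

End RandomSubsets.

(** * From subsets of fixed size to independent sampling *)

Section SubsetSubsample.
Variables (R : realType) (X : finType) (d : X -> X -> R) (q : nat).
Hypothesis dP : pseudometric d.
Local Notation n := (#|X|%:R : R).
Local Notation eps := (q.+1%:R^-1 : R).
Local Notation col := ({ffun X -> 'I_q.+1}).

Definition kept (c : col) : {set X} := [set x | c x == ord0].

Lemma kept_card_mgf : avg (fun c : col => expR (- (#|kept c|%:R))) <= expR (- (n * eps / 2)) :> R.
Proof.
have e0 : 0 <= eps by rewrite invr_ge0 ler0n.
have -> : avg (fun c : col => expR (- (#|kept c|%:R))) =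
    avg (fun c : col => \prod_x (if c x == ord0 then expR (-1) else 1)) :> R.
  apply: eq_avg => c; rewrite -big_mkcond -expR_sum; congr expR.
  rewrite sumrN sumr_const; congr (- _%:R).
  by apply: eq_card => x; rewrite inE.
rewrite (avg_ffun_prod (fun x (e : 'I_q.+1) => if e == ord0 then expR (-1) else 1 : R)).
rewrite (eq_bigr (fun=> 1 + eps * (expR (-1) - 1))) => [|x _]; last exact: avg_color.
rewrite prodr_const (_ : - (n * eps / 2) = #|X|%:R * (- (eps / 2))); last by ring.
rewrite expRM_natl lerXn2r ?nnegrE ?expR_ge0 //; last first.
  apply: le_trans (expR_ge1Dx _); rewrite lerD2l.
  have := ler_wpM2l e0 (half_le_expN1 R).
  by move: (q.+1%:R^-1 : R) (expR (-1)) => e y; lra.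
have : 0 <= eps * expR (-1) by rewrite mulr_ge0 ?expR_ge0.
have : eps <= 1 by rewrite invf_le1 ?ler1n ?ltr0n.
by move: (q.+1%:R^-1 : R) (expR (-1)) => e y; lra.
Qed.

Lemma pr_few_kept (k : nat) : (0 < k)%N -> 8 * k%:R <= n * eps ->
  pr R (fun c : col => (#|kept c| < k)%N) <= 1 / 8.
Proof.
move=> k0 kn.
apply: le_trans (@pr_markov R _ (fun c : col => (#|kept c| < k)%N)
  (fun c => expR (- (#|kept c|%:R))) (expR (- k%:R)) (expR_gt0 _)
  (fun c => expR_ge0 _) _) _.
  by move=> c /ltnW h; rewrite ler_expR lerN2 ler_nat.
rewrite ler_pdivrMr ?expR_gt0 //; apply: le_trans kept_card_mgf _.
apply: (@le_trans _ _ (expR (3%:R * -1 + - k%:R))).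
  rewrite ler_expR; have : 1 <= k%:R :> R by rewrite ler1n.
  by move: (n * eps) (k%:R : R) kn => y z; lra.
rewrite expRD expRM_natl ler_wpM2r ?expR_ge0 //.
have -> : 1 / 8 = (1 / 2) ^+ 3 :> R by field.
by rewrite lerXn2r ?nnegrE ?expR_ge0 ?divr_ge0 // half_le_expN1.
Qed.

Lemma avg_kept_card : avg (fun c : col => #|kept c|%:R) = n * eps :> R.
Proof.
have -> : avg (fun c : col => #|kept c|%:R) = \sum_(x : X) pr R (fun c : col => c x == ord0).
  rewrite /pr -avg_sum; apply: eq_avg => c; rewrite -sum1_card natr_sum.
  rewrite [LHS]big_mkcond; apply: eq_bigr => x _.
  by rewrite inE; case: (c x == ord0).
rewrite (eq_bigr (fun=> eps)) => [|x _]; last exact: pr_color.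
by rewrite sumr_const -[LHS]mulr_natl.
Qed.

(** 3/8 = 1 - 1/2 - 1/8: the mean kept fraction is at most 1/2 since q > 0, and fewer than #|K|
    points are kept with probability at most 1/8. *)
Lemma subsetnorm_le_kept (K : {set X}) : (0 < q)%N -> (0 < #|K|)%N ->
  8 * #|K|%:R <= n * eps ->
  subsetnorm d K * (3 / 8) <= avg (fun c : col => subsetnorm d (kept c)).
Proof.
move=> q0 K0 Kn.
have n0 : 0 < n by rewrite ltr0n (leq_trans K0) // max_card.
have T0 := subsetnorm_ge0 dP K.
have pt (c : col) : subsetnorm d K * (1 - #|kept c|%:R / n - (#|kept c| < #|K|)%N%:R)
    <= subsetnorm d (kept c).
  have S0 := subsetnorm_ge0 dP (kept c).
  case: (boolP (#|kept c| < #|K|)%N) => [_|]; last rewrite -leqNgt => /(subsetnorm_mono dP) h.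
    apply: le_trans S0; rewrite mulr_ge0_le0 //.
    have : 0 <= #|kept c|%:R / n by rewrite divr_ge0 // ltW.
    by rewrite /= mulr1n; lra.
  rewrite /= subr0 -(ler_pM2l n0); apply: le_trans h.
  rewrite mulrCA le_eqVlt; apply/orP; left; apply/eqP; congr (_ * _).
  by field; rewrite gt_eqF.
apply: le_trans (ler_avg pt); rewrite avgZ ler_wpM2l //.
rewrite 2!avgD !avgN (avg_const [ffun=> ord0]).
have -> : avg (fun c : col => #|kept c|%:R / n) = eps.
  have -> : avg (fun c : col => #|kept c|%:R / n) = n^-1 * avg (fun c : col => #|kept c|%:R).
    by rewrite -avgZ; apply: eq_avg => c; rewrite mulrC.
  by rewrite avg_kept_card mulrA mulVf ?mul1r // gt_eqF.
have := pr_few_kept K0 Kn; rewrite /pr.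
have : eps <= 1 / 2 by rewrite div1r lef_pV2 ?posrE // ler_nat.
by move: (q.+1%:R^-1 : R) => e; lra.
Qed.

Lemma avg_knorm_kept :
  avg (fun c : col => subsetnorm d (kept c)) = avg (fun c : col => knorm d (fun x => (x \in kept c)%:R)).
Proof.
rewrite /subsetnorm avg_exchange -[RHS](avg_const (1%g : {perm X})).
apply: eq_avg => p; rewrite [RHS](@avg_reindex _ _ _ (fun c : col => [ffun x => c (p x)])).
  by apply: eq_avg => c; congr knorm; apply/funext => x; rewrite !inE ffunE.
exists (fun c : col => [ffun x => c ((p^-1)%g x)]) => c;
by apply/ffunP => x; rewrite !ffunE ?permK ?permKV.
Qed.

(** Symmetrisation: the mean of an independent copy is constant, so subtracting the copy can only
    increase the mean norm; exchanging the two copies at random points then introduces signs. *)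
Lemma avg_kept_le_subnorm :
  avg (fun c : col => knorm d (fun x => (x \in kept c)%:R)) <= 2 * subnorm q d.
Proof.
pose ind (c : col) x : R := (x \in kept c)%:R.
apply: (@le_trans _ _ (avg (fun c => avg (fun c' => knorm d (fun x => ind c x - ind c' x))))).
  apply: ler_avg => c; apply: le_trans (knorm_avg dP _).
  rewrite -(knorm_shift d _ (- eps)) le_eqVlt; apply/orP; left; apply/eqP; congr knorm.
  apply/funext => x; rewrite avgD avgN (avg_const [ffun=> ord0]); congr (_ - _).
  rewrite -(pr_color R q x); apply: eq_avg => c'; by rewrite /ind inE.
pose sw (u : {ffun X -> bool}) (cc : col * col) : col * col :=
  ([ffun x => if u x then cc.2 x else cc.1 x], [ffun x => if u x then cc.1 x else cc.2 x]).
have swK u : involutive (sw u).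
  move=> [c c']; congr (_, _); apply/ffunP => x; rewrite !ffunE /=;
  by case: (u x).
rewrite -(avg_pair (fun cc : col * col => knorm d (fun x => ind cc.1 x - ind cc.2 x))).
rewrite -[leLHS](avg_const [ffun _ : X => true]).
have -> : avg (fun _ : {ffun X -> bool} =>
    avg (fun cc : col * col => knorm d (fun x => ind cc.1 x - ind cc.2 x))) =
   avg (fun u : {ffun X -> bool} => avg (fun cc : col * col =>
     knorm d (fun x => sg R (u x) * (ind cc.1 x - ind cc.2 x)))).
  apply: eq_avg => u; rewrite (@avg_reindex _ _ _ (sw u)); last exact: inv_bij (swK u).
  apply: eq_avg => cc; congr knorm; apply/funext => x; rewrite /ind !inE !ffunE /sg.
  by case: (u x); rewrite ?expr1 ?expr0; ring.
have E : avg (fun u : {ffun X -> bool} => avg (fun c : col => knorm d (fun x => sg R (u x) * ind c x)))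
    = subnorm q d.
  rewrite avg_exchange /subnorm avg_pair; apply: eq_avg => c; apply: eq_avg => u.
  by congr knorm; apply/funext => x; rewrite /sgsample /ind inE mulrC.
have -> : 2 * subnorm q d = avg (fun u : {ffun X -> bool} => avg (fun cc : col * col =>
    knorm d (fun x => sg R (u x) * ind cc.1 x) + knorm d (fun x => sg R (u x) * ind cc.2 x))).
  rewrite -E mulr_natl mulr2n -avgD; apply: eq_avg => u.
  rewrite avgD !avg_pair /= (avg_const [ffun=> ord0]); congr (_ + _).
  by apply: eq_avg => c; rewrite (avg_const [ffun=> ord0]).
apply: ler_avg => u; apply: ler_avg => cc.
rewrite -[X in _ <= _ + X](knormN dP); apply: le_trans (knormD dP _ _).
by rewrite le_eqVlt; apply/orP; left; apply/eqP; congr knorm; apply/funext => x; rewrite mulrBr.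
Qed.

Lemma subsetnorm_le_subnorm (K : {set X}) : (0 < q)%N -> (0 < #|K|)%N ->
  8 * #|K|%:R <= n * eps -> subsetnorm d K <= 6 * subnorm q d.
Proof.
move=> q0 K0 Kn; have := subsetnorm_le_kept q0 K0 Kn.
rewrite avg_knorm_kept; have := avg_kept_le_subnorm; have := subnorm_ge0 q dP; lra.
Qed.

End SubsetSubsample.

(** * Request sequences and offline optimum *)

Section Expectation.
Variables (R : realType) (n : nat) (I : instance R n).
Implicit Types (r : requests I) (f : requests I -> R).
Local Notation E := (@iid_expectation R n I).

Definition weight r : R := \prod_i req_law (r i).

Lemma weight_ge0 r : 0 <= weight r.
Proof. by apply: prodr_ge0 => i _; apply: req_law_ge0. Qed.

Lemma sum_weight : \sum_r weight r = 1.
Proof.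
rewrite -(bigA_distr_bigA (fun (_ : 'I_n) (x : Defs.point I) => req_law x)).
by rewrite big1 // => i _; apply: req_law_sum1.
Qed.

Lemma eq_iid f g : f =1 g -> E f = E g.
Proof. by move=> fg; apply: eq_bigr => r _; rewrite fg. Qed.

Lemma iidD f g : E (fun r => f r + g r) = E f + E g.
Proof. by rewrite /iid_expectation -big_split; apply: eq_bigr => r _ /=; rewrite mulrDr. Qed.

Lemma iidZ c f : E (fun r => c * f r) = c * E f.
Proof. by rewrite /iid_expectation mulr_sumr; apply: eq_bigr => r _; rewrite mulrCA. Qed.

Lemma iid_cst c : E (fun=> c) = c.
Proof. by rewrite /iid_expectation -mulr_suml sum_weight mul1r. Qed.

Lemma ler_iid f g : (forall r, f r <= g r) -> E f <= E g.
Proof. by move=> fg; apply: ler_sum => r _; rewrite ler_wpM2l // weight_ge0. Qed.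

Lemma iid_ge0 f : (forall r, 0 <= f r) -> 0 <= E f.
Proof. by move=> f0; rewrite -(iid_cst 0); apply: ler_iid. Qed.

Lemma iid_sum (J : finType) (P : pred J) (F : J -> requests I -> R) :
  E (fun r => \sum_(j | P j) F j r) = \sum_(j | P j) E (F j).
Proof.
by rewrite /iid_expectation exchange_big; apply: eq_bigr => r _ /=; rewrite mulr_sumr.
Qed.

Lemma iid_avg (T : finType) (F : T -> requests I -> R) :
  E (fun r => avg (F^~ r)) = avg (fun t => E (F t)).
Proof.
by rewrite /avg -iid_sum mulrC -iidZ; apply: eq_iid => r; rewrite mulrC.
Qed.

Lemma iid_perm (s : 'S_n) f : E (fun r => f [ffun i => r (s i)]) = E f.
Proof.
have bij : bijective (fun r : requests I => [ffun i => r (s i)] : requests I).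
  by exists (fun r : requests I => [ffun i => r ((s^-1)%g i)]) => r; apply/ffunP => i;
    rewrite !ffunE ?permK ?permKV.
rewrite /iid_expectation [RHS](reindex _ (onW_bij _ bij)) /=.
apply: eq_bigr => r _; congr (_ * _).
rewrite [LHS](reindex_inj (@perm_inj _ s)) /=.
by apply: eq_bigr => i _; rewrite ffunE.
Qed.

Definition mix (K : {set 'I_n}) r r' : requests I := [ffun i => if i \in K then r i else r' i].

Lemma iid_mix K f : E (fun r => E (fun r' => f (mix K r r'))) = E f.
Proof.
have -> : E f = E (fun r => E (fun r' => f r)) by apply: eq_iid => r; rewrite iid_cst.
have EE (g : requests I -> requests I -> R) : E (fun r => E (g r)) =
    \sum_(p : requests I * requests I) weight p.1 * (weight p.2 * g p.1 p.2).
  rewrite -(pair_bigA _ (fun r r' => weight r * (weight r' * g r r'))) /=.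
  by apply: eq_bigr => r _; rewrite -mulr_sumr.
rewrite !EE.
pose sw (rr : requests I * requests I) := (mix K rr.1 rr.2, mix K rr.2 rr.1).
have swK : involutive sw.
  by move=> [r r']; congr (_, _); apply/ffunP => i; rewrite !ffunE /=; case: (i \in K).
rewrite [RHS](reindex sw) /=; last by apply: onW_bij; apply: inv_bij.
apply: eq_bigr => -[r r'] _ /=; rewrite !mulrA; congr (_ * _).
rewrite -!big_split; apply: eq_bigr => i _ /=.
by rewrite !ffunE; case: (i \in K) => //; rewrite mulrC.
Qed.

Lemma iid_marginal i (g : Defs.point I -> R) : E (fun r => g (r i)) = \sum_x req_law x * g x.
Proof.
have -> : E (fun r => g (r i)) =
    \sum_(r : requests I) \prod_j (req_law (r j) * (if j == i then g (r j) else 1)).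
  apply: eq_bigr => r _; rewrite big_split /=; congr (_ * _).
  by rewrite (bigD1 i) //= eqxx big1 ?mulr1 // => j /negbTE ->.
rewrite -(bigA_distr_bigA (fun j x => req_law x * (if j == i then g x else 1))).
rewrite (bigD1 i) //= eqxx [X in _ * X]big1 ?mulr1 // => j /negbTE ->.
by under eq_bigr => x _ do rewrite mulr1; apply: req_law_sum1.
Qed.

Definition upd r (k : 'I_n) (x : Defs.point I) : requests I := [ffun i => if i == k then x else r i].

Lemma iid_resample k f : E f = E (fun r => \sum_x req_law x * f (upd r k x)).
Proof.
have -> : E f = E (fun r => \sum_(x : Defs.point I) req_law x * f r).
  by apply: eq_iid => r; rewrite -mulr_suml req_law_sum1 mul1r.
have EE (g : requests I -> Defs.point I -> R) : E (fun r => \sum_x req_law x * g r x) =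
    \sum_(p : requests I * Defs.point I) weight p.1 * (req_law p.2 * g p.1 p.2).
  rewrite -(pair_bigA _ (fun r x => weight r * (req_law x * g r x))) /=.
  by apply: eq_bigr => r _; rewrite -mulr_sumr.
rewrite !EE.
pose sw (rx : requests I * Defs.point I) := (upd rx.1 k rx.2, rx.1 k).
have swK : involutive sw.
  move=> [r x]; rewrite /sw /= ffunE eqxx; congr (_, _).
  by apply/ffunP => i; rewrite !ffunE; case: eqP => [->|].
rewrite [LHS](reindex sw) /=; last by apply: onW_bij; apply: inv_bij.
apply: eq_bigr => -[r x] _ /=; rewrite !mulrA; congr (_ * _).
rewrite /weight (bigD1 k) //= [in RHS](bigD1 k) //= ffunE eqxx.
rewrite (eq_bigr (fun i => req_law (r i))) => [|i /negbTE ik]; first by ring.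
by rewrite ffunE ik.
Qed.

End Expectation.

(** * Offline matchings and Kantorovich duality *)

Section OfflineOptimum.
Variables (R : realType) (n : nat) (I : instance R n).
Implicit Types (r : requests I).
Local Notation E := (@iid_expectation R n I).
Local Notation srv := (server I).
Local Notation X := 'I_n.

Definition sdist (i j : X) : R := mdist (srv i) (srv j).

Lemma sdistP : pseudometric sdist.
Proof.
split => [x|x y|x y z]; first exact: mdistxx; first exact: metric_sym.
exact: metric_triangle.
Qed.

Lemma OPT_ex r : exists s : 'S_n, matching_cost r s = OPT r.
Proof.
rewrite /OPT; elim/big_ind: _ => [|x y [s <-] [t <-]|s _].
- by exists 1%g; apply: eq_bigr => i _; rewrite perm1.
- by case: (leP (matching_cost r s) (matching_cost r t)) => _; [exists s|exists t].
- by exists s.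
Qed.

Definition opt_match r : 'S_n := projT1 (cid (OPT_ex r)).

Lemma opt_matchE r : matching_cost r (opt_match r) = OPT r.
Proof. by rewrite /opt_match; case: cid. Qed.

Lemma OPT_ge0 r : 0 <= OPT r.
Proof. by rewrite -opt_matchE; apply: sumr_ge0 => i _; apply: mdist_ge0. Qed.

Lemma expected_OPT_ge0 : 0 <= expected_OPT I.
Proof. by apply: iid_ge0 => r; apply: OPT_ge0. Qed.

Definition plip (g : Defs.point I -> R) := forall p q, g p - g q <= mdist p q.

(* Cost of serving [p] from [S] when using server [s] entails the extra cost [c s];
   as an inf-convolution with the metric it is 1-Lipschitz in [p]. *)
Definition best (S : {set X}) (c : X -> R) (s0 : X) (p : Defs.point I) : X :=
  [arg min_(s < s0 in S) (mdist p (srv s) + c s)]%O.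
Definition service (S : {set X}) (c : X -> R) (s0 : X) (p : Defs.point I) : R :=
  mdist p (srv (best S c s0 p)) + c (best S c s0 p).

Lemma bestP (S : {set X}) c s0 p : s0 \in S -> best S c s0 p \in S /\
  (forall s, s \in S -> service S c s0 p <= mdist p (srv s) + c s).
Proof. by move=> s0S; rewrite /service /best; case: arg_minP. Qed.

Lemma service_lip (S : {set X}) c s0 : s0 \in S -> plip (service S c s0).
Proof.
move=> s0S p q; have [qS _] := bestP c q s0S; have [_ /(_ _ qS)] := bestP c p s0S.
have := metric_triangle p q (srv (best S c s0 q)).
by rewrite [X in _ -> _ -> _ - X <= _]/service; lra.
Qed.

(** McShane extension: it is the inf-convolution [service] over all servers, with extra cost f. *)
Lemma lip_extend (f : X -> R) : (0 < n)%N -> lip sdist f ->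
  exists2 g, plip g & forall i, g (srv i) = f i.
Proof.
move=> n0 fL; pose i0 := Ordinal n0; have i0T : i0 \in [set: X] by rewrite inE.
exists (service [set: X] f i0); first exact: service_lip.
move=> i; have [_ /(_ i)] := bestP f (srv i) i0T; rewrite inE mdistxx add0r => /(_ isT) h.
apply/eqP; rewrite eq_le h /= /service; set j := best _ _ _ _.
by have := fL i j; rewrite /sdist; lra.
Qed.

Lemma plip_sum_le r (s : 'S_n) (g : Defs.point I -> R) : plip g ->
  `|\sum_i g (r i) - \sum_i g (srv i)| <= matching_cost r s.
Proof.
move=> gL; rewrite [X in _ - X](reindex_inj (@perm_inj _ s)) /= -sumrB.
apply: le_trans (ler_norm_sum _ _ _) _; apply: ler_sum => i _.
rewrite ler_norml; have := gL (r i) (srv (s i)); have := gL (srv (s i)) (r i).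
by rewrite [mdist (srv _) _]metric_sym; lra.
Qed.

(** Dual form of the fact that the transport distance between the request law and the uniform law on
    all servers is at most E[OPT] / n. *)
Lemma plip_law_le (g : Defs.point I -> R) : plip g ->
  n%:R * (\sum_x req_law x * g x) - \sum_i g (srv i) <= expected_OPT I.
Proof.
move=> gL.
have -> : n%:R * (\sum_x req_law x * g x) = E (fun r => \sum_i g (r i)).
  rewrite iid_sum [RHS](eq_bigr (fun=> \sum_x req_law x * g x)) => [|i _]; last exact: (iid_marginal i g).
  by rewrite sumr_const card_ord mulr_natl.
rewrite -[X in _ - X](iid_cst I) lerBlDr -iidD; apply: ler_iid => r.
have := plip_sum_le r (opt_match r) gL; rewrite opt_matchE ler_norml.
by move=> /andP[_]; lra.
Qed.

(* The sequence that follows r on K and r' elsewhere differs from r' only on K, so both of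
   its matchings bound the difference of the two partial sums. *)
Lemma subset_pairing_le r r' (K : {set X}) (rho pi : 'S_n) (f : X -> R) :
  (0 < n)%N -> lip sdist f ->
  \sum_(j in K) (f (opt_match r (rho j)) - f (opt_match r' (pi j))) <=
  OPT r + 2 * OPT r' + OPT (mix K [ffun i => r (rho i)] [ffun i => r' (pi i)]).
Proof.
move=> n0 fL; have [g gL gf] := lip_extend n0 fL.
set a := mix _ _ _.
have part r1 (t : 'S_n) : \sum_(j in K) mdist (r1 (t j)) (srv (opt_match r1 (t j))) <= OPT r1.
  rewrite -opt_matchE /matching_cost [leRHS](reindex_inj (@perm_inj _ t)) /=.
  rewrite [leRHS](bigID [in K]) /= lerDl; apply: sumr_ge0 => j _; exact: mdist_ge0.
have h1 : \sum_(j in K) (g (r (rho j)) - g (r' (pi j))) <= OPT a + OPT r'.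
  have -> : \sum_(j in K) (g (r (rho j)) - g (r' (pi j))) =
      (\sum_j g (a j) - \sum_i g (srv i)) - (\sum_j g (r' j) - \sum_i g (srv i)).
    rewrite opprB addrA subrK [X in _ - X](reindex_inj (@perm_inj _ pi)) /= -sumrB.
    rewrite [LHS]big_mkcond; apply: eq_bigr => j _.
    by rewrite /a !ffunE; case: (j \in K) => //; rewrite subrr.
  have := plip_sum_le a (opt_match a) gL; have := plip_sum_le r' (opt_match r') gL.
  by rewrite !opt_matchE !ler_norml => /andP[? ?] /andP[? ?]; lra.
have h2 : \sum_(j in K) (f (opt_match r (rho j)) - f (opt_match r' (pi j))) <=
  \sum_(j in K) (g (r (rho j)) - g (r' (pi j))) +
  (\sum_(j in K) mdist (r (rho j)) (srv (opt_match r (rho j))) +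
   \sum_(j in K) mdist (r' (pi j)) (srv (opt_match r' (pi j)))).
  rewrite -!big_split; apply: ler_sum => j _ /=; rewrite -!gf.
  have := gL (srv (opt_match r (rho j))) (r (rho j)).
  have := gL (r' (pi j)) (srv (opt_match r' (pi j))).
  by rewrite [mdist (srv _) _]metric_sym; lra.
by have := part r rho; have := part r' pi; lra.
Qed.

(** The optimal matchings of r and r' carry shuffled copies of K to two random sets of servers.
    Averaging over the second shuffle turns its indicator into a constant, which the norm ignores.
    The spliced sequence has the law of a request sequence, whence 1 + 2 + 1 = 4. *)
Lemma subsetnorm_le_OPT (K : {set X}) : (0 < n)%N ->
  subsetnorm sdist K <= 4 * expected_OPT I.
Proof.
move=> n0; have dP := sdistP.
have step r r' : subsetnorm sdist K <= avg (fun rho : 'S_n => avg (fun pi : 'S_n =>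
    OPT r + 2 * OPT r' + OPT (mix K [ffun i => r (rho i)] [ffun i => r' (pi i)]))).
  set s := opt_match r; set s' := opt_match r'.
  pose u (rho pi : 'S_n) (x : X) : R :=
    ((rho^-1)%g ((s^-1)%g x) \in K)%:R - ((pi^-1)%g ((s'^-1)%g x) \in K)%:R.
  have uE rho pi : knorm sdist (u rho pi) <=
      OPT r + 2 * OPT r' + OPT (mix K [ffun i => r (rho i)] [ffun i => r' (pi i)]).
    apply: knorm_le => // f fL; apply: le_trans (subset_pairing_le r r' K rho pi n0 fL).
    have re (t t' : 'S_n) : \sum_x ((t^-1)%g ((t'^-1)%g x) \in K)%:R * (f x - avg f) =
        \sum_(j in K) (f (t' (t j)) - avg f).
      rewrite (reindex_inj (@perm_inj _ t')) /= (reindex_inj (@perm_inj _ t)) /=.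
      rewrite [RHS]big_mkcond; apply: eq_bigr => j _; rewrite !permK.
      by case: (j \in K); rewrite ?mul1r ?mul0r.
    rewrite /pairing /u; under eq_bigr => x _ do rewrite mulrBl.
    rewrite sumrB !re -sumrB le_eqVlt; apply/orP; left; apply/eqP.
    by apply: eq_bigr => j _; ring.
  have -> : subsetnorm sdist K =
      avg (fun rho : 'S_n => knorm sdist (fun x => ((rho^-1)%g ((s^-1)%g x) \in K)%:R)).
    rewrite /subsetnorm (@avg_reindex _ _ _ (fun rho : 'S_n => s^-1 * rho^-1)%g).
      by apply: eq_avg => rho; congr knorm; apply/funext => x; rewrite permM.
    exists (fun p : 'S_n => (s * p)^-1)%g => p; first by rewrite mulKVg invgK.
    by rewrite invgK mulKg.
  apply: ler_avg => rho; apply: le_trans (ler_avg (uE rho)).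
  apply: le_trans (knorm_avg dP _).
  pose kap y : R := avg (fun pi : 'S_n => ((pi^-1)%g y \in K)%:R).
  have kapc y y' : kap y = kap y'.
    rewrite /kap (@avg_reindex _ _ _ (fun pi : 'S_n => pi * tperm y y')%g).
      by apply: eq_avg => pi; rewrite invMg tpermV permM tpermL.
    by exists (fun pi : 'S_n => pi * tperm y y')%g => pi; rewrite -mulgA tperm2 mulg1.
  rewrite -(knorm_shift sdist _ (- kap (Ordinal n0))).
  rewrite le_eqVlt; apply/orP; left; apply/eqP; congr knorm; apply/funext => x.
  by rewrite /u avgD avgN (avg_const (1%g : 'S_n)) (kapc _ ((s'^-1)%g x)).
rewrite -[leLHS](iid_cst I); apply: le_trans (ler_iid (g := fun r => E (fun r' => 
   avg (fun rho : 'S_n => avg (fun pi : 'S_n =>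
    OPT r + 2 * OPT r' + OPT (mix K [ffun i => r (rho i)] [ffun i => r' (pi i)]))))) _) _.
  by move=> r; rewrite -[leLHS](iid_cst I); apply: ler_iid => r'; apply: step.
under eq_iid => r do (rewrite iid_avg; under eq_avg => rho do rewrite iid_avg).
rewrite iid_avg; apply: avg_le_const => [|rho]; first by rewrite mulr_ge0 ?expected_OPT_ge0.
rewrite iid_avg; apply: avg_le_const => [|pi]; first by rewrite mulr_ge0 ?expected_OPT_ge0.
under eq_iid => r do rewrite !iidD iid_cst iidZ.
rewrite !iidD iid_cst.
have -> : E (fun r => E (fun r' => OPT (mix K [ffun i => r (rho i)] [ffun i => r' (pi i)]))) = E (@OPT R n I).
  rewrite -[RHS](iid_mix K) -[RHS](iid_perm rho); apply: eq_iid => r.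
  by rewrite -[RHS](iid_perm pi).
by rewrite /expected_OPT; lra.
Qed.

End OfflineOptimum.

(** * The optimal online policy *)

Section OptimalPolicy.
Variables (R : realType) (m : nat) (I : instance R m.+1).
Local Notation n := (m.+1).
Local Notation X := 'I_m.+1.
Local Notation E := (@iid_expectation R m.+1 I).
Local Notation srv := (server I).
Implicit Types (r : requests I) (S : {set X}).

Definition some_in S : X := odflt ord0 [pick s in S].

Lemma some_inP S : (0 < #|S|)%N -> some_in S \in S.
Proof.
rewrite /some_in => /card_gt0P[x xS]; case: pickP => //= /(_ x).
by rewrite xS.
Qed.

(* Expected cost of serving k further requests optimally when S is the set of free servers. *)
Fixpoint opt_val (k : nat) S : R :=
  if k is k'.+1 then
    \sum_x req_law x * service (I := I) S (fun s => opt_val k' (S :\ s)) (some_in S) x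
  else 0.

Definition after (k : nat) S (s : X) : R := opt_val k (S :\ s).
Definition pick_server (k : nat) S (p : Defs.point I) : X :=
  best S (after k S) (some_in S) p.

Fixpoint free r (k : nat) : {set X} :=
  if k is k'.+1 then free r k' :\ pick_server (m - k') (free r k') (r (inord k')) else [set: X].

(** The choice is greedy for distance plus expected future cost, hence optimal. There are m + 1
    requests, so m - i remain after request i. *)
Definition greedy r (i : X) : X := pick_server (m - i) (free r i) (r i).

Lemma freeS r (i : X) : free r i.+1 = free r i :\ greedy r i.
Proof. by rewrite /= /greedy inord_val. Qed.

Lemma pick_server_in k S p : (0 < #|S|)%N -> pick_server k S p \in S.
Proof. by move=> S0; case: (bestP (after k S) p (some_inP S0)). Qed.

Lemma card_free r k : (k <= n)%N -> #|free r k| = (n - k)%N.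
Proof.
elim: k => [|k IHk] kn; first by rewrite cardsT card_ord subn0.
have c := IHk (ltnW kn); have fp : (0 < #|free r k|)%N by rewrite c subn_gt0.
have := cardsD1 (pick_server (m - k) (free r k) (r (inord k))) (free r k).
by rewrite pick_server_in // c /= subnS => ->.
Qed.

Lemma greedy_in r (i : X) : greedy r i \in free r i.
Proof. by apply: pick_server_in; rewrite card_free ?subn_gt0 // ltnW. Qed.

Lemma free_sub r k l : (k <= l)%N -> free r l \subset free r k.
Proof.
move=> /subnK <-; elim: (l - k)%N => [|j IHj] //.
by apply: fintype.subset_trans IHj; rewrite addSn; apply: finset.subsetDl.
Qed.

Lemma greedy_unmatched r (i j : X) : (j < i)%N -> greedy r i != greedy r j.
Proof.
move=> ji; have := fintype.subsetP (free_sub r ji) _ (greedy_in r i).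
by rewrite freeS !inE => /andP[].
Qed.

Lemma free_online r r' k : (k <= n)%N ->
  (forall j : X, (j < k)%N -> r j = r' j) -> free r k = free r' k.
Proof.
elim: k => [|k IHk] //= kn rr'.
rewrite (IHk (ltnW kn)) => [|j jk]; last by apply: rr'; rewrite ltnW.
by rewrite rr' // inordK.
Qed.

Lemma greedy_online r r' (i : X) :
  (forall j : X, (j <= i)%N -> r j = r' j) -> greedy r i = greedy r' i.
Proof.
move=> rr'; rewrite /greedy (rr' i) // (@free_online r r' i) //; first exact: ltnW.
by move=> j ji; apply: rr'; apply: ltnW.
Qed.

(** Cost already paid plus expected cost to go, whose mean does not change with k. *)
Definition potential r (k : nat) : R :=
  \sum_(i : X | (i < k)%N) mdist (r i) (srv (greedy r i)) + opt_val (n - k) (free r k).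

Lemma potentialS (k : X) : E (fun r => potential r k) = E (fun r => potential r k.+1).
Proof.
pose past r := \sum_(i : X | (i < k)%N) mdist (r i) (srv (greedy r i)).
pose F r := service (I := I) (free r k) (after (m - k) (free r k)) (some_in (free r k)) (r k).
have -> : E (fun r => potential r k.+1) = E (fun r => past r + F r).
  apply: eq_iid => r; rewrite /potential freeS subSS (bigD1 k) //= addrAC [RHS]addrC.
  congr (_ + _); apply: eq_bigl => i.
  by rewrite ltnS [RHS]ltn_neqAle andbC -val_eqE.
rewrite (iidD past (fun r => opt_val (n - k) (free r k))) (iidD past F); congr (_ + _).
rewrite [RHS](iid_resample k).
apply: eq_iid => r; rewrite subSn; last by rewrite -ltnS.
apply: eq_bigr => x _; congr (_ * _).
have fE : free (upd r k x) k = free r k.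
  apply: free_online => [|j jk]; first exact: ltnW.
  by rewrite /upd ffunE -val_eqE (ltn_eqF jk).
by rewrite /F fE /upd ffunE eqxx.
Qed.

Lemma greedy_cost : E (fun r => matching_cost r (greedy r)) = opt_val n [set: X].
Proof.
have H k : (k <= n)%N -> E (fun r => potential r k) = opt_val n [set: X].
  elim: k => [|k IHk] kn.
    rewrite -[RHS](iid_cst I); apply: eq_iid => r.
    by rewrite /potential big_pred0 // add0r subn0.
  by rewrite -(IHk (ltnW kn)) (potentialS (Ordinal kn)).
rewrite -(H n (leqnn _)); apply: eq_iid => r; rewrite /potential subnn addr0.
by apply: eq_bigl => i; rewrite ltn_ord.
Qed.

(** The request law is replaced by the uniform law on all servers, at cost E[OPT] / n, and then by
    the uniform law on S, at a cost given by the norm. A request located at s in S can use s for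
    free. *)
Lemma val_le k S : #|S| = k.+1 ->
  opt_val k.+1 S <= expected_OPT I / n%:R +
    (knorm (sdist I) (fun x => (x \in S)%:R) + \sum_(s in S) opt_val k (S :\ s)) / k.+1%:R.
Proof.
move=> Sk; set g := service (I := I) S (after k S) (some_in S).
have S0 : (0 < #|S|)%N by rewrite Sk.
have gL : plip g by apply: service_lip; apply: some_inP.
have n0 : (0 : R) < n%:R by rewrite ltr0n.
have k0 : (0 : R) < k.+1%:R by rewrite ltr0n.
pose f i := g (srv i).
have fL : lip (sdist I) f by move=> x y; apply: gL.
have h1 : opt_val k.+1 S <= expected_OPT I / n%:R + avg f.
  have -> : avg f = (\sum_i g (srv i)) / n%:R by rewrite /avg card_ord.
  rewrite -mulrDl ler_pdivlMr // mulrC; have := plip_law_le gL.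
  by rewrite -/(opt_val k.+1 S) lerBlDr.
apply: (le_trans h1); rewrite lerD2l ler_pdivlMr //.
have h2 : \sum_(s in S) f s <= \sum_(s in S) opt_val k (S :\ s).
  apply: ler_sum => s sS; have [_ /(_ s sS)] := bestP (after k S) (srv s) (some_inP S0).
  by rewrite mdistxx add0r.
have := knorm_pairing (sdistP I) (fun x => (x \in S)%:R) fL.
have -> : pairing (fun x => (x \in S)%:R) f = \sum_(s in S) f s - avg f * k.+1%:R.
  rewrite /pairing [X in X - _]big_mkcond -Sk -sumr_const mulr_sumr [X in _ - X]big_mkcond -sumrB.
  by apply: eq_bigr => x _; case: (x \in S); rewrite ?mul1r ?mul0r ?mulr1 ?subrr.
by rewrite ler_norml => /andP[h3 _]; lra.
Qed.

(** Removing a point from the fixed set K commutes with the random relabelling, so the induction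
    passes from uniform sets to uniform sets and needs only mean norms. *)
Lemma avg_val_le (tau : nat -> R) (K : {set X}) :
  (forall L : {set X}, subsetnorm (sdist I) L <= tau #|L|) ->
  avg (fun p : 'S_n => opt_val #|K| [set x | p x \in K]) <=
  \sum_(j < #|K|) (expected_OPT I / n%:R + tau j.+1 / j.+1%:R).
Proof.
move=> tauP; move Kk : #|K| => k; elim: k K Kk => [|k IHk] K Kk.
  by rewrite big_ord0 /= avg_le_const.
have k0 : (0 : R) < k.+1%:R by rewrite ltr0n.
pose S (p : 'S_n) (L : {set X}) : {set X} := [set x | p x \in L].
have cS p : #|S p K| = k.+1.
  rewrite -Kk; have -> : S p K = (p^-1)%g @: K.
    apply/setP => x; rewrite inE; apply/idP/imsetP => [pK|[y yK ->]].
      by exists (p x); rewrite ?permK.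
    by rewrite permKV.
  by rewrite card_imset //; apply: perm_inj.
have step p : opt_val k.+1 (S p K) <= expected_OPT I / n%:R +
   k.+1%:R^-1 * (knorm (sdist I) (fun x => (p x \in K)%:R) + \sum_(y in K) opt_val k (S p (K :\ y))).
  apply: le_trans (val_le (cS p)) _; rewrite lerD2l mulrC ler_wpM2l ?invr_ge0 ?ler0n //.
  apply: lerD.
    by rewrite le_eqVlt; apply/orP; left; apply/eqP; congr knorm; apply/funext => x; rewrite inE.
  rewrite [leRHS](reindex_inj (@perm_inj _ p)) /= le_eqVlt; apply/orP; left; apply/eqP.
  apply: eq_big => [x|x _]; first by rewrite inE.
  by congr (opt_val k _); apply/setP => z; rewrite !inE (inj_eq perm_inj).
apply: le_trans (ler_avg step) _.
rewrite avgD (avg_const (1%g : 'S_n)) avgZ avgD -/(subsetnorm _ K) avg_sum.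
rewrite big_ord_recr /= [leRHS]addrC -addrA lerD2l mulrDr lerD //.
  by rewrite mulrC ler_wpM2r ?invr_ge0 ?ler0n // -Kk tauP.
rewrite ler_pdivrMl // -Kk mulr_natl -sumr_const; apply: ler_sum => y yK.
have cK : #|K :\ y| = k by have := cardsD1 y K; rewrite yK Kk => -[].
exact: IHk cK.
Qed.

End OptimalPolicy.

(** * Summation over the number of free servers *)

Section NumericalSums.
Variable R : realType.

Lemma harmonic_step (N : nat) : (0 < N)%N -> ln N%:R + N.+1%:R^-1 <= ln (N.+1%:R : R).
Proof.
move=> N0; have n0 : (0 : R) < N%:R by rewrite ltr0n.
have n1 : (0 : R) < N.+1%:R by rewrite ltr0n.
have h : ln (N%:R / N.+1%:R : R) <= - N.+1%:R^-1.
  have -> : N%:R / N.+1%:R = 1 + (- N.+1%:R^-1) :> R.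
    by rewrite -[X in X / _](addrK 1) natr1 mulrBl mulfV ?gt_eqF // mul1r.
  apply: le_ln1Dx; rewrite ltrN2 invf_lt1 // ltr1n //.
rewrite ln_div ?posrE // in h.
by move: h; move: (ln _) (ln _) (_^-1) => a b c; lra.
Qed.

Lemma harmonic_below (A : R) (N : nat) : 1 <= A ->
  \sum_(j < N) (j.+1%:R <= A)%R%:R / j.+1%:R <= 1 + ln A.
Proof.
move=> A1; have l0 : 0 <= ln A by apply: ln_ge0.
(* The bound by ln N carries the induction while N stays below A; afterwards the sum no longer
   changes. *)
suff: \sum_(j < N) (j.+1%:R <= A)%R%:R / j.+1%:R <= 1 + ln A /\
   ((0 < N)%N -> \sum_(j < N) (j.+1%:R <= A)%R%:R / j.+1%:R <= 1 + ln (N%:R : R)) by case.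
elim: N => [|N [IH1 IH2]]; first by rewrite big_ord0; split => //; lra.
rewrite big_ord_recr /=; case: (posnP N) => [->|N0].
  rewrite big_ord0 add0r ln1 addr0 divr1.
  have h : (1 <= A)%R%:R <= 1 :> R by rewrite lern1 leq_b1.
  by split => //; lra.
have h2 := IH2 N0; have st := harmonic_step N0.
have : 0 <= N.+1%:R^-1 :> R by rewrite invr_ge0.
move: (N.+1%:R^-1) st => i st i0.
case: (boolP (N.+1%:R <= A)%R) => [NA|_]; rewrite /= ?mul0r ?mul1r ?addr0; split => //.
- have : ln (N.+1%:R : R) <= ln A by rewrite ler_ln ?posrE //; lra.
  lra.
- by move=> _; lra.
- by move=> _; lra.
Qed.

Lemma harmonic_above (D : R) (n N : nat) : 0 < D -> (0 < n)%N ->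
  \sum_(j < N) (n%:R < D * j.+1%:R)%R%:R / j.+1%:R <=
  if n%:R < D * N%:R then 1 + ln (D * N%:R / n%:R) else 0.
Proof.
move=> D0 n0; have np : (0 : R) < n%:R by rewrite ltr0n.
elim: N => [|N IH]; first by rewrite big_ord0 mulr0 ltrn0.
rewrite big_ord_recr /=; case: (ltP n%:R (D * N.+1%:R)) => [c|c] /=; last first.
  move: IH; rewrite mul0r addr0 ltNge (le_trans _ c) //.
  by rewrite ler_pM2l // ler_nat.
rewrite mul1r.
have l0 : 0 <= ln (D * N.+1%:R / n%:R) by apply: ln_ge0; rewrite ler_pdivlMr // mul1r ltW.
move: IH; case: ifP => [c2|_] IH; last first.
  have : N.+1%:R^-1 <= 1 :> R by rewrite invf_le1 ?ler1n ?ltr0n.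
  by move: l0 IH; move: (N.+1%:R^-1) (ln _) (\sum_(_ < _) _) => i l s; lra.
have N0 : (0 < N)%N by case: N c2 {IH c l0} => //; rewrite mulr0 ltrn0.
have := harmonic_step N0.
have E k : (0 < k)%N -> ln (D * k%:R / n%:R) = ln D + ln (k%:R : R) - ln n%:R.
  by move=> k0; rewrite ln_div ?lnM ?posrE ?mulr_gt0 ?ltr0n.
rewrite !E // in IH *; move: IH.
by move: (N.+1%:R^-1) (ln _) (ln _) (ln _) (ln _) => i a b c2' e; lra.
Qed.

Definition root4 (x : R) : R := Num.sqrt (Num.sqrt x).

Lemma root4_ge0 x : 0 <= root4 x. Proof. exact: sqrtr_ge0. Qed.

Lemma root4_pow x : 0 <= x -> root4 x ^+ 4 = x.
Proof.
move=> x0; rewrite -[4%N]/(2 * 2)%N exprM sqr_sqrtr ?sqrtr_ge0 // sqr_sqrtr //.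
Qed.

Lemma root4M x y : 0 <= x -> root4 (x * y) = root4 x * root4 y.
Proof. by move=> x0; rewrite /root4 sqrtrM // sqrtrM ?sqrtr_ge0. Qed.

Lemma ler_root4 x y : x <= y -> root4 x <= root4 y.
Proof. by move=> xy; do 2 apply: ler_wsqrtr. Qed.

(** A discrete derivative: (u^4 - w^4) / u^3 <= 4 (u - w) for 0 <= w <= u, by factoring the
    difference of fourth powers. *)
Lemma root4_step (n j : nat) : (0 < n)%N ->
  root4 (j.+1%:R / n%:R) / j.+1%:R <= 4 * (root4 (j.+1%:R / n%:R) - root4 (j%:R / n%:R)).
Proof.
move=> n0; have np : (0 : R) < n%:R by rewrite ltr0n.
have jp : (0 : R) < j.+1%:R by rewrite ltr0n.
set u := root4 (j.+1%:R / n%:R); set w := root4 (j%:R / n%:R).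
have u4 : u ^+ 4 = j.+1%:R / n%:R by apply: root4_pow; rewrite divr_ge0 // ltW.
have w4 : w ^+ 4 = j%:R / n%:R by apply: root4_pow; rewrite divr_ge0 // ltW.
have w0 : 0 <= w := root4_ge0 _.
have wu : w <= u by apply: ler_root4; rewrite ler_pM2r ?invr_gt0 // ler_nat.
have up : 0 < u.
  rewrite lt_def (le_trans w0 wu) andbT; apply/negP => /eqP u0; move: u4.
  by rewrite u0 expr0n /= => /esym/eqP; rewrite gt_eqF // divr_gt0.
have diff : u ^+ 4 - w ^+ 4 = u ^+ 4 / j.+1%:R.
  rewrite u4 w4 -natr1; field; rewrite natr1 ?gt_eqF //.
have -> : u / j.+1%:R = (u ^+ 4 - w ^+ 4) / u ^+ 3.
  by rewrite diff; field; rewrite !gt_eqF.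
rewrite ler_pdivrMr ?exprn_gt0 //.
have u0 := ltW up.
have a1 : u ^+ 2 * w <= u ^+ 3.
  by rewrite [leRHS]exprSr ler_wpM2l ?exprn_ge0.
have a2 : u * w ^+ 2 <= u ^+ 3.
  by rewrite [leRHS]exprS ler_wpM2l // lerXn2r ?nnegrE.
have a3 : w ^+ 3 <= u ^+ 3 by rewrite lerXn2r ?nnegrE.
have duw : 0 <= u - w by rewrite subr_ge0.
have := ler_wpM2l duw (lerD (lerD a1 a2) a3); lra.
Qed.

Lemma root4_sum (n N : nat) (c : R) : (0 < n)%N -> 0 < c ->
  \sum_(j < N) (c ^+ 4 * j.+1%:R <= n%:R)%R%:R * (root4 (j.+1%:R / n%:R) / j.+1%:R) <= 4 / c.
Proof.
move=> n0 c0; have np : (0 : R) < n%:R by rewrite ltr0n.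
have c40 : 0 < c ^+ 4 by rewrite exprn_gt0.
pose S N := \sum_(j < N) (c ^+ 4 * j.+1%:R <= n%:R)%R%:R * (root4 (j.+1%:R / n%:R) / j.+1%:R).
suff: S N <= 4 / c /\ S N <= 4 * root4 (N%:R / n%:R) by case.
elim: N => [|N [IH1 IH2]].
  rewrite /S !big_ord0; split; last by rewrite mulr_ge0 // root4_ge0.
  by rewrite divr_ge0 // ltW.
have mono : root4 (N%:R / n%:R) <= root4 (N.+1%:R / n%:R).
  by apply: ler_root4; rewrite ler_pM2r ?invr_gt0 // ler_nat.
rewrite /S big_ord_recr /= -/(S N).
case: (boolP (c ^+ 4 * N.+1%:R <= n%:R)%R) => [h|_] /=; last first.
  by rewrite mul0r addr0; split => //; lra.
have st := root4_step N n0; rewrite mul1r.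
have hu : S N + root4 (N.+1%:R / n%:R) / N.+1%:R <= 4 * root4 (N.+1%:R / n%:R).
  by apply: le_trans (lerD IH2 st) _; rewrite mulrBr addrC subrK.
split => //; apply: (le_trans hu); rewrite ler_wpM2l //.
have -> : c^-1 = root4 (c^-1 ^+ 4).
  rewrite /root4 -[4%N]/(2 * 2)%N exprM sqrtr_sqr ger0_norm ?sqr_ge0 // sqrtr_sqr ger0_norm //.
  by rewrite invr_ge0 ltW.
apply: ler_root4; rewrite ler_pdivrMr // exprVn.
by rewrite -(ler_pM2l c40) mulrA mulfV ?mul1r ?gt_eqF.
Qed.

End NumericalSums.

(** * The decay of T(k) for small k / n *)

Section SmallSubsets.
Variables (R : realType) (X : finType) (d : X -> X -> R).
Hypothesis dP : pseudometric d.
Local Notation n := (#|X|%:R : R).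

Lemma subsetnorm_small (K : {set X}) (A : R) :
  (3 <= #|X|)%N -> A = 16 * (ln (ln n) + 1) -> A <= #|K|%:R -> (16 * #|K| <= #|X|)%N ->
  subsetnorm d K <= 105 * 10 ^+ 3 * (root4 A ^+ 3 * root4 (#|K|%:R / n)) * signnorm d.
Proof.
move=> X3 AE AK K16; set k := #|K| in AK K16 *.
have B0 := signnorm_ge0 dP.
have A16 : 16 <= A.
  by have := ln_ge0 (ln_ge1 R X3); rewrite AE; lra.
have k0 : (0 < k)%N by rewrite -(ltr0n R); lra.
have n0 : 0 < n by rewrite ltr0n (leq_trans _ X3).
have kp : (0 : R) < k%:R by rewrite ltr0n.
(* The sampling rate is 1 / Q: rounding down ensures 8 k <= n * eps, and Q >= 2 keeps eps within 16
   k / n while making q positive. *)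
pose Q := (#|X| %/ (8 * k))%N.
have Q2 : (2 <= Q)%N by rewrite leq_divRL ?muln_gt0 // mulnA.
have Qle : (Q * (8 * k) <= #|X|)%N by apply: leq_divM.
have Qlt : (#|X| < Q.+1 * (8 * k))%N by rewrite -ltn_divLR ?muln_gt0.
have [q qE] : exists q, Q = q.+1 by exists Q.-1; rewrite prednK // ltnW.
have q0 : (0 < q)%N by rewrite qE in Q2.
set eps : R := q.+1%:R^-1.
have Qp : (0 : R) < q.+1%:R by rewrite ltr0n.
have e0 : 0 < eps by rewrite invr_gt0.
have e1 : eps <= 1 by rewrite invf_le1 // ler1n.
have kn : 8 * k%:R <= n * eps.
  rewrite ler_pdivlMr // -!natrM ler_nat -qE mulnC //.
have ek : eps <= 16 * (k%:R / n).
  rewrite mulrA ler_pdivlMr // mulrC ler_pdivrMr // -!natrM ler_nat -qE.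
  by apply: leq_trans (ltnW Qlt) _; nia.
pose a := root4 A; pose e := root4 eps; pose s := a / e.
have a4 : a ^+ 4 = A by apply: root4_pow; lra.
have e4 : e ^+ 4 = eps by apply: root4_pow; exact: ltW.
have a0 : 0 <= a := root4_ge0 _.
have e00 : 0 <= e := root4_ge0 _.
have ep : 0 < e.
  by rewrite lt_def e00 andbT; apply: contraTneq e0 => E; rewrite -e4 E expr0n ltxx.
have a1 : 1 <= a.
  rewrite leNgt; apply/negP => alt; have : a ^+ 4 <= 1 by rewrite exprn_ile1 // ltW.
  by rewrite a4; lra.
have e11 : e <= 1.
  rewrite leNgt; apply/negP => egt; have : 1 < e ^+ 4 by rewrite exprn_egt1.
  by rewrite e4 ltNge e1.
have s0 : 0 <= s by rewrite divr_ge0.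
have s4 : s ^+ 4 = A * q.+1%:R by rewrite exprMn exprVn a4 e4 invrK.
have s1 : 1 <= s by rewrite ler_pdivlMr // mul1r; lra.
(* As s^4 = A / eps, m = p^2 is the least order allowed by [far_bound]; rounding costs at most a
   factor 2 in p because s >= 1. *)
pose p := (Num.truncn (s ^+ 2)).+1.
have s20 : 0 <= s ^+ 2 by rewrite exprn_ge0.
have /andP[pl pu] := truncn_itv s20; rewrite -/p in pu.
have p2s : p%:R <= 2 * s ^+ 2 :> R.
  have : 1 <= s ^+ 2 by rewrite exprn_ege1.
  by rewrite /p -natr1; lra.
have p2 : s ^+ 4 <= (p ^ 2)%:R.
  by rewrite natrX -[4%N]/(2 * 2)%N exprM lerXn2r ?nnegrE ?(ltW pu).
have pX : (2 * p ^ 2 <= #|X|)%N.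
  have h : (p ^ 2)%:R <= 4 * (A * q.+1%:R).
    rewrite -s4 natrX; apply: (@le_trans _ _ ((2 * s ^+ 2) ^+ 2)).
      by rewrite lerXn2r ?nnegrE ?ler0n ?(mulr_ge0 _ s20).
    by rewrite exprMn -exprM; lra.
  (* The assumption A <= k enters here: it keeps the neighbourhood size p^2 within n / 2. *)
  have h2 : A * q.+1%:R <= k%:R * q.+1%:R by rewrite ler_wpM2r // ltW.
  have h3 : (2 * p ^ 2)%:R <= (8 * (k * q.+1))%:R :> R by rewrite !natrM; rewrite natrM in h; lra.
  rewrite ler_nat in h3; apply: (leq_trans h3); by rewrite mulnA mulnC -qE.
have Ap : A <= eps * (p ^ 2)%:R.
  by rewrite mulrC -ler_pdivrMr // /eps invrK -s4.
have lA : 16 * (ln (ln n) + 1) <= A by rewrite AE.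
have sub := subnorm_le dP X3 (isT : (0 < p)%N) pX lA Ap.
have K0 : (0 < #|K|)%N by [].
have tau := subsetnorm_le_subnorm dP q0 K0 kn.
have ppp : p%:R * Num.sqrt p%:R * eps <= 3 * (a ^+ 3 * e).
  have sp : Num.sqrt (p%:R : R) <= 3 / 2 * s.
    have s32 : 0 <= 3 / 2 * s by rewrite mulr_ge0.
    rewrite -(@ler_pXn2r _ 2) ?nnegrE ?sqrtr_ge0 // sqr_sqrtr ?ler0n //.
    apply: (le_trans p2s); have -> : (3 / 2 * s) ^+ 2 = 9 / 4 * s ^+ 2 by field.
    lra.
  have : p%:R * Num.sqrt p%:R <= (2 * s ^+ 2) * (3 / 2 * s).
    by apply: ler_pM => //; rewrite ?ler0n ?sqrtr_ge0.
  move=> /(ler_wpM2r (ltW e0)) h; apply: (le_trans h).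
  rewrite le_eqVlt; apply/orP; left; apply/eqP.
  by rewrite -e4 /s; field; rewrite gt_eqF.
have sq : Num.sqrt (A * eps) <= a ^+ 3 * e.
  have -> : Num.sqrt (A * eps) = a ^+ 2 * e ^+ 2.
    by rewrite -a4 -e4 sqrtrM ?exprn_ge0 // -[4%N]/(2 * 2)%N !exprM !sqrtr_sqr !ger0_norm ?sqr_ge0.
  have -> : a ^+ 2 * e ^+ 2 = (a ^+ 2 * e) * e by ring.
  have -> : a ^+ 3 * e = (a ^+ 2 * e) * a by ring.
  by rewrite ler_wpM2l ?mulr_ge0 ?sqr_ge0 //; lra.
have ekn : e <= 2 * root4 (k%:R / n).
  have -> : 2 = root4 16 :> R.
    rewrite /root4 (_ : 16 = (2 ^+ 2) ^+ 2) ?sqrtr_sqr ?ger0_norm //; last by ring.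
    by rewrite sqrtr_sqr ger0_norm.
  by rewrite -root4M //; apply: ler_root4.
apply: (le_trans tau).
apply: (@le_trans _ _ (6 * ((8728 * (a ^+ 3 * e)) * signnorm d))).
  rewrite ler_pM2l //; apply: (le_trans sub); rewrite ler_wpM2r //.
  rewrite -[2304 * _ * _]mulrA.
  by move: ppp sq; move: (p%:R * _ * eps) (Num.sqrt (A * eps)) (a ^+ 3 * e) => x y z; lra.
rewrite mulrA ler_wpM2r //.
have a30 : 0 <= a ^+ 3 by rewrite exprn_ge0.
have := ler_wpM2l a30 ekn; have := mulr_ge0 a30 (root4_ge0 (k%:R / n)).
rewrite -/a; move: (a ^+ 3) (root4 _) => x y; lra.
Qed.

End SmallSubsets.

(** * The competitive ratio *)

Section Competitive.
Variable R : realType.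

Definition lllog (n : nat) : R := Num.max 1 (ln (ln (ln n%:R)) ^+ 2).

(** ln A is linear in the triple logarithm x, and x <= (1 + x^2) / 2 passes to the square. When ln
    ln n <= 1 the triple logarithm may be very negative, and the term 1 of the maximum is used
    instead. *)
Lemma ln_scale_le (n : nat) : (3 <= n)%N ->
  ln (16 * (ln (ln n%:R) + 1)) <= 17 * lllog n :> R.
Proof.
move=> n3; rewrite /lllog; set l : R := ln (ln n%:R).
have l0 : 0 <= l by apply: ln_ge0; apply: ln_ge1.
set mx := Num.max _ _.
have mx1 : 1 <= mx by rewrite le_max lexx.
have mx2 : ln l ^+ 2 <= mx by rewrite le_max lexx orbT.
have l16 : ln 16 <= 15 :> R.
  rewrite (_ : 16 = 1 + 15); last by ring.
  by apply: le_ln1Dx; lra.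
rewrite lnM ?posrE //; last by lra.
suff : ln (l + 1) <= 2 * mx by lra.
have [l1|l1] := leP l 1.
  by have := @le_ln1Dx R l; rewrite addrC => /(_ ltac:(lra)); lra.
have lp : 0 < l by lra.
apply: (@le_trans _ _ (ln (2 * l))); first by rewrite ler_ln ?posrE ?mulr_gt0 //; lra.
rewrite lnM ?posrE //.
have : ln 2 <= 1 :> R.
  rewrite (_ : 2 = 1 + 1); last by ring.
  by apply: le_ln1Dx; lra.
have := sqr_ge0 (ln l - 1); move: mx2; move: (ln l) => x mx2; nra.
Qed.

Variables (m : nat) (I : instance R m.+1).
Local Notation n := (m.+1).
Local Notation EO := (expected_OPT I).

Lemma val_le_sum (tau : nat -> R) :
  (forall L : {set 'I_n}, subsetnorm (sdist I) L <= tau #|L|) ->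
  opt_val I n [set: 'I_n] <= EO + \sum_(j < n) tau j.+1 / j.+1%:R.
Proof.
move=> tauP; have := avg_val_le [set: 'I_n] tauP.
rewrite cardsT card_ord big_split sumr_const card_ord -[_ *+ n]mulr_natr divfK ?pnatr_eq0 //.
apply: le_trans; rewrite -[leLHS](avg_const (1%g : 'S_n)).
by apply: ler_avg => p; rewrite (_ : [set x | p x \in [set: _]] = [set: 'I_n]) //;
  apply/setP => x; rewrite !inE.
Qed.

Lemma val_competitive : opt_val I n [set: 'I_n] <= 3361 * 10 ^+ 3 * lllog n * EO.
Proof.
have dP := sdistP I.
have EO0 : 0 <= EO := expected_OPT_ge0 I.
have mx1 : 1 <= lllog n by rewrite le_max lexx.
have triv (L : {set 'I_n}) : subsetnorm (sdist I) L <= 4 * EO by apply: subsetnorm_le_OPT.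
have [n3|n3] := leqP 3 n; last first.
  have := val_le_sum (tau := fun=> 4 * EO) triv => h; apply: (le_trans h).
  have : \sum_(j < n) 4 * EO / j.+1%:R <= \sum_(j < n) 4 * EO :> R.
    apply: ler_sum => j _; rewrite ler_piMr ?mulr_ge0 // invf_le1 ?ler1n ?ltr0n //.
  rewrite sumr_const card_ord -[_ *+ n]mulr_natl => h2.
  have n2 : n%:R <= 2 :> R by rewrite ler_nat -ltnS.
  have h3 := ler_wpM2r (mulr_ge0 (ler0n R 4) EO0) n2.
  apply: (le_trans (lerD (lexx EO) (le_trans h2 h3))).
  by have := ler_wpM2r EO0 mx1; lra.
set ell : R := ln (ln n%:R).
pose A : R := 16 * (ell + 1).
have ell0 : 0 <= ell by apply: ln_ge0; apply: ln_ge1.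
have A16 : 16 <= A by rewrite /A; lra.
have A0 : 0 <= A by lra.
(* c = A^(3/4) is the prefactor in the bound of T(k), and c^4 = A^3 is the cutoff that makes
   [root4_sum] return 4 / c. *)
pose a := root4 A; pose c := a ^+ 3.
have a4 : a ^+ 4 = A by apply: root4_pow.
have a0 : 0 < a.
  rewrite lt_def root4_ge0 andbT; apply/negP => /eqP E; move: a4; rewrite E expr0n /=.
  by move=> A00; lra.
have c0 : 0 < c by rewrite exprn_gt0.
have c4 : c ^+ 4 = A ^+ 3 by rewrite -a4 -!exprM.
have c416 : 16 <= c ^+ 4.
  rewrite c4; have : 1 <= A ^+ 2 by rewrite exprn_ege1 //; lra.
  by move=> A2; rewrite exprS; nra.
(* 840 = 105 * 8, the mean norm of the signs being at most 8 E[OPT]. *)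
pose g (j : nat) : R := 840 * 10 ^+ 3 * (c * root4 (j%:R / n%:R)).
have g0 j : 0 <= g j.
  by apply: mulr_ge0; [apply: mulr_ge0; rewrite ?exprn_ge0 ?ler0n|apply: mulr_ge0; rewrite ?root4_ge0 ?ltW].
pose tau (j : nat) : R := EO * (4 * (j%:R <= A)%R%:R + 4 * (n%:R < c ^+ 4 * j%:R)%R%:R +
   (c ^+ 4 * j%:R <= n%:R)%R%:R * g j).
have BEO : signnorm (sdist I) <= 2 * (4 * EO) by apply: signnorm_le_subsetnorm.
have tauP (L : {set 'I_n}) : subsetnorm (sdist I) L <= tau #|L|.
  rewrite /tau; set k := #|L|.
  have gk : 0 <= (c ^+ 4 * k%:R <= n%:R)%R%:R * g k by rewrite mulr_ge0 // ler0n.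
  have [kA|kA] := leP (k%:R) A.
    apply: (le_trans (triv L)); rewrite mulrC ler_wpM2l //=.
    by rewrite mulr1 -addrA lerDl addr_ge0 // mulr_ge0 // ler0n.
  have [kn|kn] := ltP (n%:R) (c ^+ 4 * k%:R).
    apply: (le_trans (triv L)); rewrite mulrC ler_wpM2l //=.
    by rewrite mulr0 add0r mulr1 mul0r addr0.
  have k16 : (16 * k <= n)%N.
    rewrite -(ler_nat R) natrM; apply: le_trans kn; rewrite ler_wpM2r ?ler0n //.
  have X3 : (3 <= #|'I_n|)%N by rewrite card_ord.
  have := @subsetnorm_small R 'I_n (sdist I) dP L A X3; rewrite card_ord.
  move=> /(_ erefl (ltW kA) k16) h; apply: (le_trans h).
  rewrite /= mulr0 addr0 add0r mul1r /g -/a -/c -/k.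
  have y0 : 0 <= c * root4 (k%:R / n%:R) by rewrite mulr_ge0 ?root4_ge0 // ltW.
  have := ler_wpM2l y0 BEO; move: (c * root4 _) y0 => y y0 h2.
  by lra.
apply: le_trans (val_le_sum tauP) _.
have -> : \sum_(j < n) tau j.+1 / j.+1%:R = EO * (4 * (\sum_(j < n) (j.+1%:R <= A)%R%:R / j.+1%:R)
  + 4 * (\sum_(j < n) (n%:R < c ^+ 4 * j.+1%:R)%R%:R / j.+1%:R)
  + 840 * 10 ^+ 3 * c * (\sum_(j < n) (c ^+ 4 * j.+1%:R <= n%:R)%R%:R *
      (root4 (j.+1%:R / n%:R) / j.+1%:R))).
  rewrite !mulr_sumr -!big_split mulr_sumr; apply: eq_bigr => j _ /=.
  by rewrite /tau /g; ring.
have A1 : 1 <= A by lra.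
have s1 := harmonic_below n A1.
have s2 : \sum_(j < n) (n%:R < c ^+ 4 * j.+1%:R)%R%:R / j.+1%:R <= 1 + 3 * ln A :> R.
  apply: (le_trans (@harmonic_above R (c ^+ 4) n n _ _)) => //; first by rewrite exprn_gt0.
  have lA0 : 0 <= ln A by apply: ln_ge0.
  case: ifP => _; last by lra.
  by rewrite mulfK ?pnatr_eq0 // c4 lnXn; [rewrite -mulr_natl; lra|lra].
have s3 := @root4_sum R n n c (ltn0Sn m) c0.
have s3c := ler_wpM2l (ltW c0) s3; rewrite mulrCA mulfV ?mulr1 ?gt_eqF // in s3c.
have lA := ln_scale_le n3; rewrite -/ell -/A in lA.
move: s1 s2 s3c; move: (\sum_(_ < _) _) (\sum_(_ < _) _) (\sum_(_ < _) _) => z y x s1 s2 s3c.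
(* The two ends give 8 + 16 ln A with ln A <= 17 [lllog n], hence 280; the middle range gives 840 *
   4 = 3360 thousand. *)
have tot : 4 * x + 4 * y + 840 * 10 ^+ 3 * c * z <= (280 + 3360 * 10 ^+ 3) * lllog n.
  rewrite -mulrA; lra.
apply: (le_trans (lerD (lexx EO) (ler_wpM2l EO0 tot))).
by have := ler_wpM2l EO0 mx1; move: EO0; move: EO (lllog n) => u w; lra.
Qed.

End Competitive.

Section Policy.
Variable R : realType.

(** The optimal policy is deterministic, so a one-point seed suffices. *)
Definition greedy_policy (m : nat) (I : instance R m.+1) : policy I :=
  @Policy R m.+1 I _ unit (dirac tt) (fun _ => @greedy R m I) (fun _ _ _ => Logic.I)
    (fun _ => @greedy_online R m I) (fun _ => @greedy_unmatched R m I).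

Lemma ex_competitive_policy (n : nat) (I : instance R n) : exists A : policy I,
  (expected_ALG A <= (3361 * 10 ^+ 3 * lllog R n * expected_OPT I)%:E)%E.
Proof.
case: n I => [|m] I.
  have on : forall (w : unit) (r r' : requests I) (i : 'I_0),
    (forall j : 'I_0, (j <= i)%N -> r j = r' j) -> i = i by [].
  have un : forall (w : unit) (r : requests I) (i j : 'I_0), (j < i)%N -> i != j by move=> ? ? [].
  exists (@Policy R 0 I _ unit (dirac tt) (fun _ _ i => i) (fun _ _ _ => Logic.I) on un).
  rewrite /expected_ALG (_ : (fun _ => _) = cst 0); last first.
    apply/funext => w; rewrite -[RHS](iid_cst I); apply: eq_iid => r.
    by rewrite /ALG /matching_cost big_ord0.
  rewrite expectation_cst lee_fin; apply: mulr_ge0; last exact: expected_OPT_ge0.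
  apply: mulr_ge0; first by apply: mulr_ge0; rewrite ?exprn_ge0 ?ler0n.
  by rewrite le_max ler01.
exists (greedy_policy I); rewrite /expected_ALG.
rewrite (_ : (fun _ => _) = cst (opt_val I m.+1 [set: 'I_m.+1])); last first.
  by apply/funext => w; rewrite -greedy_cost.
by rewrite expectation_cst lee_fin val_competitive.
Qed.

End Policy.

Theorem theorem1 (R : realType) :
  exists (A : online_algorithm R) (C : R),
    0 < C /\
    forall (n : nat) (I : instance R n),
      (expected_ALG (A n I) <=
       (C * Num.max 1 (ln (ln (ln n%:R)) ^+ 2) * expected_OPT I)%:E)%E.
Proof.
exists (fun n I => projT1 (cid (ex_competitive_policy I))), (3361 * 10 ^+ 3).
split; first by apply: mulr_gt0; rewrite ?exprn_gt0 ?ltr0n.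
by move=> n I; case: cid.
Qed.
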